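(* Let $\mathcal K$ be an $\infty$-cosmos. The simplicial category $\mathcal{L}a(\mathcal K)$ of isofibrations of $\mathcal K$ which are left adjoints, and morphisms of left adjoints, is an $\infty$-cosmos (with isofibrations the $0$-arrows of $\mathcal{L}a(\mathcal K)$ that are isofibrations of $\mathcal K^{\mathrm{isof}}$).
   Context: An $\infty$-cosmos is a category enriched in quasi-categories with a class of $0$-arrows (vertices of homs) called isofibrations ($\twoheadrightarrow$), such that: it has a terminal object, small products, pullbacks of isofibrations, limits of countable chains of isofibrations, and powers by simplicial sets, each satisfying a simplicially enriched universal property; isofibrations contain all isomorphisms and all $0$-arrows to the terminal object, are closed under composition, products, pullback, limits of countable chains, and Leibniz exponentials with monomorphisms of simplicial sets, and if $f\colon A\twoheadrightarrow B$ is an isofibration then $\mathcal K(X,f)$ is an isofibration of quasi-categories for every object $X$. The homotopy $2$-category $h\mathcal K$ has the same objects as $\mathcal K$ and hom-categories the homotopy categories of the quasi-categories $\mathcal K(A,B)$. $\mathcal K^{\mathrm{isof}}$ is the $\infty$-cosmos with objects the isofibrations $p\colon E\twoheadrightarrow B$ of $\mathcal K$, with hom from $p_1\colon E_1\twoheadrightarrow B_1$ to $p_2\colon E_2\twoheadrightarrow B_2$ the pullback $\mathcal K(E_1,E_2)\times_{\mathcal K(E_1,B_2)}\mathcal K(B_1,B_2)$; its $0$-arrows are commutative squares $(e\colon E_1\to E_2,\,b\colon B_1\to B_2)$, $p_2e=bp_1$, called morphisms of isofibrations. Its isofibrations are the $(e,b)$ with $e$, $b$ and the induced map $E_1\to B_1\times_{B_2}E_2$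 isofibrations of $\mathcal K$. Its limits are computed pointwise. $\mathcal{L}a(\mathcal K)$ is the simplicial subcategory of $\mathcal K^{\mathrm{isof}}$ whose objects are the isofibrations $p\colon E\twoheadrightarrow B$ of $\mathcal K$ that are left adjoints in $h\mathcal K$, whose $0$-arrows are the morphisms of left adjoints, and which is full on $n$-arrows ($n$-simplices of homs) for $n>0$ (i.e. its homs are the full simplicial subsets of the homs of $\mathcal K^{\mathrm{isof}}$ spanned by these $0$-arrows). Here, for $p_i\dashv r_i$ with unit $\eta_i$ and counit $\epsilon_i$ ($i=1,2$), a morphism of isofibrations $(e,b)\colon p_1\to p_2$ is a morphism of left adjoints if its mate $er_1\Rightarrow r_2p_2er_1=r_2bp_1r_1\Rightarrow r_2b$ (given by $\eta_2$ followed by $\epsilon_1$) is invertible in $h\mathcal K$. *)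

(* Defs.v *)
From mathcomp Require Import all_boot.
From mathcomp Require Import boolp.
Set Implicit Arguments.
Unset Strict Implicit.
Unset Printing Implicit Defensive.

(* [mono m n] is the set of morphisms [m] -> [n] of the simplex category, [n]
   being the ordinal {0 < ... < n}, that is ['I_n.+1]. *)
Record mono (m n : nat) := Mono {
  mono_fun :> 'I_m.+1 -> 'I_n.+1;
  mono_homo : forall i j : 'I_m.+1, i <= j -> mono_fun i <= mono_fun j }.

Lemma mono_eq m n (a b : mono m n) : a =1 b -> a = b.
Proof.
case: a b => [a Ha] [b Hb] /= /funext E; subst b.
by rewrite (Prop_irrelevance Ha Hb).
Qed.

Definition mono_id n : mono n n := @Mono n n id (fun _ _ H => H).
Definition mono_comp l m n (a : mono m n) (b : mono l m) : mono l n :=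
  @Mono l n (fun i => a (b i)) (fun _ _ H => mono_homo a (mono_homo b H)).
Definition mono_cst m n (i : 'I_n.+1) : mono m n :=
  @Mono m n (fun _ => i) (fun _ _ _ => leqnn i).

Lemma lift_homo n (k : 'I_n.+2) (i j : 'I_n.+1) :
  i <= j -> lift k i <= lift k j.
Proof. by rewrite /= leq_bump2. Qed.

Definition mono_face n (k : 'I_n.+2) : mono n n.+1 :=
  @Mono n n.+1 (lift k) (@lift_homo n k).

(* The fixed universe of small sets: it bounds the simplices of all simplicial
   sets as well as the index sets of products. *)
Definition smallType := Type.

Record sSet := SSet {
  simplex :> nat -> smallType;
  act : forall m n, mono m n -> simplex n -> simplex m;
  act_id : forall n (x : simplex n), act (mono_id n) x = x;
  act_comp : forall l m n (a : mono m n) (b : mono l m) (x : simplex n),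
    act b (act a x) = act (mono_comp a b) x }.

Definition vertex (X : sSet) n (i : 'I_n.+1) (x : X n) : X 0 :=
  act (mono_cst 0 i) x.
Definition face (X : sSet) n (k : 'I_n.+2) (x : X n.+1) : X n :=
  act (mono_face k) x.
(* The totally degenerate n-simplex on a 0-simplex. *)
Definition deg (X : sSet) n (x : X 0) : X n := act (mono_cst n ord0) x.

Record smap (X Y : sSet) := SMap {
  smap_fun :> forall n, X n -> Y n;
  smap_nat : forall m n (a : mono m n) (x : X n),
    smap_fun (act a x) = act a (smap_fun x) }.
Arguments smap_fun {X Y} _ n _.

Definition smonic (X Y : sSet) (i : smap X Y) : Prop :=
  forall n, injective (i n).

Lemma simplex_act_comp n l m k (a : mono m k) (b : mono l m) (x : mono k n) :
  mono_comp (mono_comp x a) b = mono_comp x (mono_comp a b).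
Proof. exact: mono_eq. Qed.

Lemma simplex_act_id n m (x : mono m n) : mono_comp x (mono_id m) = x.
Proof. exact: mono_eq. Qed.

Definition Delta (n : nat) : sSet :=
  @SSet (fun m => mono m n) (fun _ _ a x => mono_comp x a)
    (@simplex_act_id n) (@simplex_act_comp n).

(* The nerve of the free-living isomorphism: since every hom-set of this
   category is a singleton, an m-simplex is any sequence of m + 1 objects. *)
Definition Iso : sSet :=
  @SSet (fun m => 'I_m.+1 -> bool) (fun _ _ a x i => x (a i))
    (fun _ _ => erefl) (fun _ _ _ _ _ _ => erefl).

Section Product.
Variables X Y : sSet.

Definition sprod_act m n (a : mono m n) (s : (X n * Y n)%type) :
  (X m * Y m)%type := (act a s.1, act a s.2).

Lemma sprod_act_id n (s : (X n * Y n)%type) : sprod_act (mono_id n) s = s.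
Proof. by case: s => x y; rewrite /sprod_act /= !act_id. Qed.

Lemma sprod_act_comp l m n (a : mono m n) (b : mono l m)
  (s : (X n * Y n)%type) :
  sprod_act b (sprod_act a s) = sprod_act (mono_comp a b) s.
Proof. by rewrite /sprod_act /= !act_comp. Qed.

Definition sprod : sSet :=
  @SSet (fun n => (X n * Y n)%type) sprod_act sprod_act_id sprod_act_comp.

End Product.

Lemma sig_ext (T : Type) (P : T -> Prop) (u v : {x | P x}) :
  sval u = sval v -> u = v.
Proof. by case: u v => [x Px] [y Py] /= E; apply: eq_exist. Qed.

Section Sub.
Variables (X : sSet) (P : forall n, X n -> Prop).
Hypothesis P_act : forall m n (a : mono m n) (x : X n), P x -> P (act a x).

Definition ssub_act m n (a : mono m n) (x : {x : X n | P x}) :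
  {x : X m | P x} := exist _ (act a (sval x)) (P_act a (svalP x)).

Lemma ssub_act_id n (x : {x : X n | P x}) : ssub_act (mono_id n) x = x.
Proof. by apply: sig_ext; rewrite /= act_id. Qed.

Lemma ssub_act_comp l m n (a : mono m n) (b : mono l m) (x : {x : X n | P x}) :
  ssub_act b (ssub_act a x) = ssub_act (mono_comp a b) x.
Proof. by apply: sig_ext; rewrite /= act_comp. Qed.

Definition ssub : sSet :=
  @SSet (fun n => {x : X n | P x}) ssub_act ssub_act_id ssub_act_comp.

End Sub.

(* The full simplicial subset spanned by a class of 0-simplices. *)
Section Full.
Variables (X : sSet) (P : X 0 -> Prop).

Definition spanned n (x : X n) : Prop := forall i, P (vertex i x).

Lemma spanned_act m n (a : mono m n) (x : X n) :
  spanned x -> spanned (act a x).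
Proof.
move=> Hx i; rewrite /vertex act_comp.
rewrite (_ : mono_comp _ _ = mono_cst 0 (a i)); last exact: mono_eq.
exact: Hx.
Qed.

Definition sfull : sSet := ssub spanned_act.

End Full.

(* The k-th horn of Delta n: the simplices that miss some element other
   than k. *)
Definition in_horn n (k : 'I_n.+1) m (a : Delta n m) : Prop :=
  exists j : 'I_n.+1, j <> k /\ forall i, (a : mono m n) i <> j.

Lemma in_horn_act n (k : 'I_n.+1) l m (b : mono l m) (a : Delta n m) :
  in_horn k a -> in_horn k (act b a).
Proof. by case=> j [jk Hj]; exists j; split=> // i; apply: Hj. Qed.

Definition horn n (k : 'I_n.+1) : sSet := ssub (@in_horn_act n k).

Definition horn_incl n (k : 'I_n.+1) : smap (horn k) (Delta n) :=
  @SMap (horn k) (Delta n) (fun _ x => sval x) (fun _ _ _ _ => erefl).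

Definition iso_point (b : bool) : smap (Delta 0) Iso :=
  @SMap (Delta 0) Iso (fun _ _ _ => b) (fun _ _ _ _ => erefl).

Definition has_lift (A B X Y : sSet) (i : smap A B) (f : smap X Y) : Prop :=
  forall (u : smap A X) (v : smap B Y),
    (forall n (a : A n), f n (u n a) = v n (i n a)) ->
    exists w : smap B X,
      (forall n (a : A n), w n (i n a) = u n a) /\
      (forall n (b : B n), f n (w n b) = v n b).

Definition quasi_category (X : sSet) : Prop :=
  forall n (k : 'I_n.+1), 0 < k < n -> forall u : smap (horn k) X,
    exists w : smap (Delta n) X,
      forall m (a : horn k m), w m (horn_incl k m a) = u m a.

Definition qcat_isofibration (X Y : sSet) (f : smap X Y) : Prop :=
  (forall n (k : 'I_n.+1), 0 < k < n -> has_lift (horn_incl k) f) /\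
  (forall b, has_lift (iso_point b) f).

(* The homotopy category of X is the free category on the graph of 1-simplices
   modulo s_0 x = id and d_1 s = d_0 s o d_2 s.  Its morphisms x -> y are
   represented by the sequences s of 1-simplices with [is_path x s y], read in
   diagrammatic order; composition is concatenation, and two paths from x to y
   are the same morphism if and only if [hoeq x y] relates them. *)
Fixpoint is_path (X : sSet) (x : X 0) (s : seq (X 1)) (y : X 0) : Prop :=
  if s is e :: s' then vertex ord0 e = x /\ is_path (vertex ord_max e) s' y
  else x = y.

Inductive hoeq (X : sSet) : X 0 -> X 0 -> seq (X 1) -> seq (X 1) -> Prop :=
| hoeq_refl x y s : is_path x s y -> hoeq x y s s
| hoeq_sym x y s t : hoeq x y s t -> hoeq x y t s
| hoeq_trans x y s t u : hoeq x y s t -> hoeq x y t u -> hoeq x y s u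
| hoeq_cat x y z s s' t t' :
    hoeq x y s s' -> hoeq y z t t' -> hoeq x z (s ++ t) (s' ++ t')
| hoeq_deg x : hoeq x x [:: deg 1 x] [::]
| hoeq_triangle (s : X 2) :
    hoeq (vertex ord0 s) (vertex ord_max s)
      [:: face ord_max s; face ord0 s] [:: face (@Ordinal 3 1 isT) s].

Definition ho_invertible (X : sSet) (x y : X 0) (s : seq (X 1)) : Prop :=
  is_path x s y /\
  exists t, [/\ is_path y t x, hoeq x x (s ++ t) [::] & hoeq y y (t ++ s) [::]].

Record sCat := SCat {
  obj :> Type;
  hom : obj -> obj -> sSet;
  id0 : forall A, hom A A 0;
  comp : forall A B C n, hom B C n -> hom A B n -> hom A C n;
  comp_act : forall A B C m n (a : mono m n) (g : hom B C n) (f : hom A B n),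
    act a (comp g f) = comp (act a g) (act a f);
  compA : forall A B C D n (h : hom C D n) (g : hom B C n) (f : hom A B n),
    comp h (comp g f) = comp (comp h g) f;
  comp1f : forall A B n (f : hom A B n), comp (deg n (id0 B)) f = f;
  compf1 : forall A B n (f : hom A B n), comp f (deg n (id0 A)) = f }.

Arguments id0 {s} A.
Arguments comp {s A B C n} g f.

Notation arr A B := (hom A B 0).

Definition postc (C : sCat) (X A B : C) n (g : arr A B) (t : hom X A n) :
  hom X B n := comp (deg n g) t.
Definition prec (C : sCat) (X A B : C) n (t : hom A B n) (f : arr X A) :
  hom X B n := comp t (deg n f).

Lemma deg_act (X : sSet) m n (a : mono m n) (x : X 0) :
  act a (deg n x) = deg m x.
Proof. by rewrite /deg act_comp; congr act; apply: mono_eq. Qed.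

Lemma deg0 (X : sSet) (x : X 0) : deg 0 x = x.
Proof.
rewrite /deg -[RHS](act_id (s := X)); congr act; apply: mono_eq => i.
by rewrite /= ord1.
Qed.

Lemma deg_comp (C : sCat) (A B D : C) n (g : arr B D) (f : arr A B) :
  deg n (comp g f) = comp (deg n g) (deg n f).
Proof. exact: comp_act. Qed.

Lemma vertex_deg (X : sSet) n (i : 'I_n.+1) (x : X 0) : vertex i (deg n x) = x.
Proof. by rewrite /vertex deg_act deg0. Qed.

Lemma vertex_comp (C : sCat) (A B D : C) n (i : 'I_n.+1)
  (g : hom B D n) (f : hom A B n) :
  vertex i (comp g f) = comp (vertex i g) (vertex i f).
Proof. exact: comp_act. Qed.

Lemma postc_act (C : sCat) (X A B : C) (g : arr A B) m n (a : mono m n)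
  (t : hom X A n) : postc g (act a t) = act a (postc g t).
Proof. by rewrite /postc comp_act deg_act. Qed.

Definition hom_post (C : sCat) (X A B : C) (g : arr A B) :
  smap (hom X A) (hom X B) :=
  @SMap (hom X A) (hom X B) (fun n t => postc g t) (@postc_act C X A B g).

Definition is_iso (C : sCat) (A B : C) (f : arr A B) : Prop :=
  exists g : arr B A, comp g f = id0 A /\ comp f g = id0 B.

Definition is_terminal (C : sCat) (T : C) : Prop :=
  forall (X : C) n, exists! t : hom X T n, True.

Definition is_product (C : sCat) (I : smallType) (A : I -> C) (P : C)
  (pr : forall i, arr P (A i)) : Prop :=
  forall (X : C) n (s : forall i, hom X (A i) n),
    exists! t : hom X P n, forall i, postc (pr i) t = s i.

Definition is_pullback (C : sCat) (A B D : C) (f : arr A B) (g : arr D B)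
  (Q : C) (q1 : arr Q A) (q2 : arr Q D) : Prop :=
  comp f q1 = comp g q2 /\
  forall (X : C) n (s : hom X A n) (t : hom X D n), postc f s = postc g t ->
    exists! u : hom X Q n, postc q1 u = s /\ postc q2 u = t.

Definition is_chain_limit (C : sCat) (A : nat -> C)
  (p : forall k, arr (A k.+1) (A k)) (L : C) (l : forall k, arr L (A k)) : Prop :=
  (forall k, comp (p k) (l k.+1) = l k) /\
  forall (X : C) n (s : forall k, hom X (A k) n),
    (forall k, postc (p k) (s k.+1) = s k) ->
    exists! t : hom X L n, forall k, postc (l k) t = s k.

(* P is the power of B by X with universal cotensor cone u: the induced map
   hom A P -> (hom A B)^X, whose target has the maps X * Delta n -> hom A B as
   its n-simplices, is bijective. *)
Definition is_power (C : sCat) (X : sSet) (B P : C) (u : smap X (hom P B)) :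
  Prop :=
  forall (A : C) n (h : smap (sprod X (Delta n)) (hom A B)),
    exists! t : hom A P n, forall m (x : X m) (a : Delta n m),
      h m (x, a) = comp (u m x) (act a t).

Definition arr_class (C : sCat) := forall A B : C, arr A B -> Prop.

Record is_cosmos (C : sCat) (isof : arr_class C) : Prop := IsCosmos {
  cosmos_qcat : forall A B : C, quasi_category (hom A B);

  cosmos_terminal : exists T : C, is_terminal T;
  cosmos_product : forall (I : smallType) (A : I -> C),
    exists (P : C) (pr : forall i, arr P (A i)), is_product pr;
  cosmos_pullback : forall (A B D : C) (f : arr A B) (g : arr D B), isof A B f ->
    exists (Q : C) (q1 : arr Q A) (q2 : arr Q D), is_pullback f g q1 q2;
  cosmos_chain : forall (A : nat -> C) (p : forall k, arr (A k.+1) (A k)),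
    (forall k, isof _ _ (p k)) ->
    exists (L : C) (l : forall k, arr L (A k)), is_chain_limit p l;
  cosmos_power : forall (X : sSet) (B : C),
    exists (P : C) (u : smap X (hom P B)), is_power u;

  isof_iso : forall (A B : C) (f : arr A B), is_iso f -> isof A B f;
  isof_terminal : forall (A T : C) (f : arr A T), is_terminal T -> isof A T f;
  isof_comp : forall (A B D : C) (g : arr B D) (f : arr A B),
    isof B D g -> isof A B f -> isof A D (comp g f);
  isof_product : forall (I : smallType) (A B : I -> C)
    (f : forall i, arr (A i) (B i)) (P Q : C)
    (pr : forall i, arr P (A i)) (qr : forall i, arr Q (B i)) (k : arr P Q),
    is_product pr -> is_product qr ->
    (forall i, comp (qr i) k = comp (f i) (pr i)) ->
    (forall i, isof _ _ (f i)) -> isof P Q k;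
  isof_pullback : forall (A B D : C) (f : arr A B) (g : arr D B)
    (Q : C) (q1 : arr Q A) (q2 : arr Q D),
    isof A B f -> is_pullback f g q1 q2 -> isof Q D q2;
  isof_chain : forall (A : nat -> C) (p : forall k, arr (A k.+1) (A k))
    (L : C) (l : forall k, arr L (A k)),
    (forall k, isof _ _ (p k)) -> is_chain_limit p l ->
    forall k, isof _ _ (l k);
  (* k : A^Y -> A^X x_(B^X) B^Y is the Leibniz exponential of f : A -> B by
     i : X -> Y. *)
  isof_leibniz : forall (X Y : sSet) (i : smap X Y) (A B : C) (f : arr A B)
    (AX AY BX BY : C)
    (uAX : smap X (hom AX A)) (uAY : smap Y (hom AY A))
    (uBX : smap X (hom BX B)) (uBY : smap Y (hom BY B))
    (Ai : arr AY AX) (Bi : arr BY BX) (fX : arr AX BX) (fY : arr AY BY)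
    (Q : C) (q1 : arr Q AX) (q2 : arr Q BY) (k : arr AY Q),
    smonic i -> isof A B f ->
    is_power uAX -> is_power uAY -> is_power uBX -> is_power uBY ->
    (forall n (x : X n), prec (uAX n x) Ai = uAY n (i n x)) ->
    (forall n (x : X n), prec (uBX n x) Bi = uBY n (i n x)) ->
    (forall n (x : X n), prec (uBX n x) fX = postc f (uAX n x)) ->
    (forall n (y : Y n), prec (uBY n y) fY = postc f (uAY n y)) ->
    is_pullback fX Bi q1 q2 ->
    comp q1 k = Ai -> comp q2 k = fY ->
    isof AY Q k;
  isof_hom : forall (A B : C) (f : arr A B), isof A B f ->
    forall X : C, qcat_isofibration (hom_post X f) }.

Record cosmos := Cosmos {
  cosmos_cat :> sCat;
  isofibration : arr_class cosmos_cat;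
  cosmosP : is_cosmos isofibration }.

Arguments isofibration {c A B} _.

(* The 2-cells f => g of the homotopy 2-category of K are the morphisms f -> g
   of the homotopy category of hom A B.  They are represented by paths, whose
   vertical composition is concatenation, whose equality is [hoeq f g], and
   which are whiskered edgewise.  A 2-cell ending at an arrow f can be
   concatenated with one starting at f' as soon as f = f' is provable, so that
   no identification 2-cells are needed. *)
Section Homotopy2.
Variable K : sCat.

Definition whiskerl (A B D : K) (g : arr B D) (s : seq (hom A B 1)) :
  seq (hom A D 1) := [seq postc g e | e <- s].
Definition whiskerr (A B D : K) (s : seq (hom B D 1)) (f : arr A B) :
  seq (hom A D 1) := [seq prec e f | e <- s].

Definition is_adjunction (E B : K) (p : arr E B) (r : arr B E)
  (eta : seq (hom E E 1)) (eps : seq (hom B B 1)) : Prop :=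
  [/\ is_path (id0 E) eta (comp r p),
      is_path (comp p r) eps (id0 B),
      hoeq p p (whiskerl p eta ++ whiskerr eps p) [::] &
      hoeq r r (whiskerr eta r ++ whiskerl r eps) [::]].

Definition is_left_adjoint (E B : K) (p : arr E B) : Prop :=
  exists r eta eps, is_adjunction p r eta eps.

(* e r1 => r2 p2 e r1 = r2 b p1 r1 => r2 b *)
Definition mate (E1 B1 E2 B2 : K) (e : arr E1 E2) (b : arr B1 B2)
  (r1 : arr B1 E1) (eps1 : seq (hom B1 B1 1))
  (r2 : arr B2 E2) (eta2 : seq (hom E2 E2 1)) : seq (hom B1 E2 1) :=
  whiskerr eta2 (comp e r1) ++ whiskerl (comp r2 b) eps1.

(* The invertibility of the mate does not depend on the adjunctions chosen:
   see [left_adjoint_morphism_ex]. *)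
Definition left_adjoint_morphism (E1 B1 E2 B2 : K)
  (p1 : arr E1 B1) (p2 : arr E2 B2) (e : arr E1 E2) (b : arr B1 B2) : Prop :=
  forall r1 eta1 eps1 r2 eta2 eps2,
    is_adjunction p1 r1 eta1 eps1 -> is_adjunction p2 r2 eta2 eps2 ->
    ho_invertible (comp e r1) (comp r2 b) (mate e b r1 eps1 r2 eta2).

End Homotopy2.

Section Calculus.

Lemma path_cat (X : sSet) (x y z : X 0) s t :
  is_path x s y -> is_path y t z -> is_path x (s ++ t) z.
Proof.
elim: s x => [|e s IH] x /= => [-> //|[<- Hs] Ht].
by split=> //; apply: IH.
Qed.

Lemma path_edge (X : sSet) (e : X 1) :
  is_path (vertex ord0 e) [:: e] (vertex ord_max e).
Proof. by []. Qed.

Lemma hoeq_paths (X : sSet) (x y : X 0) s t :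
  hoeq x y s t -> is_path x s y /\ is_path x t y.
Proof.
elim=> {x y s t} //.
- by move=> x y s t _ [].
- by move=> x y s t u _ [? _] _ [].
- move=> x y z s s' t t' _ [h1 h2] _ [h3 h4].
  by split; apply: path_cat; eassumption.
- by move=> x /=; rewrite !vertex_deg.
- move=> s /=; rewrite /face /vertex !act_comp; do !split; congr act;
  by apply: mono_eq => i; apply: val_inj.
Qed.

Lemma hoeq_left (X : sSet) (x y : X 0) s t : hoeq x y s t -> is_path x s y.
Proof. by case/hoeq_paths. Qed.

Lemma hoeq_right (X : sSet) (x y : X 0) s t : hoeq x y s t -> is_path x t y.
Proof. by case/hoeq_paths. Qed.

Lemma hoeq_catl (X : sSet) (x y z : X 0) s t t' :
  is_path x s y -> hoeq y z t t' -> hoeq x z (s ++ t) (s ++ t').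
Proof. by move=> Hs Ht; apply: hoeq_cat Ht; apply: hoeq_refl. Qed.

Lemma hoeq_catr (X : sSet) (x y z : X 0) s s' t :
  hoeq x y s s' -> is_path y t z -> hoeq x z (s ++ t) (s' ++ t).
Proof. by move=> Hs Ht; apply: (hoeq_cat Hs); apply: hoeq_refl. Qed.

Lemma path_map (X Y : sSet) (phi : smap X Y) (x y : X 0) s :
  is_path x s y -> is_path (phi 0 x) [seq phi 1 e | e <- s] (phi 0 y).
Proof.
elim: s x => [|e s IH] x /= => [-> //|[<- /IH H]].
by rewrite /vertex -!smap_nat; split.
Qed.

Lemma hoeq_map (X Y : sSet) (phi : smap X Y) (x y : X 0) s t :
  hoeq x y s t ->
  hoeq (phi 0 x) (phi 0 y) [seq phi 1 e | e <- s] [seq phi 1 e | e <- t].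
Proof.
elim=> {x y s t}.
- by move=> x y s H; apply: hoeq_refl; apply: path_map.
- by move=> x y s t _; apply: hoeq_sym.
- by move=> x y s t u _ H _; apply: hoeq_trans.
- by move=> x y z s s' t t' _ H _ H'; rewrite !map_cat; apply: hoeq_cat H H'.
- by move=> x /=; rewrite /deg smap_nat; apply: hoeq_deg.
- by move=> s /=; rewrite /face /vertex !smap_nat; apply: hoeq_triangle.
Qed.

Variable K : sCat.

Lemma prec_act (X A B : K) (f : arr X A) m n (a : mono m n)
  (t : hom A B n) : prec (act a t) f = act a (prec t f).
Proof. by rewrite /prec comp_act deg_act. Qed.

Definition hom_pre (X A B : K) (f : arr X A) : smap (hom A B) (hom X B) :=
  @SMap (hom A B) (hom X B) (fun n t => prec t f) (@prec_act X A B f).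

Lemma postc0 (X A B : K) (g : arr A B) (f : arr X A) : postc g f = comp g f.
Proof. by rewrite /postc deg0. Qed.

Lemma prec0 (X A B : K) (g : arr A B) (f : arr X A) : prec g f = comp g f.
Proof. by rewrite /prec deg0. Qed.

Lemma postcA (X A B D : K) n (h : arr B D) (g : arr A B) (t : hom X A n) :
  postc h (postc g t) = postc (comp h g) t.
Proof. by rewrite /postc compA deg_comp. Qed.

Lemma precA (W X A B : K) n (t : hom A B n) (f : arr X A) (g : arr W X) :
  prec (prec t f) g = prec t (comp f g).
Proof. by rewrite /prec -compA deg_comp. Qed.

Lemma prec_postc (W X A B : K) n (g : arr A B) (t : hom X A n) (f : arr W X) :
  prec (postc g t) f = postc g (prec t f).
Proof. by rewrite /prec /postc compA. Qed.

Lemma postc1 (X A : K) n (t : hom X A n) : postc (id0 A) t = t.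
Proof. exact: comp1f. Qed.

Lemma prec1 (X A : K) n (t : hom X A n) : prec t (id0 X) = t.
Proof. exact: compf1. Qed.

Lemma id0l (A B : K) (f : arr A B) : comp (id0 B) f = f.
Proof. by rewrite -postc0 postc1. Qed.

Lemma id0r (A B : K) (f : arr A B) : comp f (id0 A) = f.
Proof. by rewrite -prec0 prec1. Qed.

Lemma wl_cat (A B D : K) (g : arr B D) (s t : seq (hom A B 1)) :
  whiskerl g (s ++ t) = whiskerl g s ++ whiskerl g t.
Proof. exact: map_cat. Qed.

Lemma wr_cat (A B D : K) (s t : seq (hom B D 1)) (f : arr A B) :
  whiskerr (s ++ t) f = whiskerr s f ++ whiskerr t f.
Proof. exact: map_cat. Qed.

Lemma wlA (X A B D : K) (h : arr B D) (g : arr A B) (s : seq (hom X A 1)) :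
  whiskerl h (whiskerl g s) = whiskerl (comp h g) s.
Proof. by rewrite /whiskerl -map_comp; apply: eq_map => e; apply: postcA. Qed.

Lemma wrA (W X A B : K) (s : seq (hom A B 1)) (f : arr X A) (g : arr W X) :
  whiskerr (whiskerr s f) g = whiskerr s (comp f g).
Proof. by rewrite /whiskerr -map_comp; apply: eq_map => e; apply: precA. Qed.

Lemma wr_wl (W X A B : K) (g : arr A B) (s : seq (hom X A 1)) (f : arr W X) :
  whiskerr (whiskerl g s) f = whiskerl g (whiskerr s f).
Proof.
by rewrite /whiskerr /whiskerl -!map_comp; apply: eq_map => e;
  apply: prec_postc.
Qed.

Lemma wl_path (A B D : K) (g : arr B D) (f f' : arr A B) s :
  is_path f s f' -> is_path (comp g f) (whiskerl g s) (comp g f').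
Proof. by move/(path_map (hom_post A g)); rewrite /= !postc0. Qed.

Lemma wr_path (A B D : K) (f : arr A B) (g g' : arr B D) s :
  is_path g s g' -> is_path (comp g f) (whiskerr s f) (comp g' f).
Proof. by move/(path_map (hom_pre D f)); rewrite /= !prec0. Qed.

Lemma wl_hoeq (A B D : K) (g : arr B D) (f f' : arr A B) s t :
  hoeq f f' s t -> hoeq (comp g f) (comp g f') (whiskerl g s) (whiskerl g t).
Proof. by move/(hoeq_map (hom_post A g)); rewrite /= !postc0. Qed.

Lemma wr_hoeq (A B D : K) (f : arr A B) (g g' : arr B D) s t :
  hoeq g g' s t -> hoeq (comp g f) (comp g' f) (whiskerr s f) (whiskerr t f).
Proof. by move/(hoeq_map (hom_pre D f)); rewrite /= !prec0. Qed.

Lemma tri_homo (k : nat) (i j : 'I_3) :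
  i <= j -> (if i < k then ord0 else ord_max : 'I_2) <=
            (if j < k then ord0 else ord_max : 'I_2).
Proof.
move=> ij; case: ifP => // /negbT; rewrite -leqNgt => ki.
by rewrite ltnNge (leq_trans ki ij).
Qed.

Definition mono_tri (k : nat) : mono 2 1 :=
  @Mono 2 1 (fun i => if i < k then ord0 else ord_max) (@tri_homo k).

Lemma hoeq_square (A B D : K) (u : hom B D 1) (v : hom A B 1) :
  hoeq (comp (vertex ord0 u) (vertex ord0 v))
       (comp (vertex ord_max u) (vertex ord_max v))
    [:: prec u (vertex ord0 v); postc (vertex ord_max u) v]
    [:: postc (vertex ord0 u) v; prec u (vertex ord_max v)].
Proof.
have tri k l : let s := comp (act (mono_tri k) u) (act (mono_tri l) v) in
  hoeq (vertex ord0 s) (vertex ord_max s)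
      [:: face ord_max s; face ord0 s] [:: face (@Ordinal 3 1 isT) s].
  exact: hoeq_triangle.
have mid : forall (X : sSet) (w : X 1) (f : mono 1 1),
    (forall i, f i = i) -> act f w = w.
  move=> X w f Hf; rewrite -[RHS](act_id (s := X)); congr act.
  exact: mono_eq.
have cst : forall (X : sSet) (w : X 1) (f : mono 1 1) i,
    (forall j, f j = i) -> act f w = deg 1 (vertex i w).
  move=> X w f i Hf; rewrite /deg /vertex act_comp; congr act.
  exact: mono_eq.
have vt : forall (X : sSet) (w : X 1) (f : mono 0 1) i,
    (forall j, f j = i) -> act f w = vertex i w.
  move=> X w f i Hf; rewrite /vertex; congr act.
  exact: mono_eq.
have cases2 (P : 'I_2 -> Prop) : P ord0 -> P ord_max -> forall i, P i.
  move=> P0 P1 [[|[|i]] Hi] //.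
    by rewrite (_ : Ordinal Hi = ord0) //; apply: val_inj.
  by rewrite (_ : Ordinal Hi = ord_max) //; apply: val_inj.
have T1 := tri 1 2; have T2 := tri 2 1; move: T1 T2 => /=.
rewrite /face /vertex !comp_act !act_comp.
do 6![rewrite ?(vt _ _ (mono_comp (mono_tri _) (mono_cst 0 ord0)) ord0) //;
      rewrite ?(vt _ _ (mono_comp (mono_tri _) (mono_cst 0 ord_max)) ord_max) //].
have m1 := mid _ _ (mono_comp (mono_tri 1) (mono_face ord_max)).
have m2 := mid _ _ (mono_comp (mono_tri 2) (mono_face ord0)).
have m3 := mid _ _ (mono_comp (mono_tri 1) (mono_face (@Ordinal 3 1 isT))).
have m4 := mid _ _ (mono_comp (mono_tri 2) (mono_face (@Ordinal 3 1 isT))).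
have c1 := cst _ _ (mono_comp (mono_tri 1) (mono_face ord0)) ord_max.
have c2 := cst _ _ (mono_comp (mono_tri 2) (mono_face ord_max)) ord0.
rewrite ?m1 ?m2 ?m3 ?m4 ?c1 ?c2;
  try by apply: cases2; apply: val_inj.
move=> T1 T2; apply: (hoeq_trans T1); exact: hoeq_sym T2.
Qed.

Lemma interchange (A B D : K) (f f' : arr B D) (g g' : arr A B) s t :
  is_path f s f' -> is_path g t g' ->
  hoeq (comp f g) (comp f' g') (whiskerr s g ++ whiskerl f' t)
    (whiskerl f t ++ whiskerr s g').
Proof.
elim: s f => [|u s IH] f /= => [-> Ht|[<- Hs] Ht].
  by rewrite cats0; apply: hoeq_refl; apply: wl_path.
have H1 : hoeq (comp (vertex ord0 u) g) (comp (vertex ord_max u) g')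
    ([:: prec u g] ++ whiskerl (vertex ord_max u) t)
    (whiskerl (vertex ord0 u) t ++ [:: prec u g']).
  elim: t g Ht {IH} => [|v t IHt] g /= => [->|[<- Ht]].
    apply: hoeq_refl => /=.
    by rewrite /prec !vertex_comp !vertex_deg.
  apply: (hoeq_trans (hoeq_catr (hoeq_square u v) (wl_path _ Ht))).
  apply: (@hoeq_catl _ _ _ _ [:: postc _ v] _ _ _ (IHt _ Ht)).
  by rewrite /= /postc !vertex_comp !vertex_deg.
rewrite -[prec u g' :: _]cat1s catA.
apply: (@hoeq_trans _ _ _ _ ([:: prec u g] ++ (whiskerl (vertex ord_max u) t
    ++ whiskerr s g'))).
  apply: (@hoeq_catl _ _ _ _ [:: prec u g] _ _ _ (IH _ Hs Ht)).
  by rewrite /= /prec !vertex_comp !vertex_deg.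
rewrite catA; apply: hoeq_catr H1 _.
exact: wr_path.
Qed.

Lemma mate_path (E1 B1 E2 B2 : K) (p1 : arr E1 B1) (p2 : arr E2 B2)
  (e : arr E1 E2) (b : arr B1 B2) r1 eta1 eps1 r2 eta2 eps2 :
  comp p2 e = comp b p1 ->
  is_adjunction p1 r1 eta1 eps1 -> is_adjunction p2 r2 eta2 eps2 ->
  is_path (comp e r1) (mate e b r1 eps1 r2 eta2) (comp r2 b).
Proof.
move=> sq [_ He1 _ _] [Hn2 _ _ _]; apply: path_cat.
  have := wr_path (comp e r1) Hn2; rewrite id0l; apply.
have := wl_path (comp r2 b) He1; rewrite id0r.
by rewrite -!compA [comp b _]compA -sq -!compA.
Qed.

Lemma mate_comp (E1 B1 E2 B2 E3 B3 : K)
  (p1 : arr E1 B1) (p2 : arr E2 B2) (p3 : arr E3 B3)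
  (e : arr E1 E2) (b : arr B1 B2) (e' : arr E2 E3) (b' : arr B2 B3)
  r1 eta1 eps1 r2 eta2 eps2 r3 eta3 eps3 :
  comp p2 e = comp b p1 -> comp p3 e' = comp b' p2 ->
  is_adjunction p1 r1 eta1 eps1 -> is_adjunction p2 r2 eta2 eps2 ->
  is_adjunction p3 r3 eta3 eps3 ->
  hoeq (comp (comp e' e) r1) (comp r3 (comp b' b))
    (whiskerl e' (mate e b r1 eps1 r2 eta2) ++
     whiskerr (mate e' b' r2 eps2 r3 eta3) b)
    (mate (comp e' e) (comp b' b) r1 eps1 r3 eta3).
Proof.
move=> sq sq' a1 a2 a3; case: (a1) (a2) (a3).
move=> Hn1 He1 T1 T1' [Hn2 He2 T2 T2'] [Hn3 He3 T3 T3'].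
have sqA (X : K) (z : arr X E1) : comp p2 (comp e z) = comp b (comp p1 z).
  by rewrite compA sq -compA.
have sqA' (X : K) (z : arr X E2) : comp p3 (comp e' z) = comp b' (comp p2 z).
  by rewrite compA sq' -compA.
have step1 := interchange Hn3 (wl_path (comp e' (comp r2 b)) He1).
have step2 := interchange Hn3 (wl_path e' (wr_path (comp e r1) Hn2)).
have step3 := wl_hoeq (comp r3 b') (interchange He2 (wl_path b He1)).
have step4 := wl_hoeq (comp r3 b') (wr_hoeq (comp e r1) T2).
move: step1 step2 step3 step4.
rewrite /mate !wl_cat !wr_cat !wl_cat -!catA.
rewrite !wr_wl !wrA !wlA -!compA ?id0l ?id0r ?sqA' ?sqA -?compA ?sqA.
rewrite sq' => step1 step2 step3 step4.
have pA := wl_path e' (wr_path (comp e r1) Hn2).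
have pD := wl_path (comp r3 b') (wr_path b He2).
have pN := wr_path (comp e' (comp e r1)) Hn3.
have pP := wl_path (comp r3 (comp b' b)) He1.
move: pA pD pN pP.
rewrite ?wr_wl ?wrA ?wlA -!compA ?id0l ?id0r ?sqA' ?sqA -?compA ?sqA.
move=> pA pD pN pP.
apply: hoeq_sym.
apply: (hoeq_trans (hoeq_catl pN (hoeq_catr (hoeq_sym step4) pP))).
have := hoeq_cat step2 step3; rewrite -!catA => H; apply: (hoeq_trans H).
rewrite [whiskerr _ _ ++ (whiskerl _ _ ++ _)]catA.
rewrite [whiskerl _ _ ++ (whiskerr _ _ ++ whiskerl _ _)]catA.
exact: hoeq_catl pA (hoeq_catr step1 pD).
Qed.

Lemma ho_invertible_cat (X : sSet) (x y z : X 0) s t :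
  ho_invertible x y s -> ho_invertible y z t -> ho_invertible x z (s ++ t).
Proof.
move=> [ps [s' [ps' ss' s's]]] [pt [t' [pt' tt' t't]]].
split; first exact: path_cat ps pt.
exists (t' ++ s'); split; first exact: path_cat pt' ps'.
- rewrite -catA [t ++ _]catA.
  exact: hoeq_trans (hoeq_catl ps (hoeq_catr tt' ps')) ss'.
- rewrite -catA [s' ++ _]catA.
  exact: hoeq_trans (hoeq_catl pt' (hoeq_catr s's pt)) t't.
Qed.

Lemma ho_invertible_map (X Y : sSet) (phi : smap X Y) (x y : X 0) s :
  ho_invertible x y s ->
  ho_invertible (phi 0 x) (phi 0 y) [seq phi 1 e | e <- s].
Proof.
move=> [ps [t [pt st ts]]]; split; first exact: path_map.
exists [seq phi 1 e | e <- t]; rewrite -!map_cat.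
by split; [exact: path_map | exact: hoeq_map st | exact: hoeq_map ts].
Qed.

Lemma ho_invertible_hoeq (X : sSet) (x y : X 0) s s' :
  hoeq x y s s' -> ho_invertible x y s -> ho_invertible x y s'.
Proof.
move=> H [ps [t [pt st ts]]]; split; first exact: hoeq_right H.
exists t; split=> //.
- exact: hoeq_trans (hoeq_catr (hoeq_sym H) pt) st.
- exact: hoeq_trans (hoeq_catl pt (hoeq_sym H)) ts.
Qed.

Lemma mate_comp_invertible (E1 B1 E2 B2 E3 B3 : K)
  (p1 : arr E1 B1) (p2 : arr E2 B2) (p3 : arr E3 B3)
  (e : arr E1 E2) (b : arr B1 B2) (e' : arr E2 E3) (b' : arr B2 B3)
  r1 eta1 eps1 r2 eta2 eps2 r3 eta3 eps3 :
  comp p2 e = comp b p1 -> comp p3 e' = comp b' p2 ->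
  is_adjunction p1 r1 eta1 eps1 -> is_adjunction p2 r2 eta2 eps2 ->
  is_adjunction p3 r3 eta3 eps3 ->
  ho_invertible (comp e r1) (comp r2 b) (mate e b r1 eps1 r2 eta2) ->
  ho_invertible (comp e' r2) (comp r3 b') (mate e' b' r2 eps2 r3 eta3) ->
  ho_invertible (comp (comp e' e) r1) (comp r3 (comp b' b))
    (mate (comp e' e) (comp b' b) r1 eps1 r3 eta3).
Proof.
move=> sq sq' a1 a2 a3 H H'.
apply: (ho_invertible_hoeq (mate_comp sq sq' a1 a2 a3)).
have := ho_invertible_map (hom_pre _ b) H'.
have := ho_invertible_map (hom_post _ e') H.
rewrite /= !postc0 !prec0 -!compA; exact: ho_invertible_cat.
Qed.

Lemma mate_id_invertible (E B : K) (p : arr E B) r eta eps r' eta' eps' :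
  is_adjunction p r eta eps -> is_adjunction p r' eta' eps' ->
  ho_invertible (comp (id0 E) r) (comp r' (id0 B))
    (mate (id0 E) (id0 B) r eps r' eta').
Proof.
have sq : comp p (id0 E) = comp (id0 B) p by rewrite id0l id0r.
have self r1 n1 e1 r2 n2 e2 :
    is_adjunction p r1 n1 e1 -> is_adjunction p r2 n2 e2 ->
    hoeq r1 r1 (mate (id0 E) (id0 B) r1 e1 r2 n2 ++
                mate (id0 E) (id0 B) r2 e2 r1 n1) [::].
  move=> a1 a2; have := mate_comp sq sq a1 a2 a1.
  have wl1 (X A : K) (s : seq (hom X A 1)) : whiskerl (id0 A) s = s.
    by rewrite /whiskerl -[RHS]map_id; apply: eq_map => x; apply: postc1.
  have wr1 (X A : K) (s : seq (hom X A 1)) : whiskerr s (id0 X) = s.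
    by rewrite /whiskerr -[RHS]map_id; apply: eq_map => x; apply: prec1.
  rewrite wl1 wr1 !id0l !id0r => H; apply: (hoeq_trans H).
  by rewrite /mate id0l id0r; case: a1.
move=> a a'; have := mate_path sq a a'; have := mate_path sq a' a.
rewrite !id0l !id0r => p1 p2; split=> //.
by exists (mate (id0 E) (id0 B) r' eps' r eta); split=> //; apply: self.
Qed.

Lemma left_adjoint_morphism_ex (E1 B1 E2 B2 : K)
  (p1 : arr E1 B1) (p2 : arr E2 B2) (e : arr E1 E2) (b : arr B1 B2) :
  comp p2 e = comp b p1 -> is_left_adjoint p1 -> is_left_adjoint p2 ->
  left_adjoint_morphism p1 p2 e b <->
  exists r1 eta1 eps1 r2 eta2 eps2,
    [/\ is_adjunction p1 r1 eta1 eps1, is_adjunction p2 r2 eta2 eps2 &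
      ho_invertible (comp e r1) (comp r2 b) (mate e b r1 eps1 r2 eta2)].
Proof.
move=> sq l1 l2; split.
  case: l1 l2 => r1 [n1 [e1 a1]] [r2 [n2 [e2 a2]]] H.
  by exists r1, n1, e1, r2, n2, e2; split=> //; exact: H a1 a2.
case=> [r1 [n1 [e1 [r2 [n2 [e2 [a1 a2 H]]]]]]] r1' n1' e1' r2' n2' e2' a1' a2'.
have sq1 : comp p1 (id0 _) = comp (id0 _) p1 by rewrite id0l id0r.
have sq2 : comp p2 (id0 _) = comp (id0 _) p2 by rewrite id0l id0r.
have H1 := mate_comp_invertible sq1 sq a1' a1 a2 (mate_id_invertible a1' a1) H.
move: H1; rewrite !id0r => H1.
have := mate_comp_invertible sq sq2 a1' a2 a2' H1 (mate_id_invertible a2 a2').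
by rewrite !id0l.
Qed.

Lemma left_adjoint_morphism_id (E B : K) (p : arr E B) :
  left_adjoint_morphism p p (id0 E) (id0 B).
Proof. by move=> r n e r' n' e'; apply: mate_id_invertible. Qed.

Lemma left_adjoint_morphism_comp (E1 B1 E2 B2 E3 B3 : K)
  (p1 : arr E1 B1) (p2 : arr E2 B2) (p3 : arr E3 B3)
  (e : arr E1 E2) (b : arr B1 B2) (e' : arr E2 E3) (b' : arr B2 B3) :
  comp p2 e = comp b p1 -> comp p3 e' = comp b' p2 -> is_left_adjoint p2 ->
  left_adjoint_morphism p1 p2 e b -> left_adjoint_morphism p2 p3 e' b' ->
  left_adjoint_morphism p1 p3 (comp e' e) (comp b' b).
Proof.
move=> sq sq' [r2 [n2 [e2 a2]]] H H' r1 n1 e1 r3 n3 e3 a1 a3.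
exact: mate_comp_invertible sq sq' a1 a2 a3 (H _ _ _ _ _ _ a1 a2)
  (H' _ _ _ _ _ _ a2 a3).
Qed.

End Calculus.

(* The subcategory on the objects [ob o] whose 0-arrows are those in M, full on
   n-arrows for n > 0. *)
Section SubCat.
Variables (C : sCat) (O : Type) (ob : O -> C).
Variable M : forall a b : O, arr (ob a) (ob b) -> Prop.
Hypothesis M_id : forall a, M (id0 (ob a)).
Hypothesis M_comp : forall a b c (g : arr (ob b) (ob c)) (f : arr (ob a) (ob b)),
  M g -> M f -> M (comp g f).

Definition sub_hom (a b : O) : sSet := sfull (@M a b).

Lemma sub_id_subproof a : spanned (@M a a) (id0 (ob a)).
Proof. by move=> i; rewrite -(deg0 (id0 _)) vertex_deg. Qed.

Definition sub_id (a : O) : sub_hom a a 0 := exist _ _ (sub_id_subproof a).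

Lemma sub_comp_subproof a b c n (g : sub_hom b c n) (f : sub_hom a b n) :
  spanned (@M a c) (comp (sval g) (sval f)).
Proof.
move=> i; rewrite vertex_comp.
by apply: M_comp; [apply: (svalP g) | apply: (svalP f)].
Qed.

Definition sub_comp a b c n (g : sub_hom b c n) (f : sub_hom a b n) :
  sub_hom a c n := exist _ _ (sub_comp_subproof g f).

Definition subcat : sCat.
Proof.
apply: (@SCat O sub_hom sub_id sub_comp).
- by move=> a b c m n x g f; apply: sig_ext; apply: comp_act.
- by move=> a b c d n h g f; apply: sig_ext; apply: compA.
- by move=> a b n f; apply: sig_ext; apply: comp1f.
- by move=> a b n f; apply: sig_ext; apply: compf1.
Defined.

End SubCat.

Section Isof.
Variable K : cosmos.

Record isof_obj := IsofObj {
  total : K;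
  base : K;
  proj : arr total base;
  projP : isofibration proj }.

(* The pullback of hom E1 E2 -> hom E1 B2 <- hom B1 B2. *)
Definition isof_square (p1 p2 : isof_obj) n
  (s : sprod (hom (total p1) (total p2)) (hom (base p1) (base p2)) n) : Prop :=
  postc (proj p2) s.1 = prec s.2 (proj p1).

Lemma isof_square_act (p1 p2 : isof_obj) m n (a : mono m n)
  (s : sprod (hom (total p1) (total p2)) (hom (base p1) (base p2)) n) :
  isof_square s -> isof_square (act a s).
Proof. by rewrite /isof_square /= postc_act prec_act => ->. Qed.

Definition Kisof_hom (p1 p2 : isof_obj) : sSet := ssub (@isof_square_act p1 p2).

Lemma Kisof_id_subproof (p : isof_obj) :
  isof_square (p1 := p) (p2 := p) (n := 0) (id0 (total p), id0 (base p)).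
Proof. by rewrite /isof_square /= postc0 prec0 id0l id0r. Qed.

Definition Kisof_id (p : isof_obj) : Kisof_hom p p 0 :=
  exist _ _ (Kisof_id_subproof p).

Lemma Kisof_comp_subproof (p1 p2 p3 : isof_obj) n
  (g : Kisof_hom p2 p3 n) (f : Kisof_hom p1 p2 n) :
  isof_square (p1 := p1) (p2 := p3) (n := n)
    (comp (sval g).1 (sval f).1, comp (sval g).2 (sval f).2).
Proof.
have /= := svalP g; have /= := svalP f; rewrite /isof_square /= => Hf Hg.
rewrite /postc /prec compA [comp (deg n _) _]Hg -[LHS]compA.
by rewrite [comp (deg n _) _]Hf compA.
Qed.

Definition Kisof_comp (p1 p2 p3 : isof_obj) n
  (g : Kisof_hom p2 p3 n) (f : Kisof_hom p1 p2 n) : Kisof_hom p1 p3 n :=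
  exist _ _ (Kisof_comp_subproof g f).

Definition Kisof : sCat.
Proof.
apply: (@SCat isof_obj Kisof_hom Kisof_id Kisof_comp).
- by move=> p q r m n a g f; apply: sig_ext; rewrite /= /sprod_act /= !comp_act.
- by move=> p q r s n h g f; apply: sig_ext; rewrite /= !compA.
- move=> p q n f; apply: sig_ext; rewrite /= !comp1f.
  by case: (sval f).
- move=> p q n f; apply: sig_ext; rewrite /= !compf1.
  by case: (sval f).
Defined.

Definition top (p1 p2 : Kisof) (f : arr p1 p2) : arr (total p1) (total p2) :=
  (sval f).1.
Definition bot (p1 p2 : Kisof) (f : arr p1 p2) : arr (base p1) (base p2) :=
  (sval f).2.

Lemma top_botE (p1 p2 : Kisof) (f : arr p1 p2) :
  comp (proj p2) (top f) = comp (bot f) (proj p1).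
Proof. by have := svalP f; rewrite /isof_square /= postc0 prec0. Qed.

(* k is the map induced by (top f, bot f) into the pullback of proj p2 along
   bot f. *)
Definition Kisof_isofibration : arr_class Kisof := fun p1 p2 f =>
  [/\ isofibration (top f), isofibration (bot f) &
    forall (Q : K) (q1 : arr Q (total p2)) (q2 : arr Q (base p1))
      (k : arr (total p1) Q),
      is_pullback (proj p2) (bot f) q1 q2 ->
      comp q1 k = top f -> comp q2 k = proj p1 -> isofibration k].

Record la_obj := LaObj {
  la_isof : Kisof;
  la_adjoint : is_left_adjoint (proj la_isof) }.

Definition la_morphism (p1 p2 : la_obj) (f : arr (la_isof p1) (la_isof p2)) :
  Prop :=
  left_adjoint_morphism (proj (la_isof p1)) (proj (la_isof p2)) (top f) (bot f).

Lemma la_morphism_id (p : la_obj) : la_morphism (id0 (la_isof p)).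
Proof. exact: left_adjoint_morphism_id. Qed.

Lemma la_morphism_comp (p1 p2 p3 : la_obj)
  (g : arr (la_isof p2) (la_isof p3)) (f : arr (la_isof p1) (la_isof p2)) :
  la_morphism g -> la_morphism f -> la_morphism (comp g f).
Proof.
move=> Hg Hf; exact: left_adjoint_morphism_comp (top_botE f) (top_botE g)
  (la_adjoint p2) Hf Hg.
Qed.

Definition La : sCat := subcat la_morphism_id la_morphism_comp.

Definition La_isofibration : arr_class La := fun p1 p2 f =>
  Kisof_isofibration (sval f).

End Isof.

(* Main.v *)
(* Limits of left adjoints are computed pointwise.  An isofibration p is a left
   adjoint iff the identity of its base has an absolute right lifting (r, eps)
   along p, and a square is a morphism of left adjoints iff it preserves these
   liftings.  Liftings are compatible with the legs of a limit cone up to an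
   invertible 2-cell, and along isofibrations this can be rectified to a strict
   compatibility: invertible edges lift because they extend to the free-living
   isomorphism (Joyal), and homotopies lift along inner horns.  So r, eps and the
   unit are induced on the limit.  The triangle composites become invertible on
   each leg; this makes them invertible, since left inverses lift along
   isofibrations by filling special outer horns, and for powers one inducts over
   skeleta, filling prisms.  Invertible triangle composites suffice for an
   adjunction.  The same joint conservativity of the legs shows that the limit
   cone detects morphisms of left adjoints.  Closure of isofibrations reduces to
   gap maps: the gap map of a limit (or Leibniz exponential) of squares is the
   limit (or Leibniz exponential) of the gap maps. *)
From mathcomp Require Import all_boot.
From mathcomp Require Import boolp zify.
Require Import Defs.
Set Implicit Arguments.
Unset Strict Implicit.
Unset Printing Implicit Defensive.

(** * Partial simplicial maps and inner horns *)

(** Passing to homotopy categories does not preserve limits: 2-cells into a limit that agree on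
    every leg need not be equal, since the homotopies on the legs need not be compatible. Hence the
    triangle identities cannot be tested on the legs, and unit and counit have to be glued as
    1-simplices strictly compatible with the cone. What the cone does detect is the existence of a
    left inverse of an edge: it is a single 2-simplex, and such 2-simplices can be chosen
    compatibly. Right inverses need no separate argument, because if every edge of a class has a
    left inverse in that class, all its edges are invertible. Lifting such a 2-simplex fills an
    outer horn at 0 with invertible initial edge. The same extension theorem serves three times: for
    left inverses, for the simplices of the free-living isomorphism, and for the outer horns left
    over when prisms are filled. Homs are full above dimension 0, so the universal property of a
    limit in dimension n follows from the pointwise ones as soon as the legs reflect morphisms of
    left adjoints on vertices. *)

Lemma smap_eq (X Y : sSet) (f g : smap X Y) :
  (forall n x, f n x = g n x) -> f = g.
Proof.
case: f g => [f Hf] [g Hg] /= E.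
have E' : f = g by apply: functional_extensionality_dep => n; apply/funext=> x.
by subst g; rewrite (Prop_irrelevance Hf Hg).
Qed.

(* Partial simplicial maps are total families of functions that are natural on
   a simplicial subset [D] only; their values outside [D] are junk. *)
Section Partial.
Variables (X P R : sSet) (f : smap P R) (psi : smap X R).

Definition ssubset (D : forall m, X m -> Prop) : Prop :=
  forall m n (a : mono m n) (x : X n), D n x -> D m (act a x).

(** A lift of [psi] along [f] over [D]. When [R] is a point this is plain extension of partial maps,
    so the relative and the absolute case share one argument. *)
Definition psec (D : forall m, X m -> Prop) (phi : forall m, X m -> P m) :
  Prop :=
  (forall m n (a : mono m n) (x : X n), D n x ->
     phi m (act a x) = act a (phi n x)) /\
  (forall m (x : X m), D m x -> f m (phi m x) = psi m x).

Lemma psec_sub (D D' : forall m, X m -> Prop) phi :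
  (forall m x, D m x -> D' m x) -> psec D' phi -> psec D phi.
Proof. by move=> H [H1 H2]; split; eauto. Qed.


(** The Boolean [b] decides [D1], so that the glued family can be defined by cases. An operator may
    move a simplex of [D2] into [D1]; there the agreement on the overlap takes over. *)
Lemma psec_glue (D1 D2 : forall m, X m -> Prop) (b : forall m, X m -> bool)
    phi1 phi2 :
  ssubset D1 -> ssubset D2 -> (forall m x, b m x <-> D1 m x) ->
  psec D1 phi1 -> psec D2 phi2 ->
  (forall m x, D1 m x -> D2 m x -> phi1 m x = phi2 m x) ->
  psec (fun m x => D1 m x \/ D2 m x)
       (fun m x => if b m x then phi1 m x else phi2 m x).
Proof.
move=> S1 S2 bP [H1 H1'] [H2 H2'] E; split=> [m n a x|m x] Dx.
  case: ifP => [/bP d1|d1]; case: ifP => [/bP d2|d2].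
  - exact: H1.
  - case: Dx => [/bP|] d; first by rewrite d2 in d.
    by rewrite E ?H2 //; apply: S2.
  - by have /bP := S1 _ _ a _ d2; rewrite d1.
  - case: Dx => [/bP|] d; first by rewrite d2 in d.
    exact: H2.
case: ifP => [/bP d1|d1]; first exact: H1'.
by case: Dx => [/bP|] d; [rewrite d1 in d | apply: H2'].
Qed.

(** The hypotheses say that adding the simplices of [x] to [D] is a pushout along the horn
    inclusion: [x] meets [D] exactly in the horn, and off the horn distinct operators give distinct
    simplices. So a single filler suffices. [fill] is told that its horn is [phi], which lets the
    filler depend on the initial edge. *)
Lemma psec_attach (D : forall m, X m -> Prop) phi r (k : 'I_r.+1) (x : X r) :
  ssubset D ->
  (forall m (s : mono m r), in_horn k (s : Delta r m) <-> D m (act s x)) ->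
  (forall m (s s' : mono m r), ~ in_horn k (s : Delta r m) ->
     act s x = act s' x -> s = s') ->
  (forall u : smap (horn k) P,
     (forall m (a : horn k m), u m a = phi m (act (sval a) x)) ->
     (forall m (a : horn k m), f m (u m a) = act (sval a) (psi r x)) ->
     exists w : P r, (forall m (a : horn k m), act (sval a) w = u m a) /\
       f r w = psi r x) ->
  psec D phi ->
  exists phi', (forall m y, D m y -> phi' m y = phi m y) /\
    psec (fun m y => D m y \/ exists s : mono m r, y = act s x) phi'.
Proof.
move=> HD Dx inj fill [H1 H2].
have unat m n (a : mono m n) (s : horn k n) :
    phi m (act (sval (act a s)) x) = act a (phi n (act (sval s) x)).
  by rewrite -H1 ?act_comp //; apply/Dx; apply: svalP.
have [|m a /=|w [w1 w2]] := fill (@SMap (horn k) P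
    (fun m s => phi m (act (sval s) x)) unat) => //.
  by rewrite H2 ?smap_nat //; apply/Dx; apply: svalP.
pose cell m (y : X m) := exists s : mono m r, y = act s x.
have cellS : ssubset cell.
  by move=> m n a y [s ->]; exists (mono_comp s a); rewrite act_comp.
have [c Hc] : exists c : forall m, X m -> P m,
    forall m (s : mono m r), c m (act s x) = act s w.
  (* The chosen operator does not matter: two operators with the same value either both lie in the
     horn, where the filler agrees with [phi], or coincide. Off the cell, [phi] is a default. *)
  pose c m (y : X m) : P m := if pselect (cell m y) is left e
    then act (sval (cid e)) w else phi m y.
  exists c => m s; rewrite /c; case: pselect => [e|[]]; last by exists s.
  case: cid => s' /= E.
  case: (pselect (in_horn k (s : Delta r m))) => Hs.
    have Hs' : in_horn k (s' : Delta r m) by apply/Dx; rewrite -E; apply/Dx.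
    have /= -> := w1 _ (exist _ _ Hs); have /= -> := w1 _ (exist _ _ Hs').
    by rewrite E.
  by rewrite (inj _ _ _ Hs E).
exists (fun m y => if `[< D m y >] then phi m y else c m y); split.
  by move=> m y Dy; rewrite asboolT.
apply: psec_glue => //.
- by move=> m y; split=> /asboolP.
- split.
    by move=> m n a y [s ->]; rewrite act_comp !Hc act_comp.
  by move=> m y [s ->]; rewrite Hc !smap_nat w2.
- move=> m y Dy [s Es]; rewrite Es Hc; rewrite Es in Dy.
  by move/Dx: Dy => Dy; have /= <- := w1 _ (exist _ _ Dy).
Qed.

End Partial.

(** * Attaching horns in the nerve of a finite poset *)

Section Nerve.
Variables (Pi : finType) (le : rel Pi).
Hypotheses (le_refl : reflexive le) (le_trans : transitive le)
  (le_anti : antisymmetric le).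

Record chain (m : nat) := Chain {
  chain_fun :> 'I_m.+1 -> Pi;
  chain_homo : forall i j : 'I_m.+1, i <= j -> le (chain_fun i) (chain_fun j) }.

Lemma chain_eq m (a b : chain m) : a =1 b -> a = b.
Proof.
case: a b => [a Ha] [b Hb] /= /funext E; subst b.
by rewrite (Prop_irrelevance Ha Hb).
Qed.

Definition chain_act m n (a : mono m n) (s : chain n) : chain m :=
  @Chain m (fun i => s (a i)) (fun _ _ H => chain_homo s (mono_homo a H)).

Definition nerve : sSet.
Proof.
by apply: (@SSet chain chain_act) => *; apply: chain_eq.
Defined.

Definition supp m (s : nerve m) : {set Pi} :=
  [set x | [exists i, chain_fun s i == x]].

Lemma suppP m (s : nerve m) x :
  reflect (exists i, chain_fun s i = x) (x \in supp s).
Proof.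
rewrite inE; apply: (iffP existsP) => -[i].
  by move/eqP; exists i.
by move=> E; exists i; apply/eqP.
Qed.

Lemma supp_act m n (a : mono m n) (s : nerve n) : supp (act a s) \subset supp s.
Proof. by apply/subsetP=> x /suppP[i <-]; apply/suppP; exists (a i). Qed.

(** A down-closed family of vertex sets cuts out a simplicial subset of the nerve, so that attaching
    horns becomes a Boolean computation on finite sets. *)
Definition downclosed (F : {set Pi} -> bool) : Prop :=
  forall V W : {set Pi}, W \subset V -> F V -> F W.

Definition nsub (F : {set Pi} -> bool) m (s : nerve m) : Prop := F (supp s).

Lemma nsubS F : downclosed F -> ssubset (nsub F).
Proof. by move=> HF m n a s; apply: HF; apply: supp_act. Qed.

Definition linear (V : {set Pi}) : Prop :=
  forall x y, x \in V -> y \in V -> le x y || le y x.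

Lemma chain_reflect r (e : nerve r) i j :
  injective (chain_fun e) -> le (chain_fun e i) (chain_fun e j) -> i <= j.
Proof.
move=> inj H; rewrite leqNgt; apply/negP => Hji.
have E := le_anti (introT andP (conj H (chain_homo e (ltnW Hji)))).
by move: Hji; rewrite (inj _ _ E) ltnn.
Qed.

Lemma linear_enum (V : {set Pi}) r : linear V -> #|V| = r.+1 ->
  exists e : nerve r, injective (chain_fun e) /\ supp e = V.
Proof.
move=> lin cV; pose s := sort le (enum V).
have size_s : size s = r.+1 by rewrite size_sort -cardE.
have mem_s x : (x \in s) = (x \in V) by rewrite mem_sort mem_enum.
have uniq_s : uniq s by rewrite sort_uniq enum_uniq.
have sorted_s : sorted le s.
  apply: (@sort_sorted_in _ (mem V) le).
    by move=> x y; apply: lin.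
  by apply/allP=> x; rewrite mem_enum.
have [x0 _] : exists x0, x0 \in V by apply/set0Pn; rewrite -card_gt0 cV.
have homo (i j : 'I_r.+1) : i <= j -> le (nth x0 s i) (nth x0 s j).
  by apply: sorted_leq_nth => //; rewrite inE size_s.
exists (@Chain r _ homo); split.
  move=> i j /= /eqP; rewrite nth_uniq ?size_s //.
  by move=> /eqP E; apply: val_inj.
apply/setP=> x; apply/suppP/idP => /=.
  by case=> i <-; rewrite -mem_s mem_nth ?size_s.
rewrite -mem_s => Hx.
have ix : index x s < r.+1 by rewrite -size_s index_mem.
by exists (Ordinal ix); rewrite /= nth_index.
Qed.

Variables (P R : sSet) (f : smap P R) (psi : smap nerve R).

(* The simplex on U can be filled from its horn at k.  Agreement with phi on F
   is what makes this available for outer horns, where the initial edge has to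
   be invertible. *)
Definition fillable (F : {set Pi} -> bool) (phi : forall m, nerve m -> P m)
  (U : {set Pi}) (k : Pi) : Prop :=
  forall r (e : nerve r) (k' : 'I_r.+1), injective (chain_fun e) ->
    supp e = U -> chain_fun e k' = k ->
    forall u : smap (horn k') P,
      (forall m (a : horn k' m), nsub F (act (sval a) e) ->
         u m a = phi m (act (sval a) e)) ->
      (forall m (a : horn k' m), f m (u m a) = act (sval a) (psi r e)) ->
      exists w : P r, (forall m (a : horn k' m), act (sval a) w = u m a) /\
        f r w = psi r e.

(** Every facet of [U] except the one opposite [k] is in [F], so the simplex on [U] meets [F]
    exactly in its horn at [k]; one filler adds both [U] and [U :\ k]. *)
Lemma psec_toggle1 (F : {set Pi} -> bool) phi (U : {set Pi}) (k : Pi) :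
  downclosed F -> linear U -> k \in U -> ~~ F (U :\ k) ->
  (forall j, j \in U -> j != k -> F (U :\ j)) ->
  fillable F phi U k -> psec f psi (nsub F) phi ->
  exists phi', (forall m y, nsub F y -> phi' m y = phi m y) /\
    psec f psi (nsub (fun W => [|| F W, W == U | W == U :\ k])) phi'.
Proof.
move=> dF lin kU nF Fj fill Hphi.
have [r cU] : exists r, #|U| = r.+1.
  exists #|U|.-1; rewrite prednK //; apply/card_gt0P; by exists k.
have [e [inj sE]] := linear_enum lin cU.
have /suppP[k' Ek] : k \in supp e by rewrite sE.
have hornP m (s : mono m r) : in_horn k' (s : Delta r m) <-> F (supp (act s e)).
  split=> [[j [jk Hj]]|HF].
    apply: (dF (U :\ chain_fun e j)); last first.
      apply: Fj; first by rewrite -sE; apply/suppP; exists j.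
      by apply/eqP; rewrite -Ek => /inj.
    apply/subsetP=> x /suppP[i <-]; rewrite !inE; apply/andP; split.
      by apply/eqP => /= /inj; apply: Hj.
    by rewrite -sE; apply/suppP; exists (s i).
  apply: contrapT => Hn; case/negP: nF; apply: dF HF.
  apply/subsetP=> x; rewrite in_setD1 -sE => /andP[xk /suppP[j Ej]].
  apply/suppP; apply: contrapT => Hx; apply: Hn; exists j; split.
    by move=> E; case/eqP: xk; rewrite -Ej -Ek E.
  by move=> i Ei; apply: Hx; exists i; rewrite /= Ei.
have inj_act m (s s' : mono m r) : act s e = act s' e -> s = s'.
  by move=> E; apply: mono_eq => i; apply: inj; have := congr1 (fun z : nerve m => chain_fun z i) E.
have [|||u Hu Hu'|phi' [E Hphi']] := @psec_attach nerve P R f psi (nsub F) phi r k' e _ _ _ _ Hphi.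
- exact: nsubS.
- by [].
- by move=> m s s' _; apply: inj_act.
- by apply: (fill r e k' inj sE Ek u) => // m a _; apply: Hu.
exists phi'; split=> //; apply: psec_sub Hphi' => m s; rewrite /nsub.
case: (boolP (F _)) => [|_ /=]; first by left.
move=> Hs; right.
have sub : supp s \subset supp e.
  by rewrite sE; case/orP: Hs => /eqP-> //; apply: subD1set.
have /choice[g Hg] : forall i, exists j, chain_fun e j = chain_fun s i.
  move=> i; apply/suppP; apply: (subsetP sub).
  by apply/suppP; exists i.
have gh (i j : 'I_m.+1) : i <= j -> g i <= g j.
  move=> ij; apply: (chain_reflect (e := e)) => //; rewrite !Hg; exact: chain_homo.
by exists (Mono gh); apply: chain_eq => i /=; rewrite Hg.
Qed.

(* F' arises from F by attaching one horn for each pair {V, V u {k}} in F' \ F,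
   the smallest V first: the other facets of V u {k} are then already present. *)
Lemma psec_toggle (F F' : {set Pi} -> bool) phi (k : Pi) :
  downclosed F -> downclosed F' -> (forall V, F V -> F' V) ->
  (forall V, F' V -> ~~ F V -> [/\ linear V, F' (k |: V) && ~~ F (k |: V) &
     F' (V :\ k) && ~~ F (V :\ k)]) ->
  (forall U, F' U -> ~~ F U -> k \in U -> fillable F phi U k) ->
  psec f psi (nsub F) phi ->
  exists phi', (forall m y, nsub F y -> phi' m y = phi m y) /\
    psec f psi (nsub F') phi'.
Proof.
(* Induction on a bound for the number of missing sets; each round adds the two sets [U] and [V]. *)
move: {2}(#|_|) (leqnn #|[set V | F' V && ~~ F V]|) => N.
elim: N F phi => [|N IH] F phi cN dF dF' FF' tog fill Hphi.
  exists phi; split=> //; apply: psec_sub Hphi => m s; rewrite /nsub => Hs.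
  apply: contraT => nF; move: cN; rewrite leqn0 cards_eq0 => /eqP/setP/(_ (supp s)).
  by rewrite !inE Hs nF.
case: (pickP [pred V | F' V && ~~ F V]) => [V0 /= /andP[F'V0 nFV0]|none]; last first.
  apply: (IH F) => //; rewrite (_ : [set V | _] = set0) ?cards0 //.
  by apply/setP=> V; rewrite !inE; apply: none.
have V1P : [&& F' (V0 :\ k), ~~ F (V0 :\ k) & k \notin V0 :\ k].
  by case: (tog _ F'V0 nFV0) => _ _ /andP[-> ->]; rewrite !inE eqxx.
case: (arg_minnP (fun V : {set Pi} => #|V|)
  (P := [pred V | [&& F' V, ~~ F V & k \notin V]]) V1P) => V /and3P[F'V nFV kV] minV.
have [_ /andP[F'U nFU] _] := tog _ F'V nFV.
set U := k |: V in F'U nFU.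
have kU : k \in U by rewrite !inE eqxx.
have UV : U :\ k = V by rewrite setU1K.
have [linU _ _] := tog _ F'U nFU.
(* If the facet [U :\ j] were missing, so would be its face without [k], which is smaller than
   [V]. *)
have Fj j : j \in U -> j != k -> F (U :\ j).
  move=> jU jk; apply: contraT => nFj.
  have F'j : F' (U :\ j) by apply: dF' F'U; apply: subD1set.
  have [_ _ /andP[a b]] := tog _ F'j nFj.
  have := minV ((U :\ j) :\ k); rewrite /= a b /= !inE eqxx => /(_ isT).
  have jV : j \in V by move: jU; rewrite !inE (negPf jk).
  rewrite (_ : _ :\ k = V :\ j).
    by rewrite leqNgt [#|V|](cardsD1 j) jV ltnS leqnn.
  by rewrite -UV; apply/setP=> x; rewrite !inE; case: (x == k); case: (x == j).
have nFUk : ~~ F (U :\ k) by rewrite UV.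
have [phi1 [E1 H1]] := psec_toggle1 dF linU kU nFUk Fj (fill _ F'U nFU kU) Hphi.
set F1 := fun W => _ in H1.
have [|||||||phi2 [E2 H2]] := IH F1 phi1 => //.
- rewrite -ltnS; apply: leq_trans cN; apply: proper_card; apply/properP; split.
    by apply/subsetP=> W; rewrite !inE /F1 => /andP[-> /norP[-> _]].
  by exists U; rewrite !inE F'U ?nFU // /F1 eqxx orbT.
(* A subset of [U] other than [U] and [U :\ k] omits some [j] different from [k], hence lies in a
   facet that is already in [F]. *)
- move=> A B BA; rewrite /F1 => /or3P[FA|/eqP EA|/eqP EA].
  + by rewrite (dF _ _ BA FA).
  + subst A; case: (eqVneq B U) => [_|BU]; first by rewrite orbT.
    case: (eqVneq B (U :\ k)) => [_|BUk]; first by rewrite !orbT.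
    rewrite !orbF; case: (boolP [exists j, [&& j \in U, j != k & j \notin B]]).
      case/existsP=> j /and3P[jU jk jB]; apply: dF (Fj j jU jk).
      by apply/subsetP=> x xB; rewrite in_setD1 (subsetP BA _ xB) andbT; apply: contraNneq jB => <-.
    move/existsPn => Hj.
    have UkB : U :\ k \subset B.
      apply/subsetP=> j; rewrite in_setD1 => /andP[jk jU]; have := Hj j.
      by rewrite jU jk /= negbK.
    case: (boolP (k \in B)) => kB.
      case/negP: BU; rewrite eqEsubset BA; apply/subsetP=> j jU.
      by case: (eqVneq j k) => [->//|jk]; apply: (subsetP UkB); rewrite in_setD1 jk.
    case/negP: BUk; rewrite eqEsubset UkB andbT; apply/subsetP=> j jB.
    by rewrite in_setD1 (subsetP BA) // andbT; apply: contraNneq kB => <-.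
  + subst A; case: (eqVneq B (U :\ k)) => [_|BUk]; first by rewrite !orbT.
    have [j jV jB] : exists2 j, j \in U :\ k & j \notin B.
      apply/subsetPn; apply: contra BUk => UB; by rewrite eqEsubset BA.
    move: jV; rewrite in_setD1 => /andP[jk jU].
    rewrite (_ : F B) //; apply: dF (Fj j jU jk).
    apply/subsetP=> x xB; have := subsetP BA _ xB; rewrite in_setD1 => /andP[_ xU].
    by rewrite in_setD1 xU andbT; apply: contraNneq jB => <-.
- move=> W /or3P[/FF'//|/eqP->//|/eqP->]; by rewrite UV.
- move=> W F'W; rewrite /F1 !negb_or => /and3P[nFW WU WUk].
  have [lin /andP[-> ->] /andP[-> ->]] := tog _ F'W nFW.
  have kW1 : k \in W -> k |: W = W.
    by move=> kW; apply/setUidPr; rewrite sub1set.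
  have kW2 : k \notin W -> W :\ k = W.
    by move=> kW; apply/setDidPl; rewrite disjoint_sym disjoints1.
  split=> //=; apply/andP; split.
  + apply/eqP => E; case: (boolP (k \in W)) => kW; first by case/eqP: WU; rewrite -E kW1.
    by case/eqP: WUk; rewrite -E setU1K.
  + apply/eqP => E; have := kU; have := congr1 (fun Z : {set Pi} => k \in Z) E.
    by rewrite !inE !eqxx.
  + apply/eqP => E; have := kU; have := congr1 (fun Z : {set Pi} => k \in Z) E.
    by rewrite !inE !eqxx.
  + apply/eqP => E; case: (boolP (k \in W)) => kW; last by case/eqP: WUk; rewrite -E kW2.
    by case/eqP: WU; rewrite -(setD1K kW) E setD1K.
- move=> W F'W; rewrite /F1 !negb_or => /and3P[nFW _ _] kW.
  move=> r e k' inj sE Ek u Hu Hu'; apply: (fill W F'W nFW kW r e k' inj sE Ek u) => //.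
  move=> m a Fa; rewrite Hu ?E1 //; by rewrite /nsub /F1 (Fa : F _).
exists phi2; split=> // m y Fy; rewrite E2 ?E1 //; by rewrite /nsub /F1 (Fy : F _).
Qed.

End Nerve.

Definition simplex_map (X : sSet) n (x : X n) : smap (Delta n) X.
Proof.
by apply: (@SMap (Delta n) X (fun m s => act (s : mono m n) x)) => *;
  rewrite act_comp.
Defined.

Definition inner_fibration (P R : sSet) (f : smap P R) : Prop :=
  forall n (k : 'I_n.+1), 0 < k < n -> has_lift (horn_incl k) f.

(** Since [x] and [y] lie strictly on either side of [k], the position of [k] in the sorted set [U]
    is neither first nor last. *)
Lemma inner_fillable (Pi : finType) (le : rel Pi) (P R : sSet) (f : smap P R)
    (psi : smap (nerve le) R) F phi (U : {set Pi}) (k x y : Pi) :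
  antisymmetric le ->
  inner_fibration f -> x \in U -> y \in U -> x != k -> y != k -> le x k ->
  le k y -> fillable f psi F phi U k.
Proof.
move=> le_anti Hf xU yU xk yk lxk lky r e k' inj sE Ek u _ Hu.
move: xU yU xk yk lxk lky; rewrite -sE -Ek => /suppP[i <-] /suppP[j <-] ik jk ik' jk'.
have := chain_reflect le_anti inj ik'; have := chain_reflect le_anti inj jk'.
rewrite leq_eqVlt => /orP[/eqP/val_inj E|kj]; first by rewrite E eqxx in jk.
rewrite leq_eqVlt => /orP[/eqP/val_inj E|lk]; first by rewrite E eqxx in ik.
have kr : 0 < k' < r.
  by rewrite (leq_ltn_trans _ lk) //= (leq_trans kj) // -ltnS.
have [|w [w1 w2]] := Hf r k' kr u (simplex_map (psi r e)); first exact: Hu.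
exists (w r (mono_id r)); split=> [m a|].
  rewrite -smap_nat -w1; congr (w m _); apply: mono_eq => ? //.
by rewrite w2 /= act_id.
Qed.

Lemma mono_factor m n (s : mono m n.+1) (j : 'I_n.+2) :
  (forall i, s i <> j) -> exists t : mono m n, s = mono_comp (mono_face j) t.
Proof.
move=> Hj.
have /choice[t Ht] : forall i, exists k, lift j k = s i.
  move=> i; have : j != s i by apply/eqP => E; apply: (Hj i).
  by case/unlift_some => k -> _; exists k.
have th (a b : 'I_m.+1) : a <= b -> t a <= t b.
  by move=> /(mono_homo s); rewrite -!Ht /= leq_bump2.
by exists (Mono th); apply: mono_eq => i /=; rewrite Ht.
Qed.

Lemma mono_face_inj m n (j : 'I_n.+2) (s t : mono m n) :
  mono_comp (mono_face j) s = mono_comp (mono_face j) t -> s = t.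
Proof.
move=> E; apply: mono_eq => i; apply: (@lift_inj _ j).
exact: (congr1 (fun z : mono m n.+1 => mono_fun z i) E).
Qed.

(** * Horns given by their faces *)

Section HornFaces.
Variables (X : sSet) (n : nat) (k : 'I_n.+3) (x : 'I_n.+3 -> X n.+1).
Hypothesis xC : forall i j : 'I_n.+3, i != k -> j != k -> i < j ->
  face (inord i) (x j) = face (inord j.-1) (x i).

(** For [i < j] the common simplex avoids both vertices, so [t] misses [i] and [s] misses [j.-1];
    both factor through the same face of codimension two, where the simplicial identity [xC]
    applies. *)
Lemma horn_faces_wd m (s t : mono m n.+1) (i j : 'I_n.+3) :
  i != k -> j != k ->
  mono_comp (mono_face i) s = mono_comp (mono_face j) t ->
  act s (x i) = act t (x j).
Proof.
wlog ij : s t i j / i <= j => [H|] ik jk E.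
  by case: (leqP i j) => [/H|/ltnW/H H']; [apply | symmetry; apply: H'].
move: ij; rewrite leq_eqVlt => /orP[/eqP/val_inj ij|ij].
  by subst j; rewrite (mono_face_inj E).
have bi : i < n.+2 by rewrite (leq_trans ij) // -ltnS.
have bj : j.-1 < n.+2 by have := ltn_ord j; lia.
have ti a : t a <> inord i.
  move=> Ea; have := congr1 (fun z : mono m n.+2 => nat_of_ord (mono_fun z a)) E.
  by rewrite /= Ea /bump inordK //; lia.
have [t' Et] := mono_factor ti.
have sj a : s a <> inord j.-1.
  move=> Ea; have := congr1 (fun z : mono m n.+2 => nat_of_ord (mono_fun z a)) E.
  by rewrite /= Ea /bump inordK //; lia.
have [s' Es] := mono_factor sj.
have Est : s' = t'.
  apply: mono_eq => a; apply: val_inj; have := congr1 (fun z : mono m n.+2 =>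
    nat_of_ord (mono_fun z a)) E.
  by rewrite Es Et /= /bump !inordK //; lia.
by rewrite Es Et Est -!act_comp; congr act; symmetry; apply: xC.
Qed.

Lemma horn_faces : exists u : smap (horn k) X,
  forall m (s : mono m n.+1) j (H : in_horn k (mono_comp (mono_face j) s : Delta _ m)),
    j != k -> u m (exist _ _ H) = act s (x j).
Proof.
have ex m (a : horn k m) : exists js : 'I_n.+3 * mono m n.+1, js.1 != k /\
    sval a = mono_comp (mono_face js.1) js.2.
  case: a => a [j [jk Hj]] /=; have [t Et] := mono_factor Hj.
  by exists (j, t); split=> //; apply/eqP.
pose c m a := sval (cid (ex m a)).
have cP m a : (c m a).1 != k /\ sval a = mono_comp (mono_face (c m a).1) (c m a).2.
  by rewrite /c; case: cid.
have nat m p (a : mono m p) (s : horn k p) :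
    act (c m (act a s)).2 (x (c m (act a s)).1) = act a (act (c p s).2 (x (c p s).1)).
  rewrite act_comp; apply: horn_faces_wd; try by case: (cP _ (act a s)); case: (cP _ s).
  have [_ <-] := cP _ (act a s); have [_ Es] := cP _ s.
  by rewrite /= Es; apply: mono_eq.
exists (@SMap (horn k) X (fun m a => act (c m a).2 (x (c m a).1)) nat).
move=> m s j H jk; apply: horn_faces_wd => //; first by case: (cP _ (exist _ _ H)).
by have [_ <-] := cP _ (exist _ _ H).
Qed.

Lemma horn_fill : quasi_category X -> 0 < k < n.+2 ->
  exists w : X n.+2, forall j, j != k -> face j w = x j.
Proof.
move=> qX kn; have [u Hu] := horn_faces; have [w Hw] := qX _ _ kn u.
exists (w _ (mono_id _)) => j jk; rewrite /face -smap_nat.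
have H : in_horn k (mono_comp (mono_face j) (mono_id n.+1) : Delta _ _).
  by exists j; split; [apply/eqP | move=> i /=; apply/eqP; rewrite eq_sym neq_lift].
have := Hw _ (exist _ _ H); rewrite Hu // act_id => <-; congr (w _ _).
Qed.

End HornFaces.

(** That is, [c] is a composite of [a] followed by [b]. *)
Definition tri (X : sSet) (a b c : X 1) : Prop :=
  exists s : X 2, [/\ face ord_max s = a, face ord0 s = b &
    face (@Ordinal 3 1 isT) s = c].

Definition src (X : sSet) (e : X 1) : X 0 := vertex ord0 e.
Definition tgt (X : sSet) (e : X 1) : X 0 := vertex ord_max e.

Ltac monoq := apply: mono_eq; let i := fresh in move=> i; apply: val_inj.

Lemma vertexE (X : sSet) n (i : 'I_n.+1) (a : mono 0 n) (x : X n) :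
  a ord0 = i -> act a x = vertex i x.
Proof. by move=> <-; congr act; apply: mono_eq => j; rewrite /= ord1. Qed.

Lemma act_cst (X : sSet) m n (i : 'I_n.+1) (a : mono m n) (x : X n) :
  (forall j, a j = i) -> act a x = deg m (vertex i x).
Proof. by move=> H; rewrite /deg /vertex act_comp; congr act; apply: mono_eq. Qed.

Lemma ord2P (P : 'I_2 -> Prop) : P ord0 -> P ord_max -> forall i, P i.
Proof.
move=> P0 P1 [[|[|i]] Hi] //.
  by rewrite (_ : Ordinal Hi = ord0) //; apply: val_inj.
by rewrite (_ : Ordinal Hi = ord_max) //; apply: val_inj.
Qed.

Lemma tri_ends (X : sSet) (a b c : X 1) : tri a b c ->
  [/\ src c = src a, tgt a = src b & tgt c = tgt b].
Proof.
case=> s [<- <- <-]; rewrite /src /tgt /vertex /face !act_comp.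
by split; congr act; monoq.
Qed.

Lemma tri_map (X Y : sSet) (f : smap X Y) a b c :
  tri a b c -> tri (f 1 a) (f 1 b) (f 1 c).
Proof. by case=> s [<- <- <-]; exists (f 2 s); rewrite /face !smap_nat. Qed.

Lemma src_deg (X : sSet) (x : X 0) : src (deg 1 x) = x.
Proof. exact: vertex_deg. Qed.

Lemma tgt_deg (X : sSet) (x : X 0) : tgt (deg 1 x) = x.
Proof. exact: vertex_deg. Qed.

Lemma act_face (X : sSet) (a : X 1) (s : mono 2 1) (k : 'I_3) :
  (forall i, s (lift k i) = i) -> face k (act s a) = a.
Proof.
by move=> H; rewrite /face act_comp -[RHS](act_id (s := X)); congr act;
  apply: mono_eq => i; apply: H.
Qed.

Lemma tri_dega (X : sSet) (a : X 1) : tri (deg 1 (src a)) a a.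
Proof.
exists (act (mono_tri 2) a); split.
- rewrite /face act_comp (@act_cst _ _ _ ord0) //.
  by elim/ord2P.
- by apply: act_face; elim/ord2P; apply: val_inj.
- by apply: act_face; elim/ord2P; apply: val_inj.
Qed.

Lemma tri_adeg (X : sSet) (a : X 1) : tri a (deg 1 (tgt a)) a.
Proof.
exists (act (mono_tri 1) a); split.
- by apply: act_face; elim/ord2P; apply: val_inj.
- rewrite /face act_comp (@act_cst _ _ _ ord_max) //.
- by apply: act_face; elim/ord2P; apply: val_inj.
Qed.

Lemma tri_ho (X : sSet) (a b c : X 1) : tri a b c ->
  hoeq (src a) (tgt b) [:: a; b] [:: c].
Proof.
case=> s [<- <- <-]; have := hoeq_triangle s.
have -> : src (face ord_max s) = vertex ord0 s.
  by rewrite /src /vertex /face act_comp; congr act; monoq.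
have -> // : tgt (face ord0 s) = vertex ord_max s.
by rewrite /tgt /vertex /face act_comp; congr act; monoq.
Qed.

Notation i1 := (@Ordinal 3 1 isT).
Notation j1 := (@Ordinal 4 1 isT).
Notation j2 := (@Ordinal 4 2 isT).

(** * The Boardman-Vogt description of the homotopy category of a quasi-category *)

Section Boardman.
Variable X : sSet.
Hypothesis qX : quasi_category X.
Implicit Types a b c : X 1.

Lemma ord4P (P : 'I_4 -> Prop) :
  P ord0 -> P (@Ordinal 4 1 isT) -> P (@Ordinal 4 2 isT) -> P ord_max -> forall i, P i.
Proof.
move=> P0 P1 P2 P3 [[|[|[|[|i]]]] Hi] //.
- by rewrite (_ : Ordinal Hi = ord0) //; apply: val_inj.
- by rewrite (_ : Ordinal Hi = @Ordinal 4 1 isT) //; apply: val_inj.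
- by rewrite (_ : Ordinal Hi = @Ordinal 4 2 isT) //; apply: val_inj.
- by rewrite (_ : Ordinal Hi = ord_max) //; apply: val_inj.
Qed.

Lemma inordE n (k : nat) (i : 'I_n.+1) : k = i -> inord k = i.
Proof. by move=> ->; apply: inord_val. Qed.


Lemma horn3_2 (x0 x1 x3 : X 2) :
  face ord0 x1 = face ord0 x0 -> face ord0 x3 = face ord_max x0 ->
  face i1 x3 = face ord_max x1 ->
  exists w : X 3, [/\ face ord0 w = x0, face j1 w = x1 & face ord_max w = x3].
Proof.
move=> H01 H03 H13.
pose x (i : 'I_4) := if i == 0 :> nat then x0 else if i == 1 :> nat then x1 else x3.
have [|//|w Hw] := @horn_fill X 1 j2 x _ qX.
  move=> i j; move: i; elim/ord4P: j => i; elim/ord4P: i => // _ _ _;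
  rewrite /x /=.
  - by rewrite (inordE (i := ord0)) ?(inordE (i := ord0)) // H01.
  - by rewrite (inordE (i := ord0)) ?(inordE (i := ord_max)) // H03.
  - by rewrite (inordE (i := i1)) ?(inordE (i := ord_max)) // H13.
by exists w; rewrite !Hw.
Qed.

Lemma horn3_1 (x0 x2 x3 : X 2) :
  face ord0 x2 = face i1 x0 -> face ord0 x3 = face ord_max x0 ->
  face ord_max x3 = face ord_max x2 ->
  exists w : X 3, [/\ face ord0 w = x0, face j2 w = x2 & face ord_max w = x3].
Proof.
move=> H02 H03 H23.
pose x (i : 'I_4) := if i == 0 :> nat then x0 else if i == 2 :> nat then x2 else x3.
have [|//|w Hw] := @horn_fill X 1 j1 x _ qX.
  move=> i j; move: i; elim/ord4P: j => i; elim/ord4P: i => // _ _ _;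
  rewrite /x /=.
  - by rewrite (inordE (i := ord0)) ?(inordE (i := i1)) // H02.
  - by rewrite (inordE (i := ord0)) ?(inordE (i := ord_max)) // H03.
  - by rewrite (inordE (i := ord_max)) ?(inordE (i := ord_max)) // H23.
by exists w; rewrite !Hw.
Qed.

Lemma face_face3 (w : X 3) :
  [/\ face ord0 (face j1 w) = face ord0 (face ord0 w),
     face ord0 (face j2 w) = face i1 (face ord0 w),
     face ord0 (face ord_max w) = face ord_max (face ord0 w) &
  [/\ face i1 (face j2 w) = face i1 (face j1 w),
     face i1 (face ord_max w) = face ord_max (face j1 w) &
     face ord_max (face ord_max w) = face ord_max (face j2 w)]].
Proof.
rewrite /face !act_comp; do ?split; congr act;
  by apply: mono_eq; elim/ord2P; apply: val_inj.
Qed.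

(** In a 3-simplex with short edges [a], [b], [e], each of the two middle faces is obtained from the
    other by filling the inner horn that omits it. The properties of [homotopic] below come from
    this equivalence applied to degenerate triangles. *)
Lemma tri_assoc a b c e g h :
  tri a b c -> tri b e g -> (tri a g h <-> tri c e h).
Proof.
move=> [s3 [s3a s3b s3c]] [s0 [s0a s0b s0c]]; split=> [[s2 [s2a s2b s2c]]|[s1 [s1a s1b s1c]]].
  have [|||w [w0 w2 w3]] := @horn3_1 s0 s2 s3; try congruence.
  exists (face j1 w); case: (face_face3 w) => e1 e2 e3 [e4 e5 e6].
  by split; congruence.
have [|||w [w0 w1 w3]] := @horn3_2 s0 s1 s3; try congruence.
exists (face j2 w); case: (face_face3 w) => e1 e2 e3 [e4 e5 e6].
by split; congruence.
Qed.

Arguments tri_assoc {a b c e g h} _ _.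

Lemma tri_comp a b : tgt a = src b -> exists c, tri a b c.
Proof.
move=> E.
pose x (i : 'I_3) := if i == 0 :> nat then b else a.
have face01 (e : X 1) : face ord0 e = tgt e by apply: vertexE; apply: val_inj.
have face11 (e : X 1) : face ord_max e = src e by apply: vertexE; apply: val_inj.
have [|//|w Hw] := @horn_fill X 0 i1 x _ qX.
  move=> [[|[|[|i]]] Hi] [[|[|[|j]]] Hj] // _ _ _; rewrite /x /=.
  by rewrite (inordE (i := ord0)) ?(inordE (i := ord_max)) // face01 face11.
exists (face i1 w), w; split=> //; by rewrite Hw.
Qed.

Lemma tri_uniq a b c c' : tri a b c -> tri a b c' -> tri c (deg 1 (tgt c)) c'.
Proof.
move=> T; have [_ _ E] := tri_ends T.
by rewrite E => T'; apply/(tri_assoc T (tri_adeg b)).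
Qed.

Definition homotopic a b := tri a (deg 1 (tgt a)) b.

Lemma homotopic_refl a : homotopic a a.
Proof. exact: tri_adeg. Qed.

Lemma homotopic_ends a b : homotopic a b -> src b = src a /\ tgt b = tgt a.
Proof. by case/tri_ends => -> _ ->; rewrite tgt_deg. Qed.

Lemma homotopic_sym a b : homotopic a b -> homotopic b a.
Proof. by move=> H; apply: tri_uniq H (tri_adeg a). Qed.

Lemma tri_eq3 a b c c' : tri a b c -> homotopic c c' -> tri a b c'.
Proof.
move=> T; have [_ _ E] := tri_ends T.
by rewrite /homotopic E => T'; apply/(tri_assoc T (tri_adeg b)).
Qed.

Lemma homotopic_trans a b c : homotopic a b -> homotopic b c -> homotopic a c.
Proof. exact: tri_eq3. Qed.

Lemma tri_eq2 a b b' c : tri a b c -> homotopic b b' -> tri a b' c.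
Proof.
move=> T H; apply/(tri_assoc T H); have [_ _ <-] := tri_ends T.
exact: tri_adeg.
Qed.

Lemma tri_eq1 a a' b c : tri a b c -> homotopic a a' -> tri a' b c.
Proof.
move=> T H; have [_ E _] := tri_ends T.
by apply/(tri_assoc H (g := b)) => //; rewrite E; apply: tri_dega.
Qed.

Lemma tri_deg_homotopic a b : tri (deg 1 (src a)) a b -> homotopic a b.
Proof. by move=> T; apply: tri_uniq T; apply: tri_dega. Qed.


(* [eval x s c]: the edge c is a composite of the path s starting at x. *)
Fixpoint eval (x : X 0) (s : seq (X 1)) (c : X 1) : Prop :=
  if s is e :: s' then
    src e = x /\ exists c', eval (tgt e) s' c' /\ tri e c' c
  else homotopic (deg 1 x) c.

Lemma eval_src x s c : eval x s c -> src c = x.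
Proof.
case: s => [/homotopic_ends[-> _]|e s [<- [c' [_ /tri_ends[]]]]] //.
exact: src_deg.
Qed.

Lemma eval_eq x s c c' : eval x s c -> homotopic c c' -> eval x s c'.
Proof.
case: s => [|e s] /=; first exact: homotopic_trans.
move=> [-> [c0 [H T]]] H'; split=> //; exists c0; split=> //; exact: tri_eq3 H'.
Qed.


Lemma eval_ex x s y : is_path x s y -> exists c, eval x s c /\ tgt c = y.
Proof.
elim: s x => [|e s IH] x /= => [->|[Ex /IH[c' [Hc' tc']]]].
  by exists (deg 1 y); split; [apply: homotopic_refl | apply: tgt_deg].
have [c T] : exists c, tri e c' c by apply: tri_comp; rewrite (eval_src Hc').
exists c; split; last by case: (tri_ends T) => _ _ ->.
by split=> //; exists c'.
Qed.

Lemma eval_cat x s y t c : is_path x s y ->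
  eval x (s ++ t) c <-> exists a b, [/\ eval x s a, eval y t b & tri a b c].
Proof.
elim: s x c => [|e s IH] x c /= => [->|[Ex Hs]].
  split=> [H|[a [b [Ha Hb T]]]].
    exists (deg 1 y), c; split=> //; first exact: homotopic_refl.
    by rewrite -(eval_src H); apply: tri_dega.
  apply: eval_eq (Hb) _; apply: tri_deg_homotopic.
  by rewrite (eval_src Hb); apply: tri_eq1 T _; apply: homotopic_sym.
split=> [[_ [c' [/(IH _ _ Hs)[a [b [Ha Hb T]]] T']]]|[a [b [[_ [a' [Ha' T']]] Hb T]]]].
  have [d Td] : exists d, tri e a d by apply: tri_comp; rewrite (eval_src Ha).
  exists d, b; split=> //; first by split=> //; exists a.
  by apply/(tri_assoc Td T).
have [d Td] : exists d, tri a' b d.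
  by apply: tri_comp; case: (tri_ends T) => _ <- _; case: (tri_ends T') => _ _ ->.
split=> //; exists d; split; first by apply/IH => //; exists a', b.
by apply/(tri_assoc T' Td).
Qed.

Lemma eval1 (e c : X 1) : eval (src e) [:: e] c <-> homotopic e c.
Proof.
split=> [[_ [d [H T]]]|H].
  by apply: tri_eq2 T _; apply: homotopic_sym.
split=> //; exists (deg 1 (tgt e)); split=> //; exact: homotopic_refl.
Qed.

Lemma eval2 (a b c : X 1) : tgt a = src b ->
  eval (src a) [:: a; b] c <-> tri a b c.
Proof.
move=> E; split=> [[_ [d [H T]]]|T].
  by apply: tri_eq2 T _; apply: homotopic_sym; apply/eval1; rewrite -E.
split=> //; exists b; split=> //; rewrite E; apply/eval1; exact: homotopic_refl.
Qed.

(** Each generator of [hoeq] preserves the set of composites of a path. This invariant is what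
    allows an inductively generated congruence to be inverted: equality of 2-cells is reduced to the
    existence of one 2-simplex. *)
Lemma hoeq_eval x y s t : hoeq x y s t -> forall c, eval x s c <-> eval x t c.
Proof.
elim=> {x y s t} //.
- by move=> x y s t _ IH c; rewrite IH.
- by move=> x y s t u _ IH _ IH' c; rewrite IH IH'.
- move=> x y z s s' t t' H IH H' IH' c.
  have ps := hoeq_left H; have ps' := hoeq_right H.
  rewrite (eval_cat _ _ ps) (eval_cat _ _ ps').
  by split=> -[a [b [Ha Hb T]]]; exists a, b; split=> //;
    [apply/IH | apply/IH' | apply/IH | apply/IH'].
- by move=> x c; rewrite -[X in eval X _](src_deg x) eval1.
- move=> s c.
  have T : tri (face ord_max s) (face ord0 s) (face i1 s) by exists s.
  have [E1 E2 E3] := tri_ends T.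
  have -> : vertex ord0 s = src (face ord_max s).
    by rewrite /src /vertex /face act_comp; congr act; monoq.
  rewrite eval2 // -E1 eval1.
  by split=> H; [apply: tri_uniq T H | apply: tri_eq3 T H].
Qed.

Lemma hoeq_eval1 x s c : eval x s c -> is_path x s (tgt c) -> hoeq x (tgt c) s [:: c].
Proof.
elim: s x c => [|e s IH] x c.
  move=> /= H E; subst x; have := tri_ho H; rewrite !tgt_deg src_deg.
  apply: hoeq_trans; apply: hoeq_sym.
  exact: (hoeq_cat (hoeq_deg (tgt c)) (hoeq_deg (tgt c))).
move=> [Ex [c' [Hc' T]]] [_ Hs]; have [E1 E2 E3] := tri_ends T.
have := IH _ _ Hc'; rewrite -E3 => /(_ Hs) H.
have := tri_ho T; rewrite Ex -E3; apply: hoeq_trans.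
by apply: (@hoeq_catl _ _ _ _ [:: e]).
Qed.

Lemma path_edge_ex x s y : is_path x s y ->
  exists c, [/\ src c = x, tgt c = y & hoeq x y s [:: c]].
Proof.
move=> p; have [c [H E]] := eval_ex p; exists c; split=> //; first exact: eval_src H.
by rewrite -E; apply: hoeq_eval1 => //; rewrite E.
Qed.

Lemma hoeq_homotopic x y a b : hoeq x y [:: a] [:: b] -> homotopic a b.
Proof.
move=> H; have [Ex _] := hoeq_left H; have [Ex' _] := hoeq_right H.
apply: homotopic_sym; apply/eval1; rewrite -[src b]/(vertex ord0 b) Ex'.
apply/(hoeq_eval H); rewrite -Ex; apply/eval1; exact: homotopic_refl.
Qed.

Lemma homotopic_hoeq x y a b : src a = x -> tgt a = y -> homotopic a b ->
  hoeq x y [:: a] [:: b].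
Proof.
move=> <- <- H; have := tri_ho H; rewrite tgt_deg; apply: hoeq_trans.
rewrite -[X in hoeq _ _ X]cats0 -[X in hoeq _ _ _ X]/([:: a] ++ [:: _]).
by apply: hoeq_catl => //; apply: hoeq_sym; apply: hoeq_deg.
Qed.

Lemma hoeq_tri x y a b c : hoeq x y [:: a; b] [:: c] -> tri a b c.
Proof.
move=> H; have [Ex [E _]] := hoeq_left H; have [Ex' _] := hoeq_right H.
apply/eval2 => //; rewrite -[src a]/(vertex ord0 a) Ex; apply/(hoeq_eval H).
rewrite -Ex'; apply/eval1; exact: homotopic_refl.
Qed.

Lemma hoeq_tri_nil x a b : hoeq x x [:: a; b] [::] -> tri a b (deg 1 x).
Proof.
by move=> H; apply: hoeq_tri; apply: hoeq_trans H _; apply: hoeq_sym; apply: hoeq_deg.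
Qed.

Lemma tri_hoeq_nil a b : tri a b (deg 1 (src a)) -> hoeq (src a) (src a) [:: a; b] [::].
Proof.
move=> T; have [_ _ E] := tri_ends T; have := tri_ho T.
by rewrite -E tgt_deg => H; apply: hoeq_trans H _; apply: hoeq_deg.
Qed.

Lemma ho_invertible_tri a : ho_invertible (src a) (tgt a) [:: a] <->
  exists b, tri a b (deg 1 (src a)) /\ tri b a (deg 1 (tgt a)).
Proof.
split=> [[_ [t [pt at_ ta]]]|[b [T T']]].
  have [b [Eb Eb' H]] := path_edge_ex pt; exists b; split; apply: hoeq_tri_nil.
    apply: hoeq_trans at_; apply: (@hoeq_catl _ _ _ _ [:: a]) => //.
    exact: hoeq_sym.
  apply: hoeq_trans ta; apply: (@hoeq_catr _ _ _ _ [:: b]) => //.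
  exact: hoeq_sym.
have [E1 E2 E3] := tri_ends T; have [E1' E2' E3'] := tri_ends T'.
split; first by []; exists [:: b]; split.
- by rewrite /= -[vertex ord0 b]/(src b) -E2 -[vertex _ b]/(tgt b) -E2'.
- exact: tri_hoeq_nil.
- by have := @tri_hoeq_nil b a; rewrite -E2; apply.
Qed.

(** If [b] is a left inverse of [a] and [c] one of [b], then [a] and [c] are homotopic, being right
    and left inverse to [b]. Stated for a class, this leaves only left inverses to be
    constructed. *)
Lemma left_inverse_invertible (C : X 1 -> Prop) :
  (forall a, C a -> exists b, C b /\ tri a b (deg 1 (src a))) ->
  forall a, C a -> ho_invertible (src a) (tgt a) [:: a].
Proof.
move=> H a Ca; have [b [Cb T]] := H a Ca; have [c [Cc T']] := H b Cb.
have [E1 E2 E3] := tri_ends T; have [E1' E2' E3'] := tri_ends T'.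
apply/ho_invertible_tri; exists b; split=> //.
have T2 : tri (deg 1 (src a)) c a.
  by apply/(tri_assoc T T') => //; rewrite -E2; apply: tri_adeg.
rewrite E2; apply: tri_eq2 T' _; apply: tri_deg_homotopic.
by rewrite -E2' -E3 tgt_deg.
Qed.

End Boardman.
Arguments tri_assoc {X} qX {a b c e g h} _ _.

(** * Special outer horns *)

Definition point : sSet.
Proof.
by apply: (@SSet (fun _ => unit) (fun _ _ _ _ => tt)) => // n [].
Defined.

Definition to_point (X : sSet) : smap X point :=
  @SMap X point (fun _ _ => tt) (fun _ _ _ _ => erefl).

Lemma point_qcat : quasi_category point.
Proof.
by move=> n k _ u; exists (to_point _) => m b /=; case: (u m b).
Qed.

Lemma point_inner (X : sSet) : quasi_category X -> inner_fibration (to_point X).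
Proof.
move=> qX n k kn u v H; have [w Hw] := qX n k kn u; exists w; split=> //.
by move=> m b; case: (v m b).
Qed.

Definition edge01 n : mono 1 n.+1.
Proof.
apply: (@Mono 1 n.+1 (fun i => inord i)) => i j ij; rewrite !inordK //.
  exact: leq_trans (ltn_ord j) _.
exact: leq_trans (ltn_ord i) _.
Defined.

Definition mono_step n (c : nat) : mono n 1.
Proof.
apply: (@Mono n 1 (fun i => if i < c then ord0 else ord_max)) => i j ij.
case: ifP => // /negbT; rewrite -leqNgt => ki.
by rewrite ltnNge (leq_trans ki ij).
Defined.

(* The vertices of w are x, y, x, y; its edges from 0 to 3 and from 2 to 3 are
   a : x -> y, those from 0 to 2 and from 1 to 3 are degenerate. *)
Lemma invertible_simplex3 (X : sSet) (a : X 1) : quasi_category X ->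
  ho_invertible (src a) (tgt a) [:: a] ->
  exists w : X 3,
    (forall m (s : mono m 3), (forall i, s i <> j1) ->
       act s w = act (mono_comp (mono_step 3 3) s) a) /\
    (forall m (s : mono m 3), (forall i, s i <> ord0) -> (forall i, s i <> j2) ->
       act s w = deg m (tgt a)).
Proof.
move=> qX /(ho_invertible_tri qX)[b [[x3 [x3a x3b x3c]] [x0 [x0a x0b x0c]]]].
(* [x1] is the degenerate triangle on vertices 0, 2, 3, sent to x, x, y. Together with the two
   halves of the invertibility of [a] it forms an inner horn at 2. *)
pose x1 := act (mono_tri 2) a.
have e0 : face ord0 x1 = a by apply: act_face; elim/ord2P; apply: val_inj.
have e2 : face ord_max x1 = deg 1 (src a).
  by rewrite /face act_comp; apply: act_cst; elim/ord2P.
have [|||w [w0 w1 w3]] := @horn3_2 X qX x0 x1 x3; try congruence.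
exists w; split=> m s.
  move=> /mono_factor[t ->]; rewrite -act_comp -/(face j1 w) w1 /x1 act_comp.
  congr act; apply: mono_eq => i; rewrite /= /bump.
  by case: (t i) => [[|[|[|?]]] ?].
move=> /mono_factor[t ->] H.
have /mono_factor[t' ->] : forall i, t i <> i1.
  by move=> i E; apply: (H i); rewrite /= E; apply: val_inj.
rewrite -act_comp -/(face ord0 w) w0 -act_comp -/(face i1 x0) x0c.
exact: deg_act.
Qed.

(* The simplex on the rungs 0, 1, 2, 3, sent to x, y, x, y, followed by the
   remaining vertices T of the horn to be filled.  The given horn is read off on
   the rungs 0 and 3, and every step from there to its filler attaches inner
   horns only. *)
Section Ladder.
Variable t : nat.

Notation Pi := ('I_4 + 'I_t.+1)%type.

Definition ladder_le (x y : Pi) : bool :=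
  match x, y with
  | inl i, inl j => i <= j
  | inl _, inr _ => true
  | inr _, inl _ => false
  | inr i, inr j => i <= j
  end.

Lemma ladder_refl : reflexive ladder_le.
Proof. by case=> i /=. Qed.

Lemma ladder_trans : transitive ladder_le.
Proof. by case=> i [] j [] k //=; apply: leq_trans. Qed.

Lemma ladder_anti : antisymmetric ladder_le.
Proof.
by case=> i [] j //=; rewrite -eqn_leq => /eqP/val_inj ->.
Qed.

Lemma ladder_linear V : linear ladder_le V.
Proof. by case=> i [] j //= _ _; apply: leq_total. Qed.

Notation N := (nerve ladder_le).

Definition ladder_rank (g : nat -> nat) (x : Pi) : nat :=
  match x with inl i => g i | inr j => j + g 4 end.

Section Map.
Variables (n : nat) (g : nat -> nat).
Hypothesis Hg : (forall i j, i <= j -> g i <= g j) /\ t + g 4 <= n.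

Lemma ladder_rank_lt x : ladder_rank g x < n.+1.
Proof.
rewrite ltnS; apply: leq_trans (proj2 Hg); case: x => i /=.
  by apply: leq_trans (leq_addl _ _); apply: (proj1 Hg); apply: ltnW.
by rewrite leq_add2r -ltnS.
Qed.

Lemma ladder_rank_homo x y : ladder_le x y -> ladder_rank g x <= ladder_rank g y.
Proof.
case: x => a; case: y => b //= ab.
- exact: (proj1 Hg).
- by apply: leq_trans (leq_addl _ _); apply: (proj1 Hg); apply: ltnW.
- by rewrite leq_add2r.
Qed.

(* The map Pi -> [n] sending the i-th rung to g i and T onto g 4, g 4 + 1, ... *)
Definition ladder_map m (s : N m) : mono m n :=
  @Mono m n (fun i => Ordinal (ladder_rank_lt (chain_fun s i)))
    (fun i j ij => ladder_rank_homo (chain_homo s ij)).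

End Map.


Lemma ladder_map_act n g (Hg : (forall i j, i <= j -> g i <= g j) /\ t + g 4 <= n) m p
  (a : mono m p) (s : N p) : ladder_map Hg (act a s) = mono_comp (ladder_map Hg s) a.
Proof. by apply: mono_eq => i; apply: val_inj. Qed.

Definition no (k : nat) (V : {set Pi}) : bool :=
  [forall i : 'I_4, (i == k :> nat) ==> (inl i \notin V)].
Definition noT (V : {set Pi}) : bool := [forall j, inr j \notin V].
Definition notT (V : {set Pi}) : bool := [exists j, inr j \notin V].

Lemma noP k (V : {set Pi}) : reflect (forall i : 'I_4, i = k :> nat -> inl i \notin V) (no k V).
Proof.
apply: (iffP forallP) => H i; first by move=> E; have := H i; rewrite E eqxx.
by apply/implyP => /eqP; apply: H.
Qed.

Lemma dc_no k : downclosed (no k).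
Proof.
move=> V W /subsetP WV /noP H; apply/noP => i E; apply: contra (H i E); exact: WV.
Qed.
Lemma dc_noT : downclosed noT.
Proof.
move=> V W /subsetP WV /forallP H; apply/forallP => i; apply: contra (H i); exact: WV.
Qed.
Lemma dc_notT : downclosed notT.
Proof.
move=> V W /subsetP WV /existsP[i H]; apply/existsP; exists i; apply: contra H; exact: WV.
Qed.
Lemma dc_or (F G : {set Pi} -> bool) : downclosed F -> downclosed G ->
  downclosed (fun V => F V || G V).
Proof. by move=> HF HG V W WV /orP[/(HF _ _ WV)->//|/(HG _ _ WV)->]; rewrite orbT. Qed.
Lemma dc_and (F G : {set Pi} -> bool) : downclosed F -> downclosed G ->
  downclosed (fun V => F V && G V).
Proof. by move=> HF HG V W WV /andP[/(HF _ _ WV)->/(HG _ _ WV)->]. Qed.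
Lemma dc_cst b : downclosed (fun _ : {set Pi} => b).
Proof. by []. Qed.

Lemma noT_notT V : noT V -> notT V.
Proof. by move/forallP/(_ ord0) => H; apply/existsP; exists ord0. Qed.

Section Toggle.
Variables (k : 'I_4) (V : {set Pi}).

Lemma no_add i : no i (inl k |: V) = (i != k) && no i V.
Proof.
apply/noP/andP => [H|[ik /noP H] j Ej].
  split; first by apply/eqP => E; have := H k (esym E); rewrite !inE eqxx.
  by apply/noP => j /H; rewrite !inE negb_or => /andP[].
rewrite !inE negb_or H // andbT; apply/eqP => -[E].
by case/eqP: ik; rewrite -E.
Qed.

Lemma no_del i : no i (V :\ inl k) = (i == k) || no i V.
Proof.
apply/noP/orP => [H|[/eqP-> j /val_inj->|/noP H j Ej]]; last 2 first.
- by rewrite !inE eqxx.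
- by rewrite !inE negb_and H // orbT.
case: eqP => ik; [by left | right]; apply/noP => j Ej; have := H j Ej.
rewrite !inE negb_and negbK => /orP[/eqP[E]|//].
by case: ik; rewrite -Ej E.
Qed.

Lemma noT_add : noT (inl k |: V) = noT V.
Proof. by apply: eq_forallb => j; rewrite !inE. Qed.
Lemma noT_del : noT (V :\ inl k) = noT V.
Proof. by apply: eq_forallb => j; rewrite !inE. Qed.
Lemma notT_add : notT (inl k |: V) = notT V.
Proof. by apply: eq_existsb => j; rewrite !inE. Qed.
Lemma notT_del : notT (V :\ inl k) = notT V.
Proof. by apply: eq_existsb => j; rewrite !inE. Qed.

Definition toggleE := (no_add, no_del, noT_add, noT_del, notT_add, notT_del).
End Toggle.

Lemma Nno k V : ~~ no k V -> exists2 i : 'I_4, i = k :> nat & inl i \in V.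
Proof.
by move/forallPn => [i]; rewrite negb_imply negbK => /andP[/eqP E H]; exists i.
Qed.

Lemma NnoT V : ~~ noT V -> exists j, inr j \in V.
Proof. by move/forallPn => [i]; rewrite negbK; exists i. Qed.

Lemma NnotT V : ~~ notT V -> ~~ noT V.
Proof. exact/contra/noT_notT. Qed.


Section Step.
Variables (P R : sSet) (f : smap P R) (psi : smap N R).
Hypothesis f_inner : inner_fibration f.

(** Every missing chain has a rung [i] below [k] and a vertex of T above it, so toggling [k] fills
    inner horns only. *)
Lemma ladder_step (F F' : {set Pi} -> bool) phi (k : 'I_4) (i : nat) :
  downclosed F -> downclosed F' -> (forall V, F V -> F' V) ->
  (forall V, F' V -> ~~ F V -> [/\ F' (inl k |: V) && ~~ F (inl k |: V),
     F' (V :\ inl k) && ~~ F (V :\ inl k), ~~ no i V & ~~ noT V]) ->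
  i < k ->
  psec f psi (nsub F) phi ->
  exists phi', (forall m y, nsub F y -> phi' m y = phi m y) /\
    psec f psi (nsub F') phi'.
Proof.
move=> dF dF' FF' tog ik; apply: (@psec_toggle _ ladder_le ladder_refl
  ladder_trans ladder_anti _ _ _ _ _ _ _ (inl k)) => //.
- by move=> V F'V nFV; have [-> -> _ _] := tog V F'V nFV; split=> //; apply: ladder_linear.
- move=> U F'U nFU kU; have [_ _ /Nno[j Ej jU] /NnoT[l lU]] := tog U F'U nFU.
  apply: (@inner_fillable _ ladder_le _ _ _ _ _ _ _ _ _ _ ladder_anti f_inner jU lU) => //.
  + by apply/eqP => -[E]; move: ik; rewrite -Ej E ltnn.
  + by rewrite /= Ej ltnW.
Qed.

End Step.

(** [g2] sends rungs 0, 1, 2 to vertex 0 and rung 3 to vertex 1; it serves chains avoiding rung 1,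
    as rungs 0 and 2 both lie over x. [g3] sends rung 0 to 0 and rungs 1, 2, 3 to 1; it serves
    chains avoiding 0 and 2, as rungs 1 and 3 both lie over y. The value 2 at 4 is where T
    starts. *)
Definition g2 (i : nat) : nat := if i < 3 then 0 else i - 2.
Definition g3 (i : nat) : nat := if i < 1 then 0 else if i < 4 then 1 else i - 2.

Lemma g2P : (forall i j, i <= j -> g2 i <= g2 j) /\ t + g2 4 <= t.+2.
Proof.
split=> [i j|]; last by rewrite /g2 /=; lia.
by rewrite /g2; case: (ltnP i 3); case: (ltnP j 3); lia.
Qed.
Lemma g3P : (forall i j, i <= j -> g3 i <= g3 j) /\ t + g3 4 <= t.+2.
Proof.
split=> [i j|]; last by rewrite /g3 /=; lia.
rewrite /g3; case: (ltnP i 1); case: (ltnP j 1) => //; case: (ltnP i 4);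
  case: (ltnP j 4); lia.
Qed.

Definition c2 := ladder_map g2P.
Definition c3 := ladder_map g3P.

(** This map serves chains without vertices in T; [ord_max] is a default on T that keeps it
    monotone. *)
Definition c1 m (s : N m) : mono m 3.
Proof.
apply: (@Mono m 3 (fun i => if chain_fun s i is inl x then x else ord_max)) => i j.
move/(chain_homo s); case: (chain_fun s i); case: (chain_fun s j) => //= a b _.
by rewrite -ltnS.
Defined.

Lemma c1_act m p (a : mono m p) (s : N p) : c1 (act a s) = mono_comp (c1 s) a.
Proof. exact: mono_eq. Qed.

(* With Z = false only the proper faces of T are attached, with Z = true all of
   T: in R the whole simplex v is available, in P only its horn. *)
Section Phase.
Variables (P R : sSet) (f : smap P R) (psi : smap N R).
Hypothesis f_inner : inner_fibration f.
Variables (Z : bool) (v : R t.+2) (u : forall m, Delta t.+2 m -> P m)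
  (a : P 1) (w : P 3).
Definition DZ m (s : Delta t.+2 m) : Prop := Z \/ in_horn (ord0 : 'I_t.+3) s.
Hypothesis uP : psec f (simplex_map v) DZ u.
Hypothesis ua : u (edge01 t.+1 : Delta _ _) = a.
Hypothesis w023 : forall m (s : mono m 3), (forall i, s i <> j1) ->
  act s w = act (mono_comp (mono_step 3 3) s) a.
Hypothesis w13 : forall m (s : mono m 3), (forall i, s i <> ord0) ->
  (forall i, s i <> j2) -> act s w = deg m (tgt a).
Hypothesis psi1 : forall m (s : N m), noT (supp s) -> psi m s = act (c1 s) (f 3 w).
Hypothesis psi2 : forall m (s : N m), no 1 (supp s) -> psi m s = act (c2 s) v.
Hypothesis psi3 : forall m (s : N m), no 0 (supp s) -> no 2 (supp s) ->
  psi m s = act (c3 s) v.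

Definition okT V := Z || notT V.

(** The chains on which the data prescribe the map: through [w], through [u] and [c2], through [u]
    and [c3]. The disjunct [no 3 V] is there because a chain avoiding rungs 1 and 3 is sent by [c2]
    to a face without vertex 1, which is in the horn at 0 even if all of T occurs. *)
Definition F0 V := [|| noT V, no 1 V && (okT V || no 3 V) |
  [&& no 0 V, no 2 V & okT V]].
Definition F1 V := F0 V || no 0 V && okT V.
Definition F2 V := okT V || no 1 V && no 3 V.

Definition phi0 m (s : N m) : P m :=
  if noT (supp s) then act (c1 s) w else
  if no 1 (supp s) then u (c2 s : Delta _ _) else u (c3 s : Delta _ _).

Lemma dc_okT : downclosed okT.
Proof. by rewrite /okT; apply: dc_or; [apply: dc_cst | apply: dc_notT]. Qed.

Lemma dc_F0 : downclosed F0.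
Proof.
rewrite /F0.
by repeat (exact: dc_no || exact: dc_noT || exact: dc_okT || exact: dc_notT ||
  apply: dc_or || apply: dc_and).
Qed.
Lemma dc_F1 : downclosed F1.
Proof.
rewrite /F1.
by repeat (exact: dc_F0 || exact: dc_no || exact: dc_noT || exact: dc_okT ||
  exact: dc_notT || apply: dc_or || apply: dc_and).
Qed.
Lemma dc_F2 : downclosed F2.
Proof.
rewrite /F2.
by repeat (exact: dc_no || exact: dc_noT || exact: dc_okT || exact: dc_notT ||
  apply: dc_or || apply: dc_and).
Qed.

Lemma supp_no k m (s : N m) i (x : 'I_4) :
  no k (supp s) -> chain_fun s i = inl x -> x <> k :> nat.
Proof.
move=> /noP H E /H /negP; apply; apply/suppP; by exists i.
Qed.

Lemma supp_noT m (s : N m) i x : noT (supp s) -> chain_fun s i <> inr x.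
Proof.
move=> /forallP/(_ x)/negP H E; apply: H; apply/suppP; by exists i.
Qed.

Lemma horn_c m (s : N m) (g : nat -> nat) (Hg : _ /\ t + g 4 <= t.+2) :
  g 4 = 2 -> (forall i, i < 4 -> g i < 2) -> okT (supp s) -> DZ (ladder_map Hg s : Delta _ _).
Proof.
move=> g4 gl; rewrite /okT /DZ => /orP[->|/existsP[j jV]]; [by left | right].
have lt : j + 2 < t.+3 by have := ltn_ord j; lia.
exists (Ordinal lt); split; first by move/(congr1 val) => /=; rewrite addnC.
move=> i /(congr1 val); rewrite /=.
case E: (chain_fun s i) => [x|x] /=; first by have := gl x (ltn_ord x); lia.
rewrite g4 => /addIn/val_inj E'; case/negP: jV; apply/suppP; exists i.
by rewrite E E'.
Qed.

Lemma DZ_c2 m (s : N m) : no 1 (supp s) -> okT (supp s) || no 3 (supp s) ->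
  DZ (c2 s : Delta _ _).
Proof.
move=> n1 /orP[ok|n3].
  by apply: horn_c => //; case=> [|[|[|[|i]]]].
right; exists (inord 1); split; first by move/(congr1 val); rewrite /= inordK.
move=> i /(congr1 val); rewrite /= inordK //.
case E: (chain_fun s i) => [x|x] /=; last by rewrite /g2 /=; lia.
have := supp_no n3 E; have := ltn_ord x; rewrite /g2; case: (ltnP x 3) => _; lia.
Qed.

Lemma DZ_edge : DZ (edge01 t.+1 : Delta _ _).
Proof.
right; exists ord_max; split; first by move/(congr1 val).
by move=> i /(congr1 val); rewrite /= inordK; have := ltn_ord i; lia.
Qed.

Lemma phi0_1 m (s : N m) : noT (supp s) -> phi0 s = act (c1 s) w.
Proof. by rewrite /phi0 => ->. Qed.

(** On chains without T the two prescriptions agree: away from vertex 1, [w] is degenerate on [a],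
    and [a] is the initial edge of [u]. *)
Lemma phi0_2 m (s : N m) : no 1 (supp s) -> okT (supp s) || no 3 (supp s) ->
  phi0 s = u (c2 s : Delta _ _).
Proof.
move=> n1 ok; rewrite /phi0 n1; case: ifP => // nT.
rewrite w023; last first.
  move=> i /= ; case E: (chain_fun s i) => [x|x //].
  by move/(congr1 val) => /=; apply: supp_no n1 E.
rewrite -ua -(proj1 uP) ?DZ_edge //; last exact: DZ_edge.
congr (u _); apply: mono_eq => i; apply: val_inj.
rewrite /= inordK; last by case: ifP.
case E: (chain_fun s i) => [x|x]; last by case: (supp_noT nT E).
by case: x {E} => [[|[|[|[|?]]]] ?].
Qed.

(** Overlaps again: on the edge from 1 to 3, [w] is degenerate at the target of [a]; and if 3 is the
    only possible rung, then [c2] and [c3] coincide. *)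
Lemma phi0_3 m (s : N m) : no 0 (supp s) -> no 2 (supp s) -> okT (supp s) ->
  phi0 s = u (c3 s : Delta _ _).
Proof.
move=> n0 n2 ok; rewrite /phi0; case: ifP => nT.
  rewrite w13; first last.
  - move=> i /=; case E: (chain_fun s i) => [x|x //].
    by move/(congr1 val) => /=; apply: supp_no n2 E.
  - move=> i /=; case E: (chain_fun s i) => [x|x //].
    by move/(congr1 val) => /=; apply: supp_no n0 E.
  rewrite /deg /tgt -ua /vertex act_comp -(proj1 uP); last exact: DZ_edge.
  congr (u _); apply: mono_eq => i; apply: val_inj.
  rewrite /= inordK //.
  case E: (chain_fun s i) => [x|x]; last by case: (supp_noT nT E).
  have := supp_no n0 E.
  by case: x {E} => [[|[|[|[|?]]]] ?].
case: ifP => // n1; congr (u _); apply: mono_eq => i; apply: val_inj.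
rewrite /=; case E: (chain_fun s i) => [x|x] //=.
have := supp_no n0 E; have := supp_no n1 E; have := supp_no n2 E.
by case: x {E} => [[|[|[|[|?]]]] ?].
Qed.

Lemma phi0P : psec f psi (nsub F0) phi0.
Proof.
split=> [m n b s|m s] /or3P[nT|/andP[n1 ok]|/and3P[n0 n2 ok]].
- rewrite !phi0_1 ?c1_act ?act_comp //; exact: dc_noT (supp_act _ _) nT.
- rewrite !phi0_2 //.
  + by rewrite -(proj1 uP) /c2 ?ladder_map_act //; apply: DZ_c2.
  + exact: dc_no (supp_act _ _) n1.
  + exact: (dc_or dc_okT (@dc_no 3)) (supp_act _ _) ok.
- rewrite !phi0_3 //.
  + rewrite -(proj1 uP) /c3 ?ladder_map_act //.
    by apply: horn_c => //; case=> [|[|[|[|i]]]].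
  + exact: dc_no (supp_act _ _) n0.
  + exact: dc_no (supp_act _ _) n2.
  + exact: dc_okT (supp_act _ _) ok.
- by rewrite phi0_1 // smap_nat psi1.
- by rewrite phi0_2 // (proj2 uP) ?psi2 //; apply: DZ_c2.
- rewrite phi0_3 // (proj2 uP) ?psi3 //.
  by apply: horn_c => //; case=> [|[|[|[|i]]]].
Qed.

(** The chains added first contain rungs 1 and 2 and are paired by toggling rung 3; those added next
    contain rungs 0 and 1 and are paired by toggling rung 2. All of them contain a vertex of T, so
    the horns are inner. *)
Lemma phase : exists phi, (forall m (s : N m), nsub F0 s -> phi m s = phi0 s) /\
  psec f psi (nsub F2) phi.
Proof.
have [|||phi1 [E1 H1]] := @ladder_step P R f psi f_inner F0 F1 phi0 ord_max 1 dc_F0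
  dc_F1 _ _ _ phi0P => //.
- by move=> V; rewrite /F1 => ->.
- move=> V; rewrite /F1; case F0V : (F0 V) => //= /andP[n0 ok] _.
  move: F0V; rewrite /F0 /okT !toggleE -/(okT V) n0 ok /= andbT.
  by do 3!case: (_ V) => //=.
have [|||phi2 [E2 H2]] := @ladder_step P R f psi f_inner F1 F2 phi1 j2 1 dc_F1 dc_F2 _ _ _ H1 => //.
- move=> V; rewrite /F1 /F0 /F2 => /orP[/or3P[/noT_notT|/andP[->
  /orP[->|->]]|/and3P[_ _ ->]]|/andP[_ ->]] //; last by rewrite orbT.
  by rewrite /okT => ->; rewrite orbT.
- move=> V; rewrite /F2 => F2V nF1; move: F2V.
  rewrite /F1 /F0 /okT !toggleE -/(okT V).
  move: nF1; rewrite /F1 /F0.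
  do 6!case: (_ V) => //=.
exists phi2; split=> // m s Fs; rewrite E2 ?E1 //; by rewrite /nsub /F1 (Fs : F0 _).
Qed.

End Phase.
End Ladder.

(** * Filling the special outer horn *)

Section Final.
Variable t : nat.
Notation Pi := ('I_4 + 'I_t.+1)%type.
Notation N := (nerve (@ladder_le t)).

(** Identifies rungs 1, 2, 3. For chains avoiding rungs 0 and 2, where rungs 1 and 3 both lie over
    y, it copies the value on rung 1. *)
Definition collapse_fun (x : Pi) : Pi :=
  if x is inl i then inl (if i == 0 :> nat then i else j1) else x.

Lemma collapse_homo x y : ladder_le x y -> ladder_le (collapse_fun x) (collapse_fun y).
Proof.
by case: x => [[[|i] Hi]|i]; case: y => [[[|j] Hj]|j].
Qed.

Definition collapse m (s : N m) : N m :=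
  @Chain _ _ m (fun i => collapse_fun (chain_fun s i))
    (fun i j ij => collapse_homo (chain_homo s ij)).

Lemma collapse_act m n (a : mono m n) (s : N n) :
  collapse (act a s) = act a (collapse s).
Proof. exact: chain_eq. Qed.

Lemma collapse_id m (s : N m) : no 2 (supp s) -> no 3 (supp s) -> collapse s = s.
Proof.
move=> n2 n3; apply: chain_eq => i /=; case E: (chain_fun s i) => [x|x] //=.
have := supp_no n2 E; have := supp_no n3 E.
case: x {E} => [[|[|[|[|?]]]] Hx] //= _ _; congr inl; exact: val_inj.
Qed.

Lemma collapse_no m (s : N m) k : 1 < k -> no k (supp (collapse s)).
Proof.
move=> k1; apply/noP => i E; apply/negP => /suppP[j] /=.
case: (chain_fun s j) => //= x [E']; move: k1; rewrite -E -E'.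
by case: ifP => [/eqP->|].
Qed.

Lemma collapse_notT m (s : N m) : notT (supp s) -> notT (supp (collapse s)).
Proof.
case/existsP=> j /negP jV; apply/existsP; exists j; apply/negP => /suppP[i] /=.
case E: (chain_fun s i) => [x|x] //= [E']; apply: jV; apply/suppP; exists i.
by rewrite E E'.
Qed.

Lemma collapse_no0 m (s : N m) : no 0 (supp s) -> no 0 (supp (collapse s)).
Proof.
move=> n0; apply/noP => i E; apply/negP => /suppP[j] /=.
case E': (chain_fun s j) => [x|x] //= [Ei].
have /eqP/negPf x0 := supp_no n0 E'; move: Ei; rewrite x0 => Ei.
by rewrite -Ei in E.
Qed.

Lemma c3_collapse m (s : N m) : c3 (collapse s) = c3 s.
Proof.
apply: mono_eq => i; apply: val_inj => /=; case E: (chain_fun s i) => [x|x] //=.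
by case: x {E} => [[|[|[|[|?]]]] Hx].
Qed.

Definition top_fun (i : 'I_t.+3) : Pi :=
  if i == 0 :> nat then inl ord0 else if i == 1 :> nat then inl ord_max
  else inr (inord (i - 2)).

Lemma top_homo (i j : 'I_t.+3) : i <= j -> ladder_le (top_fun i) (top_fun j).
Proof.
rewrite /top_fun; case: i => [[|[|i]] Hi]; case: j => [[|[|j]] Hj] //= ij.
by rewrite !inordK; lia.
Qed.

Definition top_simplex : N t.+2 := @Chain _ _ t.+2 top_fun top_homo.

Lemma c2_top : c2 top_simplex = mono_id _.
Proof.
apply: mono_eq => i; apply: val_inj => /=; rewrite /top_fun.
case: i => [[|[|i]] Hi] //=.
by rewrite -[g2 4]/2 inordK; lia.
Qed.

Lemma c2_act m n (a : mono m n) (s : N n) : c2 (act a s) = mono_comp (c2 s) a.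
Proof. exact: ladder_map_act. Qed.

Lemma top_no k : k != 0 -> k != 3 -> no k (supp top_simplex).
Proof.
move=> k0 k3; apply/noP => i E; apply/negP => /suppP[j] /=; rewrite /top_fun.
case: eqP => _; first by move=> [Ei]; rewrite -E -Ei in k0.
by case: eqP => _ // [Ei]; rewrite -E -Ei in k3.
Qed.

(* Joyal's extension theorem for outer horns with invertible initial edge. *)
Lemma special_horn (P R : sSet) (f : smap P R) (u : smap (horn (ord0 : 'I_t.+3)) P)
    (v : R t.+2) (a : P 1) :
  quasi_category P -> quasi_category R -> inner_fibration f ->
  ho_invertible (src a) (tgt a) [:: a] ->
  (forall H, u 1 (exist _ (edge01 t.+1 : Delta _ _) H) = a) ->
  (forall m (s : horn ord0 m), f m (u m s) = act (sval s : mono _ _) v) ->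
  exists w : P t.+2, (forall m (s : horn ord0 m), act (sval s : mono _ _) w = u m s) /\
    f _ w = v.
Proof.
move=> qP qR fi inv_a u01 fu; have [w [w1 w2]] := invertible_simplex3 qP inv_a.
(* Outside the horn the value is a default. *)
pose uu m (s : Delta t.+2 m) : P m :=
  if pselect (in_horn ord0 s) is left H then u m (exist _ s H) else deg m (src a).
have uuE m s (H : in_horn ord0 s) : uu m s = u m (exist _ s H).
  by rewrite /uu; case: pselect => // H'; rewrite (Prop_irrelevance H H').
have ue : uu 1 (edge01 t.+1 : Delta _ _) = a.
  rewrite (uuE _ _ _) ?u01 //; by case: (@DZ_edge t false).
have vv1 : act (edge01 t.+1) v = f 1 a.
  have H : in_horn ord0 (edge01 t.+1 : Delta t.+2 1) by case: (@DZ_edge t false).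
  by rewrite -(u01 H) fu.
have pt (z z' : unit) : z = z' by case: z; case: z'.
pose pN : smap N point := to_point N.
(* In [R] the whole simplex [v] is available. With [Z] true the phase reaches every chain and yields
   the map [psi] on the nerve over which the lift is then built. *)
have [|||||||psi0 [E0 H0]] := @phase t R point (to_point R) pN (point_inner qR) true tt
  (fun m s => act (s : mono _ _) v) (f 1 a) (f 3 w) => //.
- by split=> [m n b s _|*]; [rewrite act_comp | apply: pt].
- by move=> m s Hs; rewrite -!smap_nat w1.
- by move=> m s Hs Hs'; rewrite -smap_nat w2 // /deg /tgt /vertex -!smap_nat.
pose psi : smap N R := @SMap N R psi0 (fun m n b s => proj1 H0 m n b s isT).
have psi1 m (s : N m) : noT (supp s) -> psi m s = act (c1 s) (f 3 w).
  by move=> nT; rewrite /= E0 /phi0 ?nT // /nsub /F0 nT.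
have psi2 m (s : N m) : no 1 (supp s) -> psi m s = act (c2 s) v.
  move=> n1; rewrite /= E0; last by rewrite /nsub /F0 n1 /= orbT.
  rewrite (@phi0_2 t R point (to_point R) true tt _ (f 1 a)) //.
  - by split=> [m' n b s' _|*]; [rewrite act_comp | apply: pt].
  - by move=> m' s' Hs; rewrite -!smap_nat w1.
have psi3 m (s : N m) : no 0 (supp s) -> no 2 (supp s) -> psi m s = act (c3 s) v.
  move=> n0 n2; rewrite /= E0; last by rewrite /nsub /F0 n0 n2 /= !orbT.
  rewrite (@phi0_3 t R point (to_point R) true tt _ (f 1 a)) //.
  - by split=> [m' n b s' _|*]; [rewrite act_comp | apply: pt].
  - by move=> m' s' Hs Hs'; rewrite -smap_nat w2 // /deg /tgt /vertex -!smap_nat.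
have uuP : psec f (simplex_map v) (@DZ t false) uu.
  split=> [m n b s [//|H]|m s [//|H]]; last by rewrite uuE fu.
  have H' := in_horn_act b H.
  rewrite (uuE _ _ H) (uuE _ _ H') -smap_nat; congr (u _ _); exact: sig_ext.
have [phi2 [E2 H2]] := phase fi uuP ue w1 w2 psi1 psi2 psi3.
(* The new chains avoid rung 3 and contain rung 1 and all of T; they are paired by toggling rung
   2. *)
pose F4 (V : {set Pi}) := F2 false V || no 3 V.
have dF4 : downclosed F4 by rewrite /F4; apply: dc_or; [exact: dc_F2 | exact: dc_no].
have [|||phi4 [E4 H4]] := @ladder_step t P R f psi fi (F2 false) F4 phi2 j2 1 (@dc_F2 t
  false) dF4 _ _ _ H2 => //.
- by move=> V; rewrite /F4 => ->.
- move=> V; rewrite /F4 /F2 /okT !toggleE /=.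
  case nT : (notT V) => //=; case n3 : (no 3 V); rewrite ?andbF ?orbF ?andbT //= orbT => _ n1.
  by rewrite n1; split=> //; apply: NnotT; rewrite nT.
have phi42 m (s : N m) : F0 false (supp s) -> phi4 m s = phi0 uu w s.
  move=> F0s; rewrite E4 ?E2 // /nsub /F2.
  case/or3P: F0s => [/noT_notT nT|/andP[-> /orP[->|->]]|/and3P[_ _ ->]] //=; last by rewrite orbT.
  by rewrite /okT nT.
pose F5 (V : {set Pi}) := F4 V || no 0 V && no 2 V.
have dF5 : downclosed F5.
  rewrite /F5; apply: dc_or => //; apply: dc_and; exact: dc_no.
pose phi5 m (s : N m) := if F4 (supp s) then phi4 m s else phi4 m (collapse s).
have phi5E m (s : N m) : no 0 (supp s) -> no 2 (supp s) -> phi5 m s = phi4 m (collapse s).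
  move=> n0 n2; rewrite /phi5; case: ifP => // /orP[/orP[/=nT|/andP[n1 n3]]|n3]; last 2 first.
  - by rewrite collapse_id.
  - by rewrite collapse_id.
  rewrite !phi42; last 2 first.
  - by rewrite /F0 /okT (collapse_no0 n0) (@collapse_no _ s 2) // collapse_notT // !orbT.
  - by rewrite /F0 /okT n0 n2 nT !orbT.
  rewrite !(phi0_3 uuP ue w2) //.
  - by rewrite c3_collapse.
  - exact: collapse_no0.
  - exact: collapse_no.
  - exact: collapse_notT.
have H5 : psec f psi (nsub F5) phi5.
  split=> [m n b s|m s] /orP[Fs|/andP[n0 n2]].
  - rewrite /phi5 Fs (dF4 _ _ (supp_act b s) Fs); exact: (proj1 H4).
  - rewrite !phi5E ?collapse_act //.
    + apply: (proj1 H4); by rewrite /nsub /F4 collapse_no // orbT.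
    + exact: dc_no (supp_act _ _) n0.
    + exact: dc_no (supp_act _ _) n2.
  - rewrite /phi5 Fs; exact: (proj2 H4).
  - rewrite phi5E // (proj2 H4); last by rewrite /nsub /F4 collapse_no // orbT.
    by rewrite !psi3 ?c3_collapse ?collapse_no0 ?collapse_no.
(* One pair remains: the chain on rungs 0, 3 and T, and the same chain with rung 1 added. The horn
   at rung 1 is inner, and its missing face is the filler sought. *)
pose F6 (V : {set Pi}) := F5 V || no 2 V.
have dF6 : downclosed F6 by rewrite /F6; apply: dc_or => //; exact: dc_no.
have [|||phi6 [E6 H6]] := @ladder_step t P R f psi fi F5 F6 phi5 j1 0 dF5 dF6 _ _ _ H5 => //.
- by move=> V; rewrite /F6 => ->.
- move=> V; rewrite /F6 /F5 /F4 /F2 /okT !toggleE /=.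
  case nT : (notT V) => //=; case n3 : (no 3 V); rewrite ?andbF ?orbF ?orbT //=.
  case n2 : (no 2 V); rewrite ?andbF ?andbT ?orbF ?orbT //= => _ n0.
  by rewrite (negPf n0); split=> //; apply: NnotT; rewrite nT.
exists (phi6 _ top_simplex); split; last first.
  have := proj2 H6 _ top_simplex; rewrite psi2 ?c2_top ?act_id; last exact: top_no.
  by apply; rewrite /nsub /F6 top_no ?orbT.
move=> m [s Hs] /=; rewrite -(proj1 H6); last by rewrite /nsub /F6 top_no ?orbT.
have n1 : no 1 (supp (act s top_simplex)) by apply: (dc_no (supp_act _ _)); apply: top_no.
(* A simplex of the horn misses vertex 1, that is rung 3, or a vertex of T; so its value was
   prescribed from the start. *)
have ok : okT false (supp (act s top_simplex)) || no 3 (supp (act s top_simplex)).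
  case: (Hs) => j [j0 Hj]; case: (eqVneq (nat_of_ord j) 1) => j1.
    apply/orP; right; apply/noP => i Ei; apply/negP => /suppP[l] /=; rewrite /top_fun.
    case: eqP => _; first by move=> [El]; move: Ei; rewrite -El.
    case: eqP => [El _|//]; apply: (Hj l); apply: val_inj; exact: etrans El (esym j1).
  apply/orP; left; apply/existsP; exists (inord (j - 2)); apply/negP => /suppP[l] /=.
  rewrite /top_fun; case: eqP => // l0; case: eqP => // l1 [/(congr1 val)] /=.
  have j0' : (j : nat) <> 0 by move=> E; apply: j0; apply: val_inj.
  have lj := ltn_ord j; have ls := ltn_ord (s l); rewrite !inordK; [|lia|lia].
  by move=> E; apply: (Hj l); apply: val_inj => /=; lia.
have F0s : F0 false (supp (act s top_simplex)) by rewrite /F0 n1 ok /= orbT.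
rewrite E6; last first.
  rewrite /nsub /F5 /F4 /F2 n1; case/orP: ok => -> //; by rewrite !orbT.
rewrite /phi5 (_ : F4 _) ?phi42 //; last first.
  rewrite /F4 /F2 n1; case/orP: ok => -> //; by rewrite !orbT.
rewrite (phi0_2 uuP ue w1) // c2_act c2_top.
rewrite (_ : mono_comp _ _ = s); last exact: mono_eq.
exact: uuE.
Qed.

End Final.

(** * Extending an invertible edge to the free-living isomorphism *)

Definition parity m n (s : mono m n) : Iso m := fun i => odd (s i).

(** Deleting vertex [j > 0] from an alternating sequence makes its neighbours equal, so entries
    above [j] may be lowered by 2 without changing parities. Deleting vertex 0 would change the
    first letter; hence it is the horn at 0 that lower dimensions determine. *)
Lemma parity_lower m n (s : mono m n.+1) (j : 'I_n.+2) :
  j <> ord0 -> (forall i, s i <> j) ->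
  exists t : mono m n, parity t = parity s.
Proof.
move=> j0 Hj; have j0' : (j : nat) <> 0 by move=> E; apply: j0; apply: val_inj.
have Hj' i : (s i : nat) <> j by move=> E; apply: (Hj i); apply: val_inj.
have lj := ltn_ord j.
have lt i : (if s i < j then (s i : nat) else s i - 2) < n.+1.
  by have := ltn_ord (s i); case: (ltnP (s i) j); lia.
have ho (i i' : 'I_m.+1) : i <= i' -> Ordinal (lt i) <= Ordinal (lt i').
  move=> /(mono_homo s) /=; have := Hj' i; have := Hj' i'.
  case: (ltnP (s i) j); case: (ltnP (s i') j); lia.
exists (Mono ho); apply/funext => i; rewrite /parity /=.
case: (ltnP (s i) j) => // h; rewrite oddB /= ?addbF //.
by have := Hj' i; lia.
Qed.

(** Off the horn, [s] hits all of 1, ..., [n.+1]. Each change of parity raises [s'] by at least one,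
    which bounds [s'] below by [s]; counting down from the top bounds it above. *)
Lemma parity_inj m n (s s' : mono m n.+1) :
  ~ in_horn ord0 (s : Delta n.+1 m) -> parity s = parity s' -> s = s'.
Proof.
move=> Hs E.
have odds i : odd (s i) = odd (s' i) by exact: (congr1 (fun z : Iso m => z i) E).
have hit (k : nat) : 0 < k < n.+2 -> exists i, s i = k :> nat.
  move=> /andP[k0 k1]; apply: contrapT => H; apply: Hs.
  exists (Ordinal k1); split; first by move/(congr1 val) => /= kk; rewrite kk in k0.
  by move=> i Ei; apply: H; exists i; rewrite Ei.
have mon (z : mono m n.+1) (i j : 'I_m.+1) : z i < z j -> i < j.
  by move=> zij; rewrite ltnNge; apply/negP => /(mono_homo z); lia.
have ge k : forall i, s i = k :> nat -> k <= s' i.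
  elim: k => [//|k IH] i Ei; have := odds i; rewrite Ei.
  case: (posnP k) => [->|k0]; first by case: (nat_of_ord (s' i)).
  have [|i' Ei'] := hit k; first by have := ltn_ord (s i); lia.
  have ii' : i' < i by apply: (mon s); lia.
  have := IH i' Ei'; have := mono_homo s' (ltnW ii'); lia.
have le k : forall i, (s i + k)%N = n.+1 -> s' i + k <= n.+1.
  elim: k => [|k IH] i Ei; first by have := ltn_ord (s' i); lia.
  have [|i' Ei'] := hit (s i).+1; first by lia.
  have ii' : i < i' by apply: (mon s); lia.
  have := IH i'; have := mono_homo s' (ltnW ii'); have := odds i; lia.
apply: mono_eq => i; apply: val_inj => /=.
have := ge _ i erefl; have := ltn_ord (s i) => ls.
have := le (n.+1 - s i) i; lia.
Qed.

Section Extend.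
Variables (X : sSet) (a : X 1).
Hypotheses (qX : quasi_category X) (inv_a : ho_invertible (src a) (tgt a) [:: a]).

(** The second clause says that [x], as a map from a simplex, factors through its image under
    [parity] in [Iso]. *)
Definition alternating n (x : X n.+1) : Prop :=
  act (edge01 n) x = a /\
  forall m (s s' : mono m n.+1), parity s = parity s' -> act s x = act s' x.

Lemma edge01_id : edge01 0 = mono_id 1.
Proof. by apply: mono_eq => i; apply: val_inj; rewrite /= inordK. Qed.

Lemma alternating0 : alternating (a : X 1).
Proof.
split=> [|m s s' E]; first by rewrite edge01_id act_id.
congr act; apply: mono_eq => i; have := congr1 (fun z : Iso m => z i) E.
by rewrite /parity; case: (s i) => [[|[|?]] ?]; case: (s' i) => [[|[|?]] ?] //= _;
  apply: val_inj.
Qed.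

Lemma parity_act m n p (b : mono m n) (s : mono n p) :
  parity (mono_comp s b) = act b (parity s : Iso n).
Proof. by []. Qed.

(** The horn at 0 of the next alternating simplex is read off from [x] by [parity_lower]; it can be
    filled because its initial edge is [a]. *)
Lemma alternating_step n (x : X n.+1) : alternating x ->
  exists y : X n.+2, alternating y /\
    forall m (s : mono m n.+2) (t : mono m n.+1), parity s = parity t ->
      act s y = act t x.
Proof.
case=> x01 Hx.
have low m (s : horn (ord0 : 'I_n.+3) m) :
    exists t : mono m n.+1, parity t = parity (sval s : mono m n.+2).
  by case: s => s [j [j0 Hj]]; apply: parity_lower j0 Hj.
pose l m s := sval (cid (@low m s)).
have lP m s : parity (l m s) = parity (sval s : mono m n.+2) by rewrite /l; case: cid.
have nat m p (b : mono m p) (s : horn ord0 p) : act (l _ (act b s)) x = act b (act (l _ s) x).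
  rewrite act_comp; apply: Hx; rewrite lP parity_act lP.
  by [].
pose u := @SMap (horn (ord0 : 'I_n.+3)) X (fun m s => act (l m s) x) nat.
have [|//|y [Hy _]] := @special_horn n X point (to_point X) u tt a qX point_qcat
  (point_inner qX) inv_a.
- move=> H; rewrite /= -[RHS]x01; apply: Hx; rewrite lP; apply/funext => i.
  by rewrite /parity /= !inordK //; have := ltn_ord i; lia.
have yx m (s : mono m n.+2) (t : mono m n.+1) : parity s = parity t -> act s y = act t x.
  move=> E; have H : in_horn ord0 (s : Delta n.+2 m).
    apply: contrapT => Hs.
    have ht (i j : 'I_m.+1) : i <= j -> widen_ord (leqnSn _) (t i) <= widen_ord (leqnSn _) (t j).
      exact: mono_homo.
    have Es : s = @Mono m n.+2 _ ht by apply: parity_inj => //; rewrite E.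
    apply: Hs; rewrite Es; exists ord_max; split=> // i /(congr1 val) /=.
    by have := ltn_ord (t i); lia.
  by have /= -> := Hy _ (exist _ _ H); apply: Hx; rewrite lP.
exists y; split=> //; split.
  rewrite -[RHS]x01; apply: yx; apply/funext => i; rewrite /parity /= !inordK //.
  - by have := ltn_ord i; lia.
  - by have := ltn_ord i; lia.
move=> m s s' E; case: (pselect (in_horn ord0 (s : Delta n.+2 m))) => Hs.
  have [t Et] := low _ (exist _ _ Hs).
  by rewrite (yx _ s t) ?(yx _ s' t) // Et.
by rewrite (parity_inj Hs E).
Qed.

Fixpoint alternating_seq (n : nat) : {x : X n.+1 | alternating x} :=
  match n with
  | 0 => exist _ (a : X 1) alternating0
  | n.+1 => let y := cid (alternating_step (svalP (alternating_seq n))) in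
            exist _ (sval y) (proj1 (svalP y))
  end.

Lemma alternating_seqS n m (s : mono m n.+2) (t : mono m n.+1) :
  parity s = parity t ->
  act s (sval (alternating_seq n.+1)) = act t (sval (alternating_seq n)).
Proof. by move=> E; rewrite /=; case: cid => y [? H] /=; apply: H. Qed.

Lemma alternating_seq_le n p m (s : mono m p.+1) (t : mono m n.+1) :
  parity s = parity t ->
  act s (sval (alternating_seq p)) = act t (sval (alternating_seq n)).
Proof.
wlog np : n p s t / n <= p => [H|] E.
  by case: (leqP n p) => [/H|/ltnW/H H']; [apply | symmetry; apply: H'].
elim: p np s E => [|p IH]; first by rewrite leqn0 => /eqP np; subst n => s;
  apply: (proj2 alternating0).
rewrite leq_eqVlt => /orP[/eqP np|np] s E.
  by subst n; apply: (proj2 (svalP (alternating_seq p.+1))).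
have ht (i j : 'I_m.+1) : i <= j -> widen_ord (np : n.+2 <= p.+2) (t i) <= widen_ord
  (np : n.+2 <= p.+2) (t j).
  exact: mono_homo.
by rewrite -(IH np (@Mono m p.+1 _ ht) erefl); apply: alternating_seqS.
Qed.

Lemma invertible_iso : exists w : smap Iso X,
  w 1 (fun i => i == ord_max :> 'I_2) = a.
Proof.
(* The entries are [s i + i.*2]: the even summand makes the sequence increasing and leaves parities
   alone, and [m.*2.+1] is the largest possible value. *)
have lift m (s : Iso m) : exists t : mono m m.*2.+1, parity t = s.
  have lt (i : 'I_m.+1) : s i + i.*2 < m.*2.+2 by have := ltn_ord i; case: (s i); lia.
  have ht (i j : 'I_m.+1) : i <= j -> Ordinal (lt i) <= Ordinal (lt j).
    rewrite leq_eqVlt => /orP[/eqP/val_inj->//|/= ij].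
    by case: (s i); case: (s j); lia.
  exists (Mono ht); apply/funext => i; rewrite /parity /= oddD odd_double addbF.
  by case: (s i).
pose l m s := sval (cid (@lift m s)).
have lP m s : parity (l m s) = s by rewrite /l; case: cid.
have nat m n (b : mono m n) (s : Iso n) :
    act (l _ (act b s)) (sval (alternating_seq m.*2)) =
    act b (act (l _ s) (sval (alternating_seq n.*2))).
  by rewrite act_comp; apply: alternating_seq_le; rewrite lP parity_act lP.
exists (@SMap Iso X (fun m s => act (l _ s) (sval (alternating_seq m.*2))) nat).
rewrite /= -[RHS](act_id (s := X)).
rewrite -[a]/(sval (alternating_seq 0)); apply: alternating_seq_le; rewrite lP.
by apply/funext; elim/ord2P.
Qed.

End Extend.

Definition iso_edge : Iso 1 := fun i => i == ord_max :> 'I_2.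

Lemma iso_edge_invertible (X : sSet) (w : smap Iso X) :
  ho_invertible (src (w 1 iso_edge)) (tgt (w 1 iso_edge)) [:: w 1 iso_edge].
Proof.
pose e' : Iso 1 := fun i => i == ord0.
have T1 : tri iso_edge e' (deg 1 (src iso_edge)).
  by exists ((fun i => i == i1) : Iso 2); split; apply/funext; elim/ord2P.
have T2 : tri e' iso_edge (deg 1 (src e')).
  by exists ((fun i => i != i1) : Iso 2); split; apply/funext; elim/ord2P.
have srcw e : w 0 (src e) = src (w 1 e) by apply: smap_nat.
have tgtw e : w 0 (tgt e) = tgt (w 1 e) by apply: smap_nat.
have E1 : tgt (w 1 iso_edge) = src (w 1 e') by rewrite -srcw -tgtw; congr (w 0 _); apply/funext.
have E2 : src (w 1 iso_edge) = tgt (w 1 e') by rewrite -srcw -tgtw; congr (w 0 _); apply/funext.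
have := tri_map w T1; have := tri_map w T2; 
have degw x : w 1 (deg 1 x) = deg 1 (w 0 x) by apply: smap_nat.
rewrite !degw !srcw.
move=> /tri_hoeq_nil H2 /tri_hoeq_nil H1; split; first by [].
by exists [:: w 1 e']; rewrite E1 E2 in H2 H1 *; split.
Qed.

Lemma face_edge (X : sSet) (e : X 1) : face ord0 e = tgt e /\ face ord_max e = src e.
Proof. by split; apply: vertexE; apply: val_inj. Qed.

Lemma horn2_lift (P R : sSet) (f : smap P R) (k : 'I_3) (x : 'I_3 -> P 1) (s : R 2) :
  (forall i j : 'I_3, i != k -> j != k -> i < j ->
     face (inord i) (x j) = face (inord j.-1) (x i)) ->
  (forall j, j != k -> f 1 (x j) = face j s) ->
  (forall u : smap (horn k) P,
     (forall (H : in_horn k (edge01 1 : Delta 2 1)), k != ord_max ->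
        u 1 (exist _ (edge01 1 : Delta 2 1) H) = x ord_max) ->
     (forall m (a : horn k m), f m (u m a) = act (sval a : mono m 2) s) ->
     exists w : P 2, (forall m (a : horn k m), act (sval a : mono m 2) w = u m a) /\
       f 2 w = s) ->
  exists w : P 2, (forall j, j != k -> face j w = x j) /\ f 2 w = s.
Proof.
move=> xC xs fill; have [u Hu] := horn_faces xC.
have [||w [w1 w2]] := fill u.
- move=> H km; have E : (edge01 1 : mono 1 2) = mono_comp (mono_face ord_max) (mono_id 1).
    by apply: mono_eq => i; apply: val_inj => /=; rewrite inordK; case: i => [[|[|?]] ?].
  by move: H; rewrite E => H; rewrite Hu 1?eq_sym // act_id.
- move=> m [y Hy] /=; have [j [/eqP jk Hj]] := Hy; have [t Et] := mono_factor Hj.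
  by subst y; rewrite Hu // smap_nat xs // /face act_comp.
exists w; split=> // j jk.
have H : in_horn k (mono_comp (mono_face j) (mono_id 1) : Delta 2 1).
  by exists j; split; [apply/eqP | move=> i /=; apply/eqP; rewrite eq_sym neq_lift].
have := w1 _ (exist _ _ H); rewrite Hu // act_id => <-.
by rewrite /face; congr act; apply: mono_eq.
Qed.

(** [s] exhibits a left inverse of [f 1 a]. Lifting it means filling the horn at 0 formed by [a] and
    an identity, which is special because [a] is invertible. *)
Lemma left_inverse_lift (P R : sSet) (f : smap P R) (a : P 1) (s : R 2) :
  quasi_category P -> quasi_category R -> inner_fibration f ->
  ho_invertible (src a) (tgt a) [:: a] ->
  face ord_max s = f 1 a -> face i1 s = deg 1 (src (f 1 a)) ->
  exists w : P 2, [/\ face ord_max w = a, face i1 w = deg 1 (src a) & f 2 w = s].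
Proof.
move=> qP qR fi inv_a s2 s1.
pose x (i : 'I_3) := if i == 1 :> nat then deg 1 (src a) else a.
have [|||w [w1 w2]] := @horn2_lift P R f ord0 x s.
- move=> [[|[|[|i]]] Hi] [[|[|[|j]]] Hj] // _ _ _; rewrite /x /=.
  rewrite (inordE (i := ord_max)) ?(inordE (i := ord_max)) //.
  by rewrite !(proj2 (face_edge _)) src_deg.
- move=> [[|[|[|j]]] Hj] // _; rewrite /x /=.
    rewrite (_ : Ordinal _ = i1) ?s1; last exact: val_inj.
    by rewrite /src /vertex /deg !smap_nat.
  by rewrite (_ : Ordinal _ = ord_max) ?s2 //; exact: val_inj.
- move=> u u01 fu; apply: (@special_horn 0 P R f u s a qP qR fi inv_a) => // H.
  exact: u01.
by exists w; split=> //; apply: w1.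
Qed.

(** * Filling prisms over the outer horn of the triangle *)

Section Prism.
Variable n : nat.
Notation Pi := ('I_3 * 'I_n.+1)%type.

Definition prism_le (x y : Pi) : bool := (x.1 <= y.1) && (x.2 <= y.2).

Lemma prism_refl : reflexive prism_le.
Proof. by move=> x; rewrite /prism_le !leqnn. Qed.

Lemma prism_trans : transitive prism_le.
Proof.
move=> y x z /andP[a b] /andP[c d]; rewrite /prism_le.
by rewrite (leq_trans a c) (leq_trans b d).
Qed.

Lemma prism_anti : antisymmetric prism_le.
Proof.
move=> [a b] [c d] /andP[/andP[/= h1 h2] /andP[/= h3 h4]].
by congr pair; apply: val_inj; apply/eqP; rewrite eqn_leq ?h1 ?h2.
Qed.

Notation N := (nerve prism_le).

Definition level m (s : N m) : mono m 2.
Proof.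
by apply: (@Mono m 2 (fun i => (chain_fun s i).1)) => i j /(chain_homo s)/andP[].
Defined.

Definition column m (s : N m) : mono m n.
Proof.
by apply: (@Mono m n (fun i => (chain_fun s i).2)) => i j /(chain_homo s)/andP[].
Defined.

Definition zigzag m (b : mono m n) (a : mono m 2) : N m.
Proof.
apply: (@Chain Pi prism_le m (fun i => (a i, b i))) => i j ij.
by rewrite /prism_le /= !mono_homo.
Defined.

Definition chainb (V : {set Pi}) : bool :=
  [forall x in V, forall y in V, prism_le x y || prism_le y x].

Lemma chainbP V : reflect (linear prism_le V) (chainb V).
Proof.
apply: (iffP forall_inP) => [H x y xV yV|H x xV].
  exact: (forall_inP (H x xV)).
by apply/forall_inP => y; apply: H.
Qed.

Lemma supp_chainb m (s : N m) : chainb (supp s).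
Proof.
apply/chainbP => x y /suppP[i <-] /suppP[j <-].
by case/orP: (leq_total i j) => /(chain_homo s) ->; rewrite ?orbT.
Qed.

Definition covers (V : {set Pi}) : bool := [forall j, exists i, (i, j) \in V].
Definition meets (i : 'I_3) (V : {set Pi}) : bool := [exists j, (i, j) \in V].
Definition before (c : nat) (V : {set Pi}) : bool :=
  [forall j : 'I_n.+1, (j < c) ==> ((i1, j) \notin V)].

(* Filtration of Delta 2 x Delta n: the stages are attached for c = n, ..., 0,
   the c-th one consisting of the missing chains that reach level 1 in column c.
   These are paired by toggling (0, c), which is inner except for c = 0. *)
Definition Fpr (c : nat) (V : {set Pi}) : bool :=
  chainb V && [|| ~~ covers V, ~~ meets i1 V, ~~ meets ord_max V | before c V].

Lemma coversS (V W : {set Pi}) : W \subset V -> covers W -> covers V.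
Proof.
move=> /subsetP WV /forallP H; apply/forallP => j; have /existsP[i Hi] := H j.
by apply/existsP; exists i; apply: WV.
Qed.

Lemma meetsS i (V W : {set Pi}) : W \subset V -> meets i W -> meets i V.
Proof. by move=> /subsetP WV /existsP[j H]; apply/existsP; exists j; apply: WV. Qed.

Lemma beforeP c (V : {set Pi}) :
  reflect (forall j : 'I_n.+1, j < c -> (i1, j) \notin V) (before c V).
Proof. by apply: (iffP forallP) => H j; have := H j; [move/implyP | move=> h; apply/implyP]. Qed.

Lemma dc_Fpr c : downclosed (Fpr c).
Proof.
move=> V W WV /andP[/chainbP ch H]; apply/andP; split.
  by apply/chainbP => x y /(subsetP WV) xV /(subsetP WV); apply: ch.
case/or4P: H => [h|h|h|/beforeP h].
- by rewrite (contra (coversS WV) h).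
- by rewrite (contra (@meetsS _ _ _ WV) h) !orbT.
- by rewrite (contra (@meetsS _ _ _ WV) h) !orbT.
- apply/or4P; constructor 4; apply/beforeP => j jc; apply: contra (h j jc).
  exact: (subsetP WV).
Qed.

Definition missing c V := [&& covers V, meets i1 V, meets ord_max V & before c V].

Section Toggle.
Variables (c : 'I_n.+1) (V : {set Pi}).
Hypotheses (chV : chainb V) (bV : before c V) (cV : (i1, c) \in V).

(** Comparability with [(i1, c)] bounds earlier columns by level 1, and [before] excludes level 1
    there. *)
Lemma below_level (x : Pi) : x \in V -> x.2 < c -> x.1 = ord0.
Proof.
move=> xV xc; have := elimT (chainbP V) chV x (i1, c) xV cV.
rewrite /prism_le /= [c <= _]leqNgt xc andbF orbF => /andP[x1 _].
case: x xV xc x1 => [[[|[|i]] Hi] j] //= xV xc _; first exact: val_inj.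
have := elimT (beforeP _ _) bV j xc.
by rewrite (_ : (i1, j) = (Ordinal Hi, j)) ?xV //; congr pair; apply: val_inj.
Qed.

Lemma toggle_chain : chainb ((ord0, c) |: V).
Proof.
have cmp x : x \in V -> prism_le (ord0, c) x || prism_le x (ord0, c).
  move=> xV; rewrite /prism_le /=; case: (leqP c x.2) => // xc.
  by rewrite (below_level xV xc) /= ltnW.
apply/chainbP => x y; rewrite !inE => /orP[/eqP->|xV] /orP[/eqP->|yV].
- by rewrite prism_refl.
- exact: cmp.
- by rewrite orbC cmp.
- exact: (elimT (chainbP V) chV).
Qed.

Lemma toggle_before_add : before c ((ord0, c) |: V).
Proof. by apply/beforeP => j jc; rewrite !inE /= (elimT (beforeP _ _) bV j jc). Qed.


Lemma toggle_covers_del : covers V -> covers (V :\ (ord0, c)).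
Proof.
move/forallP => H; apply/forallP => j; case: (eqVneq j c) => [->|jc].
  by apply/existsP; exists i1; rewrite !inE cV.
have /existsP[i Hi] := H j; apply/existsP; exists i; rewrite !inE Hi andbT.
by apply: contra jc => /eqP[_ ->].
Qed.

Lemma toggle_meets_del i : i != ord0 -> meets i V -> meets i (V :\ (ord0, c)).
Proof.
move=> i0 /existsP[j Hj]; apply/existsP; exists j; rewrite !inE Hj andbT.
by apply: contra i0 => /eqP[-> _].
Qed.

End Toggle.

Section Fill.
Variables (X : sSet) (phi : forall m, (Delta n m * Delta 2 m)%type -> X m) (a : X 1).
Hypotheses (qX : quasi_category X) (inv_a : ho_invertible (src a) (tgt a) [:: a]).

(** The boundary of [Delta n] times [Delta 2], together with [Delta n] times the horn at 0. *)
Definition prism_sub m (ba : sprod (Delta n) (Delta 2) m) : Prop :=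
  (exists j, forall i, (ba.1 : mono m n) i <> j) \/ in_horn ord0 ba.2.

Hypothesis phi_nat : forall m p (b : mono m p) (s : sprod (Delta n) (Delta 2) p),
  prism_sub s -> phi (act b s) = act b (phi s).
Hypothesis phi_a : phi (mono_cst 1 ord0 : Delta n 1, edge01 1 : Delta 2 1) = a.

Definition phiN m (s : N m) : X m := phi (column s : Delta n m, level s : Delta 2 m).

Lemma Fpr_sub m (s : N m) : Fpr n.+1 (supp s) ->
  prism_sub (column s : Delta n m, level s : Delta 2 m).
Proof.
have Hn1 : ~~ meets i1 (supp s) -> in_horn ord0 (level s : Delta 2 m).
  move=> /existsPn H; exists i1; split=> // i /= Ei; case/negP: (H (chain_fun s i).2).
  by apply/suppP; exists i; rewrite -Ei; case: (chain_fun s i).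
case/andP=> _ /or4P[/forallPn[j /existsPn H]|/Hn1|/existsPn H|/beforeP H].
- left; exists j => i /= Ei; case/negP: (H (chain_fun s i).1).
  by apply/suppP; exists i; rewrite -Ei; case: (chain_fun s i).
- by right.
- right; exists ord_max; split=> // i /= Ei; case/negP: (H (chain_fun s i).2).
  by apply/suppP; exists i; rewrite -Ei; case: (chain_fun s i).
- by right; apply: Hn1; apply/existsPn => j; apply: H.
Qed.

Lemma sub_Fpr m (s : N m) : prism_sub (column s : Delta n m, level s : Delta 2 m) ->
  Fpr n.+1 (supp s).
Proof.
rewrite /Fpr supp_chainb /=; case=> [[j /= Hj]|[j [j0 /= Hj]]].
  rewrite (_ : covers _ = false) //; apply/negbTE/forallPn; exists j.
  by apply/existsPn => i; apply/negP => /suppP[k Ek]; apply: (Hj k); rewrite Ek.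
have Hm : ~~ meets j (supp s).
  by apply/existsPn => k; apply/negP => /suppP[l El]; apply: (Hj l); rewrite El.
case: j j0 Hm {Hj} => [[|[|[|j]]] Hj] // j0 Hm; first by case: j0; apply: val_inj.
  by apply/or4P; constructor 2; rewrite (_ : i1 = Ordinal Hj) //; apply: val_inj.
by apply/or4P; constructor 3; rewrite (_ : ord_max = Ordinal Hj) //; apply: val_inj.
Qed.

Let pN : smap N point := to_point N.

Lemma phiN_psec : psec (to_point X) pN (nsub (Fpr n.+1)) phiN.
Proof.
split=> // m p b s /Fpr_sub Hs; rewrite /phiN -phi_nat //.
Qed.

(** In column 0 the toggled vertex is the least one, and [(i1, ord0)] comes next in [U], so the
    initial edge of the outer horn lies over vertex 0 of [Delta n], where it is [a]. A vertex of
    level 2 makes the dimension at least 2. *)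
Lemma prism_special (F : {set Pi} -> bool) (phi' : forall m, N m -> X m) (U : {set Pi}) :
  (forall m (s : N m), nsub (Fpr n.+1) s -> F (supp s)) ->
  (forall m (s : N m), nsub (Fpr n.+1) s -> phi' m s = phiN s) ->
  chainb U -> (ord0, ord0) \in U -> (i1, ord0) \in U -> meets ord_max U ->
  fillable (to_point X) pN F phi' U (ord0, ord0).
Proof.
move=> HF Hphi /chainbP chU U0 U1 mU r e k' inj sE Ek u Hu _.
have [j1 Ej1] : exists j, chain_fun e j = (i1, ord0) by apply/suppP; rewrite sE.
have [j2 [j Ej2]] : exists j2 j, chain_fun e j2 = (ord_max, j).
  case/existsP: mU => j jU; have [j2 Ej2] : exists j2, chain_fun e j2 = (ord_max,
    j) by apply/suppP; rewrite sE.
  by exists j2, j.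
have mono_lt i i' : chain_fun e i != chain_fun e i' ->
  prism_le (chain_fun e i) (chain_fun e i') -> i < i'.
  move=> ne H; rewrite ltn_neqAle (chain_reflect prism_anti inj H) andbT.
  by apply: contra ne => /eqP/val_inj->.
have k'j1 : k' < j1 by apply: mono_lt; rewrite Ek Ej1.
have j1j2 : j1 < j2 by apply: mono_lt; rewrite Ej1 Ej2.
have k'0 : k' = 0 :> nat.
  have H : prism_le (chain_fun e k') (chain_fun e ord0) by rewrite Ek /prism_le.
  by apply/eqP; rewrite -leqn0; apply: (chain_reflect prism_anti inj H).
have j11 : j1 = 1 :> nat.
  have r1 : 1 < r.+1 by have := ltn_ord j1; lia.
  pose o1 := Ordinal r1.
  have o1j : o1 <= j1 by rewrite /= -k'0.
  have /andP[/= h1 h2] := chain_homo e o1j; rewrite Ej1 in h1 h2.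
  have : chain_fun e o1 = (ord0, ord0) \/ chain_fun e o1 = (i1, ord0).
    move: h1 h2; case: (chain_fun e o1) => [[[|[|i]] Hi] [[|l] Hl]] //= _ _; [left | right];
    by congr pair; apply: val_inj.
  case; first by rewrite -Ek => /inj /(congr1 val) /=; rewrite k'0.
  by rewrite -Ej1 => /inj/(congr1 val).
have [t Et] : exists t, r = t.+2.
  by exists r.-2; have := ltn_ord j2; lia.
subst r; have Ek' : k' = ord0 by apply: val_inj.
subst k'; have [|//|w [w1 _]] := @special_horn t X point (to_point X) u tt a qX
  point_qcat (point_inner qX) inv_a.
  move=> H; have E01 (i : 'I_2) :
      chain_fun e ((edge01 t.+1 : mono _ _) i) = ((edge01 1 : mono 1 2) i, ord0).
    move: i; elim/ord2P.
      rewrite [mono_fun _ _](_ : _ = ord0); last by apply: val_inj; rewrite /= inordK.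
      by rewrite Ek; congr pair; apply: val_inj; rewrite /= inordK.
    rewrite [mono_fun _ _](_ : _ = j1); last by apply: val_inj; rewrite /= inordK ?j11.
    by rewrite Ej1; congr pair; apply: val_inj; rewrite /= inordK.
  have sub01 : nsub (Fpr n.+1) (act (edge01 t.+1) e).
    apply: sub_Fpr; right; exists ord_max; split=> // i.
    rewrite /= E01 /= => /(congr1 val) /=; rewrite inordK; have := ltn_ord i; lia.
  rewrite Hu /=; last exact: HF.
  rewrite Hphi // -phi_a /phiN; congr (phi (_, _)); apply: mono_eq => i; by rewrite /= E01.
by exists w; split.
Qed.

Lemma prism_fill : exists phi' : forall m, (Delta n m * Delta 2 m)%type -> X m,
  (forall m (s : sprod (Delta n) (Delta 2) m), prism_sub s -> phi' m s = phi s) /\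
  (forall m p (b : mono m p) (s : sprod (Delta n) (Delta 2) p),
     phi' m (act b s) = act b (phi' p s)).
Proof.
(* Stages are indexed downwards from [n.+1], hence the induction on the difference [d]. *)
have step c : c <= n.+1 -> exists phi' : forall m, N m -> X m,
    (forall m (s : N m), nsub (Fpr n.+1) s -> phi' m s = phiN s) /\
    psec (to_point X) pN (nsub (Fpr c)) phi'.
  move=> cn; rewrite -(subKn cn); move: (n.+1 - c) (leq_subr c n.+1) => d.
  elim: d => [_|d IH dn].
    by exists phiN; split=> //; rewrite subn0; apply: phiN_psec.
  have [phi1 [E1 H1]] := IH (ltnW dn).
  pose k : 'I_n.+1 := inord (n.+1 - d.+1).
  have kE : n.+1 - d.+1 = k :> nat by rewrite inordK //; lia.
  have kE1 : n.+1 - d = k.+1 by rewrite -kE; lia.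
  rewrite kE; rewrite kE1 in H1.
  have newP V : Fpr k V -> ~~ Fpr k.+1 V ->
      [/\ chainb V, covers V, meets i1 V, meets ord_max V & before k V /\ (i1, k) \in V].
    rewrite /Fpr => /andP[-> /=] H; rewrite !negb_or !negbK => /and4P[c1 c2 c3 nb].
    move: H; rewrite c1 c2 c3 /= => bV; split=> //; split=> //.
    apply: contraNT nb => kV; apply/beforeP => j; rewrite ltnS leq_eqVlt.
    by case/orP=> [/eqP/val_inj->//|]; apply: (elimT (beforeP _ _) bV).
  have newI V : chainb V -> covers V -> meets i1 V -> meets ord_max V -> before k V ->
      (i1, k) \in V -> Fpr k V && ~~ Fpr k.+1 V.
    move=> a1 a2 a3 a4 a5 a6; rewrite /Fpr a1 a2 a3 a4 a5 /=.
    by apply/negP => /beforeP/(_ k (ltnSn _)); rewrite a6.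
  have [|||phi2 [E2 H2]] := @psec_toggle Pi prism_le prism_refl prism_trans prism_anti
      X point (to_point X) pN (Fpr k.+1) (Fpr k) phi1 (ord0, k) (@dc_Fpr _) (@dc_Fpr _) _ _ _ H1.
  - move=> V; rewrite /Fpr => /andP[-> /or4P[->|->|->|/beforeP b]] //=; rewrite ?orbT //.
    by apply/or4P; constructor 4; apply/beforeP => j jk; apply: b; apply: leqW.
  - move=> V F1 F2; have [chV cV m1 m2 [bV kV]] := newP V F1 F2.
    split; first exact/chainbP.
    + apply: newI.
      * exact: toggle_chain bV kV.
      * exact: coversS (subsetUr _ _) cV.
      * exact: meetsS (subsetUr _ _) m1.
      * exact: meetsS (subsetUr _ _) m2.
      * exact: toggle_before_add.
      * by rewrite !inE kV orbT.
    + have chD : chainb (V :\ (ord0, k)).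
        apply/chainbP => x y; rewrite !in_setD1 => /andP[_ xV] /andP[_ yV].
        exact: (elimT (chainbP V) chV).
      apply: newI => //.
      * exact: toggle_covers_del.
      * exact: toggle_meets_del.
      * exact: toggle_meets_del.
      * apply/beforeP => j jk; rewrite in_setD1 negb_and.
        by rewrite (elimT (beforeP _ _) bV j jk) orbT.
      * by rewrite !inE kV.
  - move=> U F1 F2 kU; have [chU cU m1 m2 [bU k1U]] := newP U F1 F2.
    case: (posnP k) => [k0|k0].
      have Ek : k = ord0 by apply: val_inj.
      rewrite Ek in kU k1U *; apply: prism_special => //.
      by move=> m s; rewrite /nsub /Fpr => /andP[-> /or4P[->|->|->|/beforeP b]] //=;
        rewrite ?orbT //;
        apply/or4P; constructor 4; apply/beforeP => j jk; apply: b; apply: leq_trans jk _.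
    (* For [k > 0] the preceding column is covered, necessarily at level 0, by a vertex below
       [(ord0, k)]; since [(i1, k)] lies above it, the horn is inner. *)
    pose k' : 'I_n.+1 := inord k.-1.
    have k'k : k' < k.
      rewrite inordK; first by rewrite prednK.
      exact: leq_ltn_trans (leq_pred _) (ltn_ord k).
    have /existsP[i Hi] := elimT forallP cU k'.
    have i0 : i = ord0 by have := below_level chU bU k1U Hi; apply.
    rewrite i0 in Hi; apply: (inner_fillable prism_anti (point_inner qX) Hi k1U) => //.
    + by apply/eqP => -[E]; move: k'k; rewrite E ltnn.
    + by rewrite /prism_le /= ltnW.
    + by rewrite /prism_le /= leqnn.
  by exists phi2; split=> // m s Hs; rewrite E2 ?E1 //; move: Hs; rewrite /nsub /Fpr =>
    /andP[-> /or4P[->|->|->|/beforeP b]] //=; rewrite ?orbT //;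
    apply/or4P; constructor 4; apply/beforeP => j jk; apply: b.
have [phi' [E H]] := step 0 (leq0n _).
have all m (s : N m) : nsub (Fpr 0) s.
  by rewrite /nsub /Fpr supp_chainb /=; apply/or4P; constructor 4; apply/beforeP.
exists (fun m ba => phi' m (zigzag (ba.1 : mono m n) (ba.2 : mono m 2))); split.
  move=> m [b c] Hs; rewrite E /phiN.
    by congr (phi (_, _)); apply: mono_eq.
  apply: sub_Fpr.
  have -> : column (zigzag b c) = b by apply: mono_eq.
  by have -> : level (zigzag b c) = c by apply: mono_eq.
move=> m p b [c d].
have <- := proj1 H _ _ b (zigzag (c : mono p n) (d : mono p 2)) (all _ _).
congr (phi' m _); exact: chain_eq.
Qed.

End Fill.
End Prism.

(** * Skeletal induction *)

Definition misses m n (s : mono m n) : Prop := exists j, forall i, s i <> j.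

(** The section can be made to return a prescribed [i]; in [skel_uniq] this recovers a degeneracy
    operator one value at a time. *)
Lemma mono_section m n (s : mono m n) (i : 'I_m.+1) : ~ misses s ->
  exists d : mono n m, d (s i) = i /\ mono_comp s d = mono_id n.
Proof.
move=> Hs.
have /choice[d Hd] : forall j, exists k, s k = j /\ (j = s i -> k = i).
  move=> j; case: (pselect (j = s i)) => [->|ne]; first by exists i.
  have [k Ek] : exists k, s k = j.
    by apply: contrapT => H; apply: Hs; exists j => k Ek; apply: H; exists k.
  by exists k.
have dh (j j' : 'I_n.+1) : j <= j' -> d j <= d j'.
  move=> jj; rewrite leqNgt; apply/negP => dd.
  have := mono_homo s (ltnW dd); rewrite !(proj1 (Hd _)) => jj'.
  have E : j = j' by apply: val_inj; apply/eqP; rewrite eqn_leq jj jj'.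
  by rewrite E ltnn in dd.
exists (Mono dh); split; first by apply: (proj2 (Hd _)).
by apply: mono_eq => j /=; apply: (proj1 (Hd _)).
Qed.

Lemma mono_onto_id n (s : mono n n) : ~ misses s -> s = mono_id n.
Proof.
move=> Hs; have hit (k : 'I_n.+1) : exists i, s i = k.
  by apply: contrapT => H; apply: Hs; exists k => i Ei; apply: H; exists i.
have mon (i j : 'I_n.+1) : s i < s j -> i < j.
  by move=> zij; rewrite ltnNge; apply/negP => /(mono_homo s); lia.
have ge k : forall i : 'I_n.+1, s i = k :> nat -> k <= i.
  elim: k => [//|k IH] i Ei.
  have lk : k < n.+1 by have := ltn_ord (s i); lia.
  have [i' Ei'] := hit (Ordinal lk).
  have ii' : i' < i by apply: mon; rewrite Ei' /=; lia.
  by have := IH i'; rewrite Ei' /= => /(_ erefl); lia.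
have le k : forall i : 'I_n.+1, (s i + k)%N = n -> i + k <= n.
  elim: k => [|k IH] i Ei; first by have := ltn_ord i; lia.
  have lk : (s i).+1 < n.+1 by lia.
  have [i' Ei'] := hit (Ordinal lk).
  have ii' : i < i' by apply: mon; rewrite Ei' /=.
  by have := IH i'; rewrite Ei' /=; lia.
apply: mono_eq => i; apply: val_inj => /=.
by have := ge _ i erefl; have := ltn_ord (s i) => ls; have := le (n - s i) i; lia.
Qed.

Section Skeleton.
Variables (Y X : sSet) (phi0 : forall m, sprod Y (Delta 2) m -> X m).
Hypothesis qX : quasi_category X.

Definition horn_part m (s : sprod Y (Delta 2) m) : Prop := in_horn ord0 s.2.

Hypothesis phi0_nat : forall m p (b : mono m p) (s : sprod Y (Delta 2) p),
  horn_part s -> phi0 (act b s) = act b (phi0 s).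

Definition initial_edge (y : Y 0) : X 1 := phi0 (deg 1 y, edge01 1 : Delta 2 1).

Hypothesis phi0_inv : forall y : Y 0,
  ho_invertible (src (initial_edge y)) (tgt (initial_edge y)) [:: initial_edge y].

(** The bound on dimensions is strict, so that stage 0 is empty and the induction starts from the
    horn part alone. *)
Definition skel n m (y : Y m) : Prop :=
  exists l (z : Y l) (s : mono m l), l < n /\ y = act s z.

Lemma skel_act n m p (b : mono m p) (y : Y p) : skel n y -> skel n (act b y).
Proof.
move=> [l [z [s [ln ->]]]]; exists l, z, (mono_comp s b); split=> //.
exact: act_comp.
Qed.

Lemma skel_all m (y : Y m) : skel m.+1 y.
Proof. by exists m, y, (mono_id m); rewrite act_id. Qed.

Lemma skel_mono n p m (y : Y m) : n <= p -> skel n y -> skel p y.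
Proof.
by move=> np [l [z [s [ln ->]]]]; exists l, z, s; split=> //; apply: leq_trans np.
Qed.

Lemma skelS n m (y : Y m) : skel n.+1 y -> ~ skel n y ->
  exists (z : Y n) (s : mono m n), y = act s z.
Proof.
move=> [l [z [s [ln Ey]]]] Hy; have E : l = n.
  apply/eqP; rewrite eqn_leq -ltnS ln /= leqNgt; apply/negP => ln'.
  by apply: Hy; exists l, z, s.
by subst l; exists z, s.
Qed.

Lemma skel_misses n m (z : Y n) (s : mono m n) : misses s -> skel n (act s z).
Proof.
case: n z s => [|n] z s [j Hj]; first by case: (Hj ord0); rewrite !ord1.
have [t ->] := mono_factor Hj.
by exists n, (face j z), t; split=> //; rewrite /face act_comp.
Qed.

(* The Eilenberg-Zilber lemma. *)
Lemma skel_uniq n m (z z' : Y n) (s s' : mono m n) :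
  act s z = act s' z' -> ~ skel n (act s z) -> z = z' /\ s = s'.
Proof.
move=> E Hs; have ms : ~ misses s by move/(skel_misses z).
have key i : z = z' /\ s' i = s i.
  have [d [di sd]] := mono_section i ms.
  have Ez : z = act (mono_comp s' d) z'.
    by rewrite -(act_id z) -sd -act_comp E act_comp.
  have Eid : mono_comp s' d = mono_id n.
    apply: mono_onto_id => H; apply: Hs; rewrite Ez; apply: skel_act.
    exact: skel_misses.
  split; first by rewrite Ez Eid act_id.
  by have := congr1 (fun x : mono n n => x (s i)) Eid; rewrite /= di.
by split; [case: (key ord0) | apply: mono_eq => i; case: (key i)].
Qed.

Definition skel_sub n m (s : sprod Y (Delta 2) m) : Prop :=
  skel n s.1 \/ horn_part s.

Definition partial n (phi : forall m, sprod Y (Delta 2) m -> X m) : Prop :=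
  (forall m (s : sprod Y (Delta 2) m), horn_part s -> phi m s = phi0 s) /\
  (forall m p (b : mono m p) (s : sprod Y (Delta 2) p),
     skel_sub n s -> phi m (act b s) = act b (phi p s)).

Lemma partial0 : partial 0 phi0.
Proof. by split=> // m p b s [[? [? [? []]]]|/phi0_nat]. Qed.

Lemma horn_edge01 : in_horn ord0 (edge01 1 : Delta 2 1).
Proof.
exists ord_max; split=> // i /(congr1 val) /=.
by rewrite inordK; have := ltn_ord i; lia.
Qed.

(** Each nondegenerate [z] of dimension [n] contributes a prism, filled relative to its boundary and
    horn. By the Eilenberg-Zilber lemma, prisms of distinct [z] meet only where the map is already
    defined. *)
Lemma partial_step n phi : partial n phi ->
  exists phi', partial n.+1 phi' /\
    forall m (s : sprod Y (Delta 2) m), skel_sub n s -> phi' m s = phi m s.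
Proof.
move=> [phiE phiN].
pose pz (z : Y n) m (ba : (Delta n m * Delta 2 m)%type) : X m :=
  phi m (act (ba.1 : mono m n) z, ba.2).
have subz z m (ba : sprod (Delta n) (Delta 2) m) : prism_sub ba ->
  skel_sub n (act (ba.1 : mono m n) z, ba.2).
  case=> [H|H]; [left | by right]; exact: skel_misses.
have /choice[F HF] : forall z : Y n, exists f : forall m, (Delta n m * Delta 2 m)%type -> X m,
    (forall m (s : sprod (Delta n) (Delta 2) m), prism_sub s -> f m s = pz z m s) /\
    (forall m p (b : mono m p) (s : sprod (Delta n) (Delta 2) p),
       f m (act b s) = act b (f p s)).
  move=> z; apply: (@prism_fill n X (pz z) (initial_edge (vertex ord0 z)) qX) => //.
    move=> m p b s Hs; rewrite /pz -phiN; last exact: subz.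
    by rewrite -act_comp.
  rewrite /pz /= phiE; last exact: horn_edge01.
  by rewrite /initial_edge /deg /vertex act_comp; congr (phi0 (_, _)); congr act; apply: mono_eq.
pose cell m (y : Y m) := exists zs : Y n * mono m n, y = act zs.2 zs.1.
pose phi' m (s : sprod Y (Delta 2) m) : X m :=
  if pselect (skel_sub n s) is left _ then phi m s else
  if pselect (cell m s.1) is left e then F (sval (cid e)).1 m ((sval (cid e)).2 : Delta n m, s.2)
  else phi m s.
have old m s : skel_sub n s -> phi' m s = phi m s by rewrite /phi'; case: pselect.
have new m (z : Y n) (s : mono m n) a : ~ skel n z -> phi' m (act s z,
  a) = F z m (s : Delta n m, a).
  move=> nz; rewrite /phi'; case: pselect => [H|H].
    have [HF1 _] := HF z; rewrite HF1 //.
    case: (pselect (in_horn ord0 a)) => Ha; first by right.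
    case: H => // H; left; apply: contrapT => ms.
    have [d [_ sd]] := mono_section ord0 ms.
    by apply: nz; rewrite -(act_id z) -sd -act_comp; apply: skel_act.
  case: pselect => [e|[]]; last by exists (z, s).
  case: (cid e) => -[z' s'] /= E.
  by have [|-> ->] := skel_uniq E; first by move=> h; apply: H; left.
exists phi'; split; last exact: old.
split=> [m s Hs|m p b [y a] Hs]; first by rewrite old ?phiE //; right.
case: (pselect (skel_sub n (y, a))) => H.
  rewrite !old ?phiN //; case: H => H; [left; exact: skel_act | right; exact: in_horn_act].
case: Hs => /= [Hs|Hs]; last by case: H; right.
have [z [s Ey]] := skelS Hs (fun h => H (or_introl h)).
subst y; have [_ HF2] := HF z.
have nz : ~ skel n z by move=> h; apply: H; left; apply: skel_act.
transitivity (phi' m (act (mono_comp s b) z, act b a)).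
  by congr (phi' m _); rewrite /= /sprod_act /= act_comp.
by rewrite !new // -HF2.
Qed.

Fixpoint partial_seq (n : nat) : {phi | partial n phi} :=
  match n with
  | 0 => exist _ phi0 partial0
  | n.+1 => let y := cid (partial_step (svalP (partial_seq n))) in
            exist _ (sval y) (proj1 (svalP y))
  end.

Lemma skeleton_fill : exists phi : smap (sprod Y (Delta 2)) X,
  forall m (s : sprod Y (Delta 2) m), horn_part s -> phi m s = phi0 s.
Proof.
have stepE n m (s : sprod Y (Delta 2) m) : skel_sub n s ->
    sval (partial_seq n.+1) m s = sval (partial_seq n) m s.
  by move=> Hs; rewrite /=; case: cid => phi' [H' E] /=; apply: E.
have leE n p m (s : sprod Y (Delta 2) m) : skel n s.1 -> n <= p ->
    sval (partial_seq p) m s = sval (partial_seq n) m s.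
  move=> Hs; elim: p => [|p IH]; first by rewrite leqn0 => /eqP->.
  rewrite leq_eqVlt => /orP[/eqP->//|np]; rewrite stepE ?IH //.
  by left; apply: skel_mono Hs.
(* An [m]-simplex is read at stage [m.+1]; naturality compares both stages with a common later
   one. *)
have nat m p (b : mono m p) (s : sprod Y (Delta 2) p) :
    sval (partial_seq m.+1) m (act b s) = act b (sval (partial_seq p.+1) p s).
  have [_ N] := svalP (partial_seq (maxn m p).+1).
  rewrite -(leE m.+1 (maxn m p).+1); [|exact: skel_all|by rewrite ltnS leq_maxl].
  rewrite -(leE p.+1 (maxn m p).+1 p); [|exact: skel_all|by rewrite ltnS leq_maxr].
  rewrite N //; left; apply: skel_mono (skel_all _); by rewrite ltnS leq_maxr.
exists (@SMap (sprod Y (Delta 2)) X (fun m s => sval (partial_seq m.+1) m s) nat).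
move=> m s Hs /=; exact: (proj1 (svalP (partial_seq m.+1))).
Qed.

End Skeleton.

(** * Invertibility in the homotopy category; absolute right liftings *)

Section Cancel.
Variable X : sSet.
Implicit Types (x y z : X 0) (s t w : seq (X 1)).

Lemma ho_invertible_nil x : ho_invertible x x [::].
Proof. by split=> //; exists [::]; split=> //; apply: hoeq_refl. Qed.

Lemma ho_invertible_inv x y s : ho_invertible x y s ->
  exists t, [/\ ho_invertible y x t, hoeq x x (s ++ t) [::] & hoeq y y (t ++ s) [::]].
Proof. by case=> ps [t [pt st ts]]; exists t; split=> //; split=> //; exists s. Qed.

Lemma hoeq_cancelr x y z s t w : ho_invertible y z w -> is_path x s y ->
  is_path x t y -> hoeq x z (s ++ w) (t ++ w) -> hoeq x y s t.
Proof.
move=> [pw [v [pv wv _]]] ps pt H.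
have K u : is_path x u y -> hoeq x y ((u ++ w) ++ v) u.
  by move=> pu; rewrite -catA -[X in hoeq _ _ _ X]cats0; apply: hoeq_catl pu wv.
apply: hoeq_trans (hoeq_sym (K s ps)) _; apply: hoeq_trans (K t pt).
exact: hoeq_catr H pv.
Qed.


End Cancel.

Section Lifting.
Variable K : sCat.

Lemma wl1 (X A : K) (s : seq (hom X A 1)) : whiskerl (id0 A) s = s.
Proof. by rewrite /whiskerl -[RHS]map_id; apply: eq_map => x; apply: postc1. Qed.

Lemma wr1 (X A : K) (s : seq (hom X A 1)) : whiskerr s (id0 X) = s.
Proof. by rewrite /whiskerr -[RHS]map_id; apply: eq_map => x; apply: prec1. Qed.

Lemma ho_invertible_wl (X A B : K) (g : arr A B) (x y : arr X A) s :
  ho_invertible x y s -> ho_invertible (comp g x) (comp g y) (whiskerl g s).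
Proof. by move/(ho_invertible_map (hom_post X g)); rewrite /= !postc0. Qed.

Lemma ho_invertible_wr (X A B : K) (f : arr X A) (x y : arr A B) s :
  ho_invertible x y s -> ho_invertible (comp x f) (comp y f) (whiskerr s f).
Proof. by move/(ho_invertible_map (hom_pre B f)); rewrite /= !prec0. Qed.

(* eps : p r => b exhibits r as an absolute right lifting of b along p. *)
Definition lifting (X E B : K) (p : arr E B) (b : arr X B) (r : arr X E)
    (eps : seq (hom X B 1)) : Prop :=
  [/\ is_path (comp p r) eps b,
      forall (Y : K) (y : arr Y X) (e : arr Y E) chi,
        is_path (comp p e) chi (comp b y) -> exists phi,
        is_path e phi (comp r y) /\
        hoeq (comp p e) (comp b y) (whiskerl p phi ++ whiskerr eps y) chi &
      forall (Y : K) (y : arr Y X) (e : arr Y E) phi phi',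
        is_path e phi (comp r y) -> is_path e phi' (comp r y) ->
        hoeq (comp p e) (comp b y) (whiskerl p phi ++ whiskerr eps y)
          (whiskerl p phi' ++ whiskerr eps y) ->
        hoeq e (comp r y) phi phi'].

Lemma lifting_whisker (W X E B : K) (p : arr E B) (b : arr X B) r eps (a : arr W X) :
  lifting p b r eps -> lifting p (comp b a) (comp r a) (whiskerr eps a).
Proof.
case=> pe ex un; split.
- by rewrite compA; apply: wr_path.
- move=> Y y e chi; rewrite -!compA => /ex[phi [pphi H]]; exists phi.
  by rewrite wrA.
- move=> Y y e phi phi'; rewrite -!compA !wrA; exact: un.
Qed.

Lemma lifting_compare (X E B : K) (p : arr E B) (b : arr X B) r eps r' eps' :
  lifting p b r eps -> lifting p b r' eps' ->
  exists z, is_path r z r' /\ hoeq (comp p r) b (whiskerl p z ++ eps') eps.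
Proof.
move=> [pe _ _] [_ ex _]; have := ex X (id0 X) r eps.
by rewrite !id0r wr1; apply.
Qed.

(** [z] and the empty path have the same transpose. *)
Lemma lifting_endo (X E B : K) (p : arr E B) (b : arr X B) r eps z :
  lifting p b r eps -> is_path r z r ->
  hoeq (comp p r) b (whiskerl p z ++ eps) eps -> hoeq r r z [::].
Proof.
move=> [pe _ un] pz H; have := un X (id0 X) r z [::].
by rewrite !id0r wr1; apply.
Qed.

Lemma lifting_compare_comp (X E B : K) (p : arr E B) (b : arr X B) r eps r' eps' r'' eps'' z z' :
  is_path (comp p r) eps b ->
  is_path r z r' -> hoeq (comp p r) b (whiskerl p z ++ eps') eps ->
  is_path r' z' r'' -> hoeq (comp p r') b (whiskerl p z' ++ eps'') eps' ->
  hoeq (comp p r) b (whiskerl p (z ++ z') ++ eps'') eps.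
Proof.
move=> pe pz H pz' H'; rewrite wl_cat -catA; apply: hoeq_trans H.
by apply: hoeq_catl H'; apply: wl_path.
Qed.

(** There is also a comparison in the other direction, and both composites are endomorphisms
    compatible with the counits. *)
Lemma lifting_compare_invertible (X E B : K) (p : arr E B) (b : arr X B) r eps r' eps' z :
  lifting p b r eps -> lifting p b r' eps' -> is_path r z r' ->
  hoeq (comp p r) b (whiskerl p z ++ eps') eps -> ho_invertible r r' z.
Proof.
move=> L L' pz H; have [z' [pz' H']] := lifting_compare L' L.
have [pe _ _] := L; have [pe' _ _] := L'.
split=> //; exists z'; split=> //.
- apply: lifting_endo L (path_cat pz pz') _; exact: lifting_compare_comp H pz' H'.
- apply: lifting_endo L' (path_cat pz' pz) _; exact: lifting_compare_comp H' pz H.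
Qed.

Lemma lifting_iso (X E B : K) (p : arr E B) (b : arr X B) r eps r' eps' z :
  lifting p b r eps -> ho_invertible r r' z -> is_path (comp p r') eps' b ->
  hoeq (comp p r) b (whiskerl p z ++ eps') eps -> lifting p b r' eps'.
Proof.
move=> [pe ex un] iz pe' H; have [pz _] := iz; split=> //.
- move=> Y y e chi pc; have [phi [pphi Hphi]] := ex Y y e chi pc.
  exists (phi ++ whiskerr z y); split.
    exact: path_cat pphi (wr_path y pz).
  apply: hoeq_trans Hphi; rewrite wl_cat -catA -wr_wl -wr_cat.
  apply: (hoeq_catl (wl_path p pphi)); rewrite compA; exact: wr_hoeq.
- have [z' [iz' zz' z'z]] := ho_invertible_inv iz; have [pz' _] := iz'.
  have H' : hoeq (comp p r') b (whiskerl p z' ++ eps) eps'.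
    apply: hoeq_trans (hoeq_catl (wl_path p pz') (hoeq_sym H)) _.
    rewrite catA -wl_cat -[X in hoeq _ _ _ X]cat0s.
    exact: hoeq_catr (wl_hoeq p z'z) pe'.
  move=> Y y e phi phi' pphi pphi' Hphi.
  have iw := ho_invertible_wr y iz'; have [pw _] := iw.
  apply: (hoeq_cancelr iw) => //; apply: un.
  + exact: path_cat pphi pw.
  + exact: path_cat pphi' pw.
  + have red u : is_path e u (comp r' y) -> hoeq (comp p e) (comp b y)
        (whiskerl p (u ++ whiskerr z' y) ++ whiskerr eps y) (whiskerl p u ++ whiskerr eps' y).
      move=> pu; rewrite wl_cat -catA -wr_wl -wr_cat.
      apply: (hoeq_catl (wl_path p pu)); rewrite compA; exact: wr_hoeq.
    apply: hoeq_trans (red _ pphi) _; apply: hoeq_trans Hphi _.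
    exact: hoeq_sym (red _ pphi').
Qed.

Lemma lifting_hoeq (X E B : K) (p : arr E B) (b : arr X B) r eps eps' :
  lifting p b r eps -> hoeq (comp p r) b eps eps' -> lifting p b r eps'.
Proof.
move=> L H; apply: (lifting_iso L (ho_invertible_nil r) (hoeq_right H)).
exact: hoeq_sym.
Qed.

Lemma lifting_target_iso (X E B : K) (p : arr E B) (b b' : arr X B) r eps nu :
  lifting p b r eps -> ho_invertible b b' nu -> lifting p b' r (eps ++ nu).
Proof.
move=> [pe ex un] inu; have [pnu [nu' [pnu' nn' n'n]]] := inu; split.
- exact: path_cat pe pnu.
- move=> Y y e chi pc.
  have [phi [pphi H]] := ex Y y e (chi ++ whiskerr nu' y) (path_cat pc (wr_path y pnu')).
  exists phi; split=> //; rewrite wr_cat catA.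
  apply: hoeq_trans (hoeq_catr H (wr_path y pnu)) _.
  rewrite -catA -wr_cat -[X in hoeq _ _ _ X]cats0.
  exact: hoeq_catl pc (wr_hoeq y n'n).
- move=> Y y e phi phi' pphi pphi'; rewrite wr_cat !catA => H.
  apply: un => //; apply: (hoeq_cancelr (ho_invertible_wr y inu)) H.
  + by apply: path_cat (wl_path p pphi) _; rewrite compA; apply: wr_path.
  + by apply: path_cat (wl_path p pphi') _; rewrite compA; apply: wr_path.
Qed.

(* If both triangle composites are merely invertible, then eps is still the
   counit of an adjunction, for another unit. *)
Lemma weak_adjunction (E B : K) (p : arr E B) r eta eps :
  is_path (id0 E) eta (comp r p) -> is_path (comp p r) eps (id0 B) ->
  ho_invertible p p (whiskerl p eta ++ whiskerr eps p) ->
  ho_invertible r r (whiskerr eta r ++ whiskerl r eps) ->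
  lifting p (id0 B) r eps.
Proof.
move=> pn pe it iw; split=> //.
- move=> Y y e chi; rewrite id0l => pc.
  have [t' [it' tt' t't]] := ho_invertible_inv it; have [pt' _] := it'.
  (* The usual transpose of [chi] is off by the first triangle composite; [chi] is corrected in
     advance by its inverse. *)
  set chi' := whiskerr t' e ++ chi.
  have pc' : is_path (comp p e) chi' y by apply: path_cat (wr_path e pt') pc.
  have pne : is_path e (whiskerr eta e) (comp r (comp p e)).
    by have := wr_path e pn; rewrite id0l compA.
  exists (whiskerr eta e ++ whiskerl r chi'); split.
    exact: path_cat pne (wl_path r pc').
  have pe1 : is_path (comp p (comp r (comp p e))) (whiskerr eps (comp p e)) (comp p e).
    by have := wr_path (comp p e) pe; rewrite id0l -compA.
  have I := interchange pe pc'; rewrite !id0l wl1 -!compA in I.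
  rewrite wl_cat wlA -catA.
  apply: hoeq_trans (hoeq_catl (wl_path p pne) (hoeq_sym I)) _.
  rewrite /chi' -wr_wl -wrA !catA -wr_cat -wr_cat -[X in hoeq _ _ _ X]cat0s.
  exact: hoeq_catr (wr_hoeq e tt') pc.
- move=> Y y e phi phi' pphi pphi'; rewrite id0l => H.
  apply: (hoeq_cancelr (ho_invertible_wr y iw)) => //.
  have pne : is_path e (whiskerr eta e) (comp r (comp p e)).
    by have := wr_path e pn; rewrite id0l compA.
  have pey : is_path (comp p (comp r y)) (whiskerr eps y) y.
    by have := wr_path y pe; rewrite id0l -compA.
  (* By interchange, [u] followed by the second triangle composite depends only on the transpose of
     [u]; that composite is invertible, so [u] is determined. *)
  have red u : is_path e u (comp r y) ->
      hoeq e (comp r y) (u ++ whiskerr (whiskerr eta r ++ whiskerl r eps) y)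
        (whiskerr eta e ++ whiskerl r (whiskerl p u ++ whiskerr eps y)).
    move=> pu; have I := interchange pn pu; rewrite !id0l wl1 -!compA in I.
    rewrite wr_cat wr_wl wrA catA wl_cat wlA catA.
    by apply: hoeq_catr (hoeq_sym I) _; apply: wl_path.
  apply: hoeq_trans (red _ pphi) _; apply: hoeq_trans (hoeq_sym (red _ pphi')).
  exact: hoeq_catl pne (wl_hoeq r H).
Qed.

Lemma adjunction_lifting (E B : K) (p : arr E B) r eta eps :
  is_adjunction p r eta eps -> lifting p (id0 B) r eps.
Proof.
case=> pn pe T1 T2; apply: (weak_adjunction pn pe).
- exact: ho_invertible_hoeq (hoeq_sym T1) (ho_invertible_nil _).
- exact: ho_invertible_hoeq (hoeq_sym T2) (ho_invertible_nil _).
Qed.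

(** [eta] is the transpose of the identity of [p], which gives the first triangle identity. The
    second holds because its composite is an endomorphism of [r] compatible with [eps]. *)
Lemma lifting_adjunction (E B : K) (p : arr E B) r eps :
  lifting p (id0 B) r eps -> exists eta, is_adjunction p r eta eps.
Proof.
move=> L; have [pe ex un] := L.
have [|eta [pn H]] := ex E p (id0 E) [::]; first by rewrite /= id0l id0r.
rewrite id0l id0r in H; exists eta; split=> //.
have pnr : is_path r (whiskerr eta r) (comp r (comp p r)).
  by have := wr_path r pn; rewrite id0l compA.
have pre : is_path (comp r (comp p r)) (whiskerl r eps) r.
  by have := wl_path r pe; rewrite id0r.
apply: (lifting_endo L); first exact: path_cat pnr pre.
have I := interchange pe pe; rewrite !id0l ?id0r wl1 wr1 -!compA in I.
rewrite wl_cat wlA -catA.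
apply: hoeq_trans (hoeq_catl (wl_path p pnr) (hoeq_sym I)) _.
rewrite -wrA -wr_wl catA -wr_cat -[X in hoeq _ _ _ X]cat0s.
exact: hoeq_catr (wr_hoeq r H) pe.
Qed.

Lemma left_adjointP (E B : K) (p : arr E B) :
  is_left_adjoint p <-> exists r eps, lifting p (id0 B) r eps.
Proof.
split=> [[r [eta [eps A]]]|[r [eps /lifting_adjunction[eta A]]]].
  by exists r, eps; apply: adjunction_lifting A.
by exists r, eta, eps.
Qed.

Section Mate.
Variables (E1 B1 E2 B2 : K) (p1 : arr E1 B1) (p2 : arr E2 B2)
  (e : arr E1 E2) (b : arr B1 B2).
Hypothesis sq : comp p2 e = comp b p1.

(** So the mate compares [whiskerl b eps1] with the absolute right lifting [whiskerr eps2 b], and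
    its invertibility means that the former is one as well. *)
Lemma mate_transpose r1 eta1 eps1 r2 eta2 eps2 :
  is_adjunction p1 r1 eta1 eps1 -> is_adjunction p2 r2 eta2 eps2 ->
  hoeq (comp p2 (comp e r1)) b
    (whiskerl p2 (mate e b r1 eps1 r2 eta2) ++ whiskerr eps2 b) (whiskerl b eps1).
Proof.
move=> [pn1 pe1 _ _] [pn2 pe2 T _]; rewrite /mate wl_cat -catA wlA.
have Esq (X : K) (z : arr X E1) : comp p2 (comp e z) = comp b (comp p1 z).
  by rewrite compA sq -compA.
have pbe : is_path (comp b (comp p1 r1)) (whiskerl b eps1) b.
  by have := wl_path b pe1; rewrite id0r.
have I := interchange pe2 pbe; rewrite !id0l wl1 -!compA wlA -compA in I.
have pn := wl_path p2 (wr_path (comp e r1) pn2).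
rewrite id0l -!compA Esq in pn; rewrite Esq.
apply: hoeq_trans (hoeq_catl pn (hoeq_sym I)) _.
rewrite -Esq -[whiskerr eps2 _]wrA catA -wr_wl -wr_cat -[X in hoeq _ _ _ X]cat0s.
apply: hoeq_catr pbe; have := wr_hoeq (comp e r1) T.
by rewrite Esq.
Qed.

(** Preservation holds for [eps1] by inverting the mate, then for its restriction along [a], then
    for every lifting of [a], since liftings of [a] are isomorphic. *)
Lemma left_adjoint_morphism_lifting (X : K) (a : arr X B1) r eps :
  is_left_adjoint p1 -> is_left_adjoint p2 -> left_adjoint_morphism p1 p2 e b ->
  lifting p1 a r eps -> lifting p2 (comp b a) (comp e r) (whiskerl b eps).
Proof.
move=> [r1 [eta1 [eps1 A1]]] [r2 [eta2 [eps2 A2]]] M L.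
have im := M _ _ _ _ _ _ A1 A2; have [pm _] := im.
have mt := mate_transpose A1 A2.
have L1 := adjunction_lifting A1; have L2 := lifting_whisker b (adjunction_lifting A2).
have [_ pe1 _ _] := A1.
have pbe : is_path (comp p2 (comp e r1)) (whiskerl b eps1) b := hoeq_right mt.
have [m' [im' mm' m'm]] := ho_invertible_inv im; have [pm' _] := im'.
rewrite id0l in L2; have [pe2 _ _] := L2.
have L3 : lifting p2 b (comp e r1) (whiskerl b eps1).
  apply: (lifting_iso L2 im' pbe).
  apply: hoeq_trans (hoeq_catl (wl_path p2 pm') (hoeq_sym mt)) _.
  rewrite catA -wl_cat -[X in hoeq _ _ _ X]cat0s.
  exact: hoeq_catr (wl_hoeq p2 m'm) pe2.
have L1a := lifting_whisker a L1; rewrite id0l in L1a.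
have [z [pz H]] := lifting_compare L1a L.
have iz := lifting_compare_invertible L1a L pz H.
have := lifting_whisker a L3; rewrite -compA => L3a.
have [pe _ _] := L.
have Esq (Y : K) (y : arr Y E1) : comp p2 (comp e y) = comp b (comp p1 y).
  by rewrite compA sq -compA.
apply: (lifting_iso L3a (ho_invertible_wl e iz)).
- by rewrite Esq; apply: wl_path.
- rewrite wlA sq -wlA -wl_cat wr_wl Esq; exact: wl_hoeq.
Qed.

Lemma lifting_left_adjoint_morphism r1 eps1 :
  is_left_adjoint p2 -> lifting p1 (id0 B1) r1 eps1 ->
  lifting p2 b (comp e r1) (whiskerl b eps1) -> left_adjoint_morphism p1 p2 e b.
Proof.
move=> l2 /lifting_adjunction[eta1 A1] L.
have l1 : is_left_adjoint p1 by exists r1, eta1, eps1.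
apply/left_adjoint_morphism_ex => //.
have [r2 [eta2 [eps2 A2]]] := l2.
exists r1, eta1, eps1, r2, eta2, eps2; split=> //.
have L2 := lifting_whisker b (adjunction_lifting A2); rewrite id0l in L2.
exact: lifting_compare_invertible L L2 (mate_path sq A1 A2) (mate_transpose A1 A2).
Qed.

(* Morphisms of left adjoints are replete in the homotopy category. *)
Lemma left_adjoint_morphism_iso (e' : arr E1 E2) (b' : arr B1 B2) th ps :
  comp p2 e' = comp b' p1 ->
  is_left_adjoint p1 -> is_left_adjoint p2 -> left_adjoint_morphism p1 p2 e b ->
  ho_invertible e e' th -> ho_invertible b b' ps ->
  whiskerl p2 th = whiskerr ps p1 ->
  (forall r1 eps1, lifting p1 (id0 B1) r1 eps1 ->
     lifting p2 b' (comp e' r1) (whiskerl b' eps1)).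
Proof.
move=> sq' l1 l2 M ith ips E r1 eps1 L; have [pe1 _ _] := L.
have := left_adjoint_morphism_lifting l1 l2 M L; rewrite id0r => L2.
have := lifting_target_iso L2 ips => L3.
have [pps _] := ips.
apply: (lifting_iso L3 (ho_invertible_wr r1 ith)).
  have := wl_path b' pe1; rewrite id0r [comp p2 _]compA sq' -compA; exact.
rewrite -wr_wl E wrA.
have := interchange pps pe1; by rewrite !id0r wr1 [comp p2 _]compA sq -compA.
Qed.

End Mate.

Section Cone.
Variable I : Type.

Definition conservative_cone (L : K) (A : I -> K) (l : forall i, arr L (A i)) : Prop :=
  forall (X : K) (x y : arr X L) s, is_path x s y ->
    (forall i, ho_invertible (comp (l i) x) (comp (l i) y) (whiskerl (l i) s)) ->
    ho_invertible x y s.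

Variables (E B : K) (Ei Bi : I -> K) (p : arr E B) (pi : forall i, arr (Ei i) (Bi i))
  (k : forall i, arr E (Ei i)) (l : forall i, arr B (Bi i)).
Hypothesis sq : forall i, comp (pi i) (k i) = comp (l i) p.
Hypotheses (kC : conservative_cone k) (lC : conservative_cone l).
Variables (r : arr B E) (eps : seq (hom B B 1)).
Hypothesis pe : is_path (comp p r) eps (id0 B).
Hypothesis Li : forall i, lifting (pi i) (l i) (comp (k i) r) (whiskerl (l i) eps).

(** On each leg the first triangle composite is an identity by hypothesis, and the second is an
    endomorphism of the lifting [comp (k i) r] compatible with its counit, hence an identity too.
    Conservativity turns this into invertibility, which is all that [weak_adjunction] asks for. *)
Lemma cone_lifting eta : is_path (id0 E) eta (comp r p) ->
  (forall i, hoeq (comp (l i) p) (comp (l i) p)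
     (whiskerl (l i) (whiskerl p eta ++ whiskerr eps p)) [::]) ->
  lifting p (id0 B) r eps.
Proof.
move=> pn H; apply: (weak_adjunction pn pe).
  apply: lC => [|i].
    apply: (@path_cat _ _ (comp p (comp r p))).
      by have := wl_path p pn; rewrite id0r.
    by have := wr_path p pe; rewrite id0l -compA.
  exact: ho_invertible_hoeq (hoeq_sym (H i)) (ho_invertible_nil _).
have pnr : is_path r (whiskerr eta r) (comp r (comp p r)).
  by have := wr_path r pn; rewrite id0l compA.
have pre : is_path (comp r (comp p r)) (whiskerl r eps) r.
  by have := wl_path r pe; rewrite id0r.
have pw := path_cat pnr pre.
apply: kC => // i.
apply: ho_invertible_hoeq (ho_invertible_nil _); apply: hoeq_sym.
apply: (lifting_endo (Li i)); first exact: wl_path.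
have Esq (X : K) (z : arr X E) : comp (pi i) (comp (k i) z) = comp (l i) (comp p z).
  by rewrite compA sq -compA.
rewrite wlA sq -wlA -wl_cat Esq; have := wl_path (l i) pe; rewrite id0r => ple.
have I0 := interchange pe pe; rewrite !id0l ?id0r wl1 wr1 -!compA in I0.
have H1 : hoeq (comp p r) (id0 B)
    (whiskerl p (whiskerr eta r ++ whiskerl r eps) ++ eps)
    (whiskerr (whiskerl p eta ++ whiskerr eps p) r ++ eps).
  rewrite wl_cat wlA -catA.
  apply: hoeq_trans (hoeq_catl (wl_path p pnr) (hoeq_sym I0)) _.
  rewrite -wrA -wr_wl catA -wr_cat; apply: hoeq_refl; apply: path_cat pe.
  rewrite wr_cat wrA wr_wl; apply: (@path_cat _ _ (comp p (comp r (comp p r)))).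
    exact: wl_path.
  by have := wr_path (comp p r) pe; rewrite id0l -!compA.
have := wl_hoeq (l i) H1; rewrite id0r => H2; apply: hoeq_trans H2 _.
rewrite wl_cat -wr_wl -[X in hoeq _ _ _ X]cat0s; apply: hoeq_catr ple.
have := wr_hoeq r (H i); rewrite -!compA; exact.
Qed.

Lemma cone_projection i : is_left_adjoint (pi i) -> lifting p (id0 B) r eps ->
  left_adjoint_morphism p (pi i) (k i) (l i).
Proof. move=> la L; exact: lifting_left_adjoint_morphism la L (Li i). Qed.

(** Each leg turns the mate into a comparison between two absolute right liftings of [comp (l i) b]
    along [pi i]. *)
Lemma cone_morphism (E1 B1 : K) (p1 : arr E1 B1) (e : arr E1 E) (b : arr B1 B) :
  comp p e = comp b p1 -> is_left_adjoint p1 -> (forall i, is_left_adjoint (pi i)) ->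
  lifting p (id0 B) r eps ->
  (forall i, left_adjoint_morphism p1 (pi i) (comp (k i) e) (comp (l i) b)) ->
  left_adjoint_morphism p1 p e b.
Proof.
move=> sq1 la1 lai L M.
have la : is_left_adjoint p by apply/left_adjointP; exists r, eps.
apply/left_adjoint_morphism_ex => //.
have [r1 [eta1 [eps1 A1]]] := la1; have [eta A] := lifting_adjunction L.
exists r1, eta1, eps1, r, eta, eps; split=> //.
have pm := mate_path sq1 A1 A; have mt := mate_transpose sq1 A1 A.
apply: kC => // i.
have sqi : comp (pi i) (comp (k i) e) = comp (comp (l i) b) p1.
  by rewrite compA sq -!compA sq1.
have := left_adjoint_morphism_lifting sqi la1 (lai i) (M i) (adjunction_lifting A1).
rewrite id0r -compA => L1.
have := lifting_whisker b (Li i); rewrite -compA => L2.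
apply: (lifting_compare_invertible L1 L2); first exact: wl_path.
rewrite wlA sq -wlA wr_wl -wl_cat -wlA [comp (pi i) _]compA sq -compA.
exact: wl_hoeq.
Qed.

End Cone.

End Lifting.

(** * Pointwise invertibility and rectification *)

Notation invertible_edge a := (ho_invertible (src a) (tgt a) [:: a]).

Lemma src_map (X Y : sSet) (f : smap X Y) (a : X 1) : src (f 1 a) = f 0 (src a).
Proof. by rewrite /src /vertex smap_nat. Qed.

Lemma tgt_map (X Y : sSet) (f : smap X Y) (a : X 1) : tgt (f 1 a) = f 0 (tgt a).
Proof. by rewrite /tgt /vertex smap_nat. Qed.

Lemma deg_map (X Y : sSet) (f : smap X Y) n (x : X 0) : f n (deg n x) = deg n (f 0 x).
Proof. exact: smap_nat. Qed.

(** The horn at 1 formed by [a] and an identity is filled over the given 2-simplex. *)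
Lemma homotopy_lift (P R : sSet) (f : smap P R) (a : P 1) (c : R 1) :
  inner_fibration f -> homotopic (f 1 a) c ->
  exists a', homotopic a a' /\ f 1 a' = c.
Proof.
move=> fi [s [s2 s0 s1]].
pose x (i : 'I_3) := if i == 0 :> nat then deg 1 (tgt a) else a.
have [|||w [w1 w2]] := @horn2_lift P R f i1 x s.
- move=> [[|[|[|i]]] Hi] [[|[|[|j]]] Hj] // _ _ _; rewrite /x /=.
  rewrite (inordE (i := ord0)) ?(inordE (i := ord_max)) //.
  by rewrite (proj1 (face_edge _)) (proj2 (face_edge _)) src_deg.
- move=> [[|[|[|j]]] Hj] // _; rewrite /x /=.
    rewrite (_ : Ordinal _ = ord0) ?s0 ?deg_map -?tgt_map //; exact: val_inj.
  by rewrite (_ : Ordinal _ = ord_max) ?s2 //; exact: val_inj.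
- move=> u _ fu; have [||w [w1 w2]] := fi 2 i1 _ u (simplex_map s) => //.
  exists (w 2 (mono_id 2)); split; last by rewrite w2 /= act_id.
  by move=> m b; rewrite -smap_nat -w1; congr (w m _); apply: mono_eq.
exists (face i1 w); split; first by exists w; split=> //; rewrite w1.
by rewrite /face smap_nat w2.
Qed.

Section Edges.
Variable X : sSet.
Hypothesis qX : quasi_category X.

Lemma left_inverse_of_invertible (a b : X 1) : invertible_edge a ->
  tri a b (deg 1 (src a)) -> invertible_edge b.
Proof.
move=> inv_a T; have /(ho_invertible_tri qX)[c [T1 T2]] := inv_a.
have [E1 E2 E3] := tri_ends T; have [E1' E2' E3'] := tri_ends T1.
have H : homotopic b c.
  apply: tri_deg_homotopic => //; rewrite -E2.
  apply/(tri_assoc qX T2 T); rewrite -[src a]tgt_deg E3'; exact: tri_adeg.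
have ic2 : invertible_edge c.
  apply/(ho_invertible_tri qX); exists a; split.
    by rewrite -E2'.
  by rewrite -E3' tgt_deg.
have [Hs Ht] := homotopic_ends H; rewrite Hs Ht in ic2.
by apply: ho_invertible_hoeq ic2; apply: hoeq_sym; apply: homotopic_hoeq.
Qed.

Lemma ho_invertible_edge x y (c : X 1) : src c = x -> tgt c = y ->
  ho_invertible x y [:: c] -> invertible_edge c.
Proof. by move=> <- <-. Qed.

Lemma invertible_edge_left (a : X 1) : invertible_edge a ->
  exists s : X 2, face ord_max s = a /\ face i1 s = deg 1 (src a).
Proof. by move=> /(ho_invertible_tri qX)[b [[s [s2 s0 s1]] _]]; exists s. Qed.

End Edges.

Lemma is_power_eq (C : sCat) (X : sSet) (B P : C) (u : smap X (hom P B)) (A : C) n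
    (s t : hom A P n) : is_power u ->
  (forall m (x : X m) (a : Delta n m), comp (u m x) (act (a : mono m n) s) =
     comp (u m x) (act (a : mono m n) t)) -> s = t.
Proof.
move=> uP E.
have hP m l (b : mono m l) (xa : sprod X (Delta n) l) :
    comp (u m (act b xa).1) (act ((act b xa).2 : mono m n) s) =
    act b (comp (u l xa.1) (act (xa.2 : mono l n) s)).
  by rewrite comp_act smap_nat act_comp.
have [w [_ U]] := uP A n (@SMap (sprod X (Delta n)) (hom A B)
  (fun m xa => comp (u m xa.1) (act (xa.2 : mono m n) s)) hP).
by rewrite -(U s) // -(U t).
Qed.

Section Cosmos.
Variable K : cosmos.

Lemma hom_qcat (A B : K) : quasi_category (hom A B).
Proof. exact: (cosmos_qcat (cosmosP K)). Qed.

Lemma isofibration_inner (X A B : K) (f : arr A B) :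
  isofibration f -> inner_fibration (hom_post X f).
Proof. by move=> fi; have [H _] := isof_hom (cosmosP K) fi X. Qed.

Lemma src_postc (X A B : K) (g : arr A B) (a : hom X A 1) :
  src (postc g a) = comp g (src a).
Proof. by rewrite -[postc g a]/(hom_post X g 1 a) src_map /= postc0. Qed.

Lemma tgt_postc (X A B : K) (g : arr A B) (a : hom X A 1) :
  tgt (postc g a) = comp g (tgt a).
Proof. by rewrite -[postc g a]/(hom_post X g 1 a) tgt_map /= postc0. Qed.

Lemma src_prec (W X A : K) (a : hom X A 1) (g : arr W X) :
  src (prec a g) = comp (src a) g.
Proof. by rewrite -[prec a g]/(hom_pre A g 1 a) src_map /= prec0. Qed.

Lemma tgt_prec (W X A : K) (a : hom X A 1) (g : arr W X) :
  tgt (prec a g) = comp (tgt a) g.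
Proof. by rewrite -[prec a g]/(hom_pre A g 1 a) tgt_map /= prec0. Qed.

Lemma postc_deg (X A B : K) (g : arr A B) n (x : arr X A) :
  postc g (deg n x) = deg n (comp g x).
Proof. by rewrite -[postc g _]/(hom_post X g n _) deg_map /= postc0. Qed.

Lemma face_postc (X A B : K) (g : arr A B) n k (s : hom X A n.+1) :
  face k (postc g s) = postc g (face k s).
Proof. by rewrite /face -postc_act. Qed.

(** A path is replaced by one edge, and [left_inverse_invertible] is applied to the class of edges
    invertible on all legs; a left inverse of an invertible edge is invertible, so it stays in the
    class. *)
Lemma conservative_edges (I : Type) (L : K) (A : I -> K) (l : forall i, arr L (A i)) :
  (forall (X : K) (a : hom X L 1), (forall i, invertible_edge (postc (l i) a)) ->
     exists s : hom X L 2, face ord_max s = a /\ face i1 s = deg 1 (src a)) ->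
  conservative_cone l.
Proof.
move=> H X x y s ps Hs.
have [c [Ec Ec' Hc]] := path_edge_ex (@hom_qcat X L) ps.
apply: ho_invertible_hoeq (hoeq_sym Hc) _.
rewrite -Ec -Ec'.
apply: (@left_inverse_invertible _ (@hom_qcat X L)
  (fun a => forall i, invertible_edge (postc (l i) a))).
  move=> a Ha; have [t [t2 t1]] := H X a Ha.
  have T : tri a (face ord0 t) (deg 1 (src a)) by exists t.
  exists (face ord0 t); split=> // i.
  apply: (@left_inverse_of_invertible _ (@hom_qcat X (A i))) (Ha i) _.
  by have := tri_map (hom_post X (l i)) T; rewrite /= postc_deg src_postc.
move=> i; rewrite src_postc tgt_postc Ec Ec'.
exact: ho_invertible_hoeq (wl_hoeq (l i) Hc) (Hs i).
Qed.

Definition jointly_monic (I : Type) (L : K) (A : I -> K) (l : forall i, arr L (A i)) :=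
  forall (X : K) n (s t : hom X L n),
    (forall i, postc (l i) s = postc (l i) t) -> s = t.

Lemma conservative_lifts (I : Type) (L : K) (A : I -> K) (l : forall i, arr L (A i)) :
  jointly_monic l ->
  (forall (X : K) (a : hom X L 1), (forall i, invertible_edge (postc (l i) a)) ->
     exists s : hom X L 2, forall i, face ord_max (postc (l i) s) = postc (l i) a /\
       face i1 (postc (l i) s) = deg 1 (src (postc (l i) a))) ->
  conservative_cone l.
Proof.
move=> jm H; apply: conservative_edges => X a Ha.
have [s Hs] := H X a Ha; exists s; split; apply: jm => i; have [H1 H2] := Hs i.
  by rewrite -face_postc.
by rewrite -face_postc H2 postc_deg src_postc.
Qed.

Lemma product_monic (I : smallType) (A : I -> K) (P : K) (pr : forall i, arr P (A i)) :
  is_product pr -> jointly_monic pr.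
Proof.
move=> H X n s t E; have [w [_ U]] := H X n (fun i => postc (pr i) s).
by rewrite -(U s) // -(U t).
Qed.

Lemma product_conservative (I : smallType) (A : I -> K) (P : K) (pr : forall i, arr P (A i)) :
  is_product pr -> conservative_cone pr.
Proof.
move=> H; apply: conservative_lifts; first exact: product_monic.
move=> X a Ha.
have s_ i := cid (@invertible_edge_left _ (@hom_qcat X (A i)) _ (Ha i)).
have [s [Hs _]] := H X 2 (fun i => sval (s_ i)).
by exists s => i; rewrite Hs; apply: svalP (s_ i).
Qed.

Definition leg (A D : K) (b : bool) : K := if b then A else D.
Definition legs (A D Q : K) (q1 : arr Q A) (q2 : arr Q D) (b : bool) : arr Q (leg A D b) :=
  if b return arr Q (leg A D b) then q1 else q2.

Lemma pullback_monic (A B D : K) (f : arr A B) (g : arr D B) (Q : K)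
  (q1 : arr Q A) (q2 : arr Q D) : is_pullback f g q1 q2 -> jointly_monic (legs q1 q2).
Proof.
move=> [sq H] X n s t E.
have [|w [_ U]] := H X n (postc q1 s) (postc q2 s); first by rewrite !postcA sq.
rewrite -(U s) // -(U t) //; by split; [rewrite (E true) | rewrite (E false)].
Qed.

(** The triangle is chosen over [D], pushed to [B], and lifted to [A] along the isofibration. *)
Lemma pullback_conservative (A B D : K) (f : arr A B) (g : arr D B) (Q : K)
  (q1 : arr Q A) (q2 : arr Q D) : isofibration f -> is_pullback f g q1 q2 ->
  conservative_cone (legs q1 q2).
Proof.
move=> fi H; have [sq U] := H; apply: conservative_lifts; first exact: pullback_monic H.
move=> X a Ha.
have [s2 [s2a s2b]] := @invertible_edge_left _ (@hom_qcat X D) _ (Ha false).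
have Eg : postc g (postc q2 a) = postc f (postc q1 a) by rewrite !postcA sq.
have [||s1 [s1a s1b s1c]] := left_inverse_lift (s := postc g s2) (@hom_qcat X A) (@hom_qcat X B)
  (isofibration_inner (X := X) fi) (Ha true).
- by rewrite face_postc s2a.
- by rewrite face_postc s2b postc_deg -src_postc Eg.
have [s [[Es1 Es2] _]] := U X 2 s1 s2 s1c.
by exists s => -[] /=; rewrite ?Es1 ?Es2.
Qed.

Lemma chain_monic (A : nat -> K) (p : forall k, arr (A k.+1) (A k)) (L : K)
  (l : forall k, arr L (A k)) : is_chain_limit p l -> jointly_monic l.
Proof.
move=> [sq H] X n s t E.
have [|w [_ U]] := H X n (fun k => postc (l k) s); first by move=> k; rewrite postcA sq.
by rewrite -(U s) // -(U t).
Qed.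

(** Dependent choice along a tower, each stage lying over the previous one. *)
Lemma tower_choice (T : nat -> Type) (Q : forall k, T k -> Prop)
    (R : forall k, T k -> T k.+1 -> Prop) :
  (exists x : T 0, Q 0 x) ->
  (forall k (x : T k), Q k x -> exists y : T k.+1, Q k.+1 y /\ R k x y) ->
  exists s : forall k, T k, forall k, Q k (s k) /\ R k (s k) (s k.+1).
Proof.
move=> H0 H.
have nxt k (x : {x : T k | Q k x}) := cid (H k (sval x) (svalP x)).
pose s := fix s k : {x : T k | Q k x} := match k with
  | 0 => exist _ (sval (cid H0)) (svalP (cid H0))
  | k.+1 => exist _ (sval (nxt k (s k))) (proj1 (svalP (nxt k (s k))))
  end.
exists (fun k => sval (s k)) => k; split; first exact: svalP.
exact: (proj2 (svalP (nxt k (s k)))).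
Qed.

Lemma chain_conservative (A : nat -> K) (p : forall k, arr (A k.+1) (A k)) (L : K)
  (l : forall k, arr L (A k)) : (forall k, isofibration (p k)) ->
  is_chain_limit p l -> conservative_cone l.
Proof.
move=> pi H; have [sq U] := H; apply: conservative_lifts; first exact: chain_monic H.
move=> X a Ha.
have [||s Hs] := @tower_choice (fun k => hom X (A k) 2 : Type)
  (fun k s => face ord_max s = postc (l k) a /\ face i1 s = deg 1 (src (postc (l k) a)))
  (fun k s t => postc (p k) t = s).
- exact: (@invertible_edge_left _ (@hom_qcat X (A 0)) _ (Ha 0)).
- move=> k s [s2 s1].
  have Ep : postc (p k) (postc (l k.+1) a) = postc (l k) a by rewrite postcA sq.
  have [||t [t2 t1 tE]] := left_inverse_lift (s := s) (@hom_qcat X (A k.+1)) (@hom_qcat X (A k))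
    (isofibration_inner (X := X) (pi k)) (Ha k.+1).
  + by rewrite s2 -Ep.
  + by rewrite s1 -Ep.
  by exists t.
have [|t [Ht _]] := U X 2 s; first by move=> k; case: (Hs k).
by exists t => k; rewrite Ht; case: (Hs k).
Qed.

(** The vertices of [X] do not separate simplices of the power, so triangles cannot be chosen leg by
    leg. Instead [a] and an identity define a map on [X] times the horn at 0 whose initial edges are
    invertible; its extension to [X] times [Delta 2] is the required 2-simplex. *)
Lemma power_conservative (X : sSet) (B P : K) (u : smap X (hom P B)) :
  is_power u -> conservative_cone (fun x : X 0 => u 0 x : arr P B).
Proof.
move=> H; apply: conservative_edges => A a Ha.
(* ret collapses the horn onto the edge from 0 to 1, on which phi0 is a. *)
pose ret m (c : Delta 2 m) : mono m 1 :=
  if `[< forall i, (c : mono m 2) i <> ord_max >] then mono_comp (mono_step 2 1) (c : mono m 2)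
  else mono_cst m ord0.
pose phi0 m (s : sprod X (Delta 2) m) : hom A B m := comp (u m s.1) (act (ret m s.2) a).
have ret2 m (c : Delta 2 m) : (forall i, (c : mono m 2) i <> ord_max) ->
    ret m c = mono_comp (mono_step 2 1) (c : mono m 2).
  by move=> h; rewrite /ret asboolT.
have ret1 m (c : Delta 2 m) : (forall i, (c : mono m 2) i <> i1) -> ret m c = mono_cst m ord0.
  move=> h; rewrite /ret; case: asboolP => // h'; apply: mono_eq => i /=.
  have := h i; have := h' i; case: ((c : mono m 2) i) => [[|[|[|?]]] Hi] // h1 h2.
    by case: h2; apply: val_inj.
  by case: h1; apply: val_inj.
have hornE m (c : Delta 2 m) : in_horn ord0 c ->
    (forall i, (c : mono m 2) i <> ord_max) \/ (forall i, (c : mono m 2) i <> i1).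
  case=> -[[|[|[|j]]] Hj] [j0 hj] //; first by case: j0; apply: val_inj.
    by right=> i E; apply: (hj i); rewrite E; apply: val_inj.
  by left=> i E; apply: (hj i); rewrite E; apply: val_inj.
have phi0_nat m p (b : mono m p) (s : sprod X (Delta 2) p) : horn_part s ->
    phi0 m (act b s) = act b (phi0 p s).
  move=> /hornE Hs; rewrite /phi0 comp_act smap_nat act_comp; congr (comp _ (act _ _)).
  by case: Hs => h; [rewrite !ret2 | rewrite !ret1] => // i; apply: h.
have phi0_edge y : initial_edge phi0 y = postc (u 0 y) a.
  rewrite /initial_edge /phi0 /postc deg_map; congr comp.
  rewrite /= ret2; last first.
    by move=> i /(congr1 val) /=; rewrite inordK; have := ltn_ord i; case: (i : nat) => [|[|]].
  rewrite -[RHS](act_id (s := hom A P)); congr act; apply: mono_eq.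
  by elim/ord2P; apply: val_inj => /=; rewrite inordK.
have [|h Hh] := @skeleton_fill X (hom A B) phi0 (@hom_qcat A B) phi0_nat.
  by move=> y; rewrite phi0_edge.
have [s [Hs _]] := H A 2 h.
exists s; split; apply: (is_power_eq H) => m x c.
- rewrite /face act_comp -(Hs m x (mono_comp (mono_face ord_max) (c : mono m 1))) Hh; last first.
    by exists ord_max; split=> // i /(congr1 val) /=; rewrite /bump;
      case: (nat_of_ord _) (ltn_ord ((c : mono m 1) i)) => [|[|]].
  rewrite /phi0 ret2; last first.
    by move=> i /(congr1 val) /=; rewrite /bump;
      case: (nat_of_ord _) (ltn_ord ((c : mono m 1) i)) => [|[|]].
  congr (comp _ (act _ _)); apply: mono_eq => i; apply: val_inj => /=.
  by case: ((c : mono m 1) i) => [[|[|?]] ?].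
- rewrite /face act_comp -(Hs m x (mono_comp (mono_face i1) (c : mono m 1))) Hh; last first.
    by exists i1; split=> // i /eqP /=; rewrite eq_sym (negPf (neq_lift _ _)).
  rewrite /phi0 ret1; last first.
    by move=> i /eqP /=; rewrite eq_sym (negPf (neq_lift _ _)).
  by rewrite deg_act; congr (comp _ _); rewrite /deg /src /vertex act_comp; congr act;
    apply: mono_eq.
Qed.

End Cosmos.

Section Steps.
Variable K : cosmos.

Lemma iso_edge_src : src iso_edge = (fun _ => false).
Proof. by apply/funext => i; rewrite /src /vertex /= /iso_edge. Qed.

(** Isofibrations lift against [iso_point], so the edge is first extended to [Iso]; the lift is
    again a map from [Iso], which is why the lifted edge is invertible. *)
Lemma invertible_lift (X A B : K) (f : arr A B) (x : arr X A) (c : hom X B 1) :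
  isofibration f -> comp f x = src c -> invertible_edge c ->
  exists z : hom X A 1, [/\ src z = x, postc f z = c & invertible_edge z].
Proof.
move=> fi E ic; have [w Ew] := invertible_iso (@hom_qcat K X B) ic.
have [_ Hf] := isof_hom (cosmosP K) fi X.
have [|W [W1 W2]] := Hf false (simplex_map x) w.
  move=> n a /=.
  have -> : act (a : mono n 0) x = deg n x.
    by rewrite /deg; congr act; apply: mono_eq => i; rewrite !ord1.
  rewrite postc_deg E -Ew -[w 1 _]/(w 1 iso_edge) src_map iso_edge_src -deg_map.
  by congr (w n _); apply/funext.
exists (W 1 iso_edge); split.
- rewrite src_map iso_edge_src.
  have := W1 0 (mono_id 0 : Delta 0 0); rewrite /= act_id => <-.
  by congr (W 0 _); apply/funext.
- by rewrite -[postc f _]/(hom_post X f 1 _) W2.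
- exact: iso_edge_invertible.
Qed.

Lemma edge_lift (X A B : K) (f : arr A B) (x y : arr X A) s (c : hom X B 1) :
  isofibration f -> is_path x s y ->
  hoeq (comp f x) (comp f y) (whiskerl f s) [:: c] ->
  exists d : hom X A 1, hoeq x y s [:: d] /\ postc f d = c.
Proof.
move=> fi ps H; have [d0 [E1 E2 Hd]] := path_edge_ex (@hom_qcat K X A) ps.
have H' : homotopic (postc f d0) c.
  apply: (hoeq_homotopic (@hom_qcat K X B)) (hoeq_trans (hoeq_sym (wl_hoeq f Hd)) H).
have [d [Hdd Ed]] := homotopy_lift (isofibration_inner (X := X) fi) H'.
exists d; split=> //; apply: hoeq_trans Hd _.
exact: homotopic_hoeq.
Qed.

Section Square.
Variables (EA BA EB BB : K) (pA : arr EA BA) (pB : arr EB BB)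
  (e : arr EA EB) (b : arr BA BB).
Hypotheses (sq : comp pB e = comp b pA) (eF : isofibration e) (bF : isofibration b)
  (lA : is_left_adjoint pA) (lB : is_left_adjoint pB)
  (M : left_adjoint_morphism pA pB e b).

Lemma square_whisker (X : K) (x : arr X EA) : comp pB (comp e x) = comp b (comp pA x).
Proof. by rewrite compA sq -compA. Qed.

(** Some lifting of [a] along [pA] exists, and [e] carries it to one isomorphic to [r]. Lifting this
    isomorphism to an edge [d] gives [r'] strictly over [r]; the counit transported along the
    inverse of [d] lies over [eps] up to homotopy, which [edge_lift] removes. *)
Lemma lifting_step (X : K) (a : arr X BA) (r : arr X EB) (eps : hom X BB 1) :
  lifting pB (comp b a) r [:: eps] ->
  exists (r' : arr X EA) (eps' : hom X BA 1),
    [/\ lifting pA a r' [:: eps'], comp e r' = r & postc b eps' = eps].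
Proof.
move=> L; have /left_adjointP[rA [epsA LA]] := lA.
have L0 := lifting_whisker a LA; rewrite id0l in L0.
have L1 := left_adjoint_morphism_lifting sq lA lB M L0.
have [z [pz Hz]] := lifting_compare L1 L.
have iz := lifting_compare_invertible L1 L pz Hz.
have [c [Ec Ec' Hc]] := path_edge_ex (@hom_qcat K X EB) pz.
have ic : invertible_edge c by apply: ho_invertible_edge Ec Ec' (ho_invertible_hoeq Hc iz).
have [d [Ed Fd id_]] := invertible_lift eF (esym Ec) ic.
have Ed' : comp e (tgt d) = r by rewrite -tgt_postc Fd.
have [d' [id' dd' d'd]] := ho_invertible_inv id_; have [pd' _] := id'.
have [p0 _ _] := L0; rewrite -Ed in p0 L0 Hz Hc pz.
have pe1 : is_path (comp pA (tgt d)) (whiskerl pA d' ++ whiskerr epsA a) a.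
  exact: path_cat (wl_path pA pd') p0.
have L2 : lifting pA a (tgt d) (whiskerl pA d' ++ whiskerr epsA a).
  apply: (lifting_iso L0 id_ pe1); rewrite catA -wl_cat -[X in hoeq _ _ _ X]cat0s.
  exact: hoeq_catr (wl_hoeq pA dd') p0.
have [pe _ _] := L.
have H : hoeq (comp b (comp pA (tgt d))) (comp b a)
    (whiskerl b (whiskerl pA d' ++ whiskerr epsA a)) [:: eps].
  have cd' := wl_hoeq e d'd; rewrite Ed' in cd'.
  have pd'e := wl_path e pd'; rewrite Ed' in pd'e.
  rewrite wl_cat wlA -sq -wlA -square_whisker Ed'.
  apply: hoeq_trans (hoeq_catl (wl_path pB pd'e) (hoeq_sym Hz)) _.
  rewrite catA -wl_cat -[X in hoeq _ _ _ X]cat0s; apply: hoeq_catr pe.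
  have -> : [::] = whiskerl pB (whiskerl e [::] : seq (hom X EB 1)) by [].
  apply: wl_hoeq; apply: hoeq_trans cd'; rewrite wl_cat /= Fd.
  exact: hoeq_catl pd'e Hc.
have [eps' [He Ee]] := edge_lift bF pe1 H.
by exists (tgt d), eps'; split=> //; apply: lifting_hoeq L2 He.
Qed.

(** Existence in the lifting along [pA] gives a unit, uniqueness in the lifting along [pB]
    identifies its image with [etaB] up to homotopy, and [edge_lift] makes this strict. *)
Lemma unit_step (X Y : K) (a : arr X BA) (r : arr X EA) (eps : seq (hom X BA 1))
    (q : arr Y X) (k : arr Y EA) (etaB : hom Y EB 1) :
  lifting pA a r eps -> comp pA k = comp a q ->
  src etaB = comp e k -> tgt etaB = comp e (comp r q) ->
  hoeq (comp pB (comp e k)) (comp (comp b a) q)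
    (whiskerl pB [:: etaB] ++ whiskerr (whiskerl b eps) q) [::] ->
  exists eta : hom Y EA 1, [/\ src eta = k, tgt eta = comp r q,
    hoeq (comp pA k) (comp a q) (whiskerl pA [:: eta] ++ whiskerr eps q) [::] &
    postc e eta = etaB].
Proof.
move=> L Ek Es Et HB; have [pe ex un] := L.
have LB := left_adjoint_morphism_lifting sq lA lB M L; have [peB _ unB] := LB.
have [|phi [pphi Hphi]] := ex Y q k [::]; first exact: Ek.
have H : hoeq (comp e k) (comp e (comp r q)) (whiskerl e phi) [:: etaB].
  rewrite [comp e (comp r q)]compA; apply: unB.
  - by rewrite -compA; apply: wl_path.
  - by rewrite /= -compA; split.
  - apply: hoeq_trans (hoeq_sym HB).
    rewrite wlA sq -wlA wr_wl -wl_cat square_whisker -compA.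
    exact: (wl_hoeq b Hphi).
have [eta [He Ee]] := edge_lift eF pphi H.
have [Es' Et'] := hoeq_right He.
exists eta; split=> //.
apply: hoeq_trans Hphi; apply: hoeq_sym; apply: hoeq_catr (wl_hoeq pA He) _.
rewrite compA; exact: wr_path.
Qed.

Lemma unit_push (X Y : K) (a : arr X BA) (eps : seq (hom X BA 1))
    (q : arr Y X) (k : arr Y EA) (eta : hom Y EA 1) :
  hoeq (comp pA k) (comp a q) (whiskerl pA [:: eta] ++ whiskerr eps q) [::] ->
  hoeq (comp pB (comp e k)) (comp (comp b a) q)
    (whiskerl pB [:: postc e eta] ++ whiskerr (whiskerl b eps) q) [::].
Proof.
move=> H; rewrite -[whiskerl pB _]/(whiskerl pB (whiskerl e [:: eta])).
rewrite wlA sq -wlA wr_wl -wl_cat square_whisker -compA.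
exact: (wl_hoeq b H).
Qed.

End Square.

Lemma unit_exists (E B X Y : K) (p : arr E B) (a : arr X B) (r : arr X E) eps
    (q : arr Y X) (k : arr Y E) :
  lifting p a r eps -> comp p k = comp a q ->
  exists eta : hom Y E 1, [/\ src eta = k, tgt eta = comp r q &
    hoeq (comp p k) (comp a q) (whiskerl p [:: eta] ++ whiskerr eps q) [::]].
Proof.
move=> [pe ex _] Ek; have [|phi [pphi Hphi]] := ex Y q k [::]; first exact: Ek.
have [eta [Es Et He]] := path_edge_ex (@hom_qcat K Y E) pphi.
exists eta; split=> //; apply: hoeq_trans Hphi; apply: hoeq_sym.
by apply: hoeq_catr (wl_hoeq p He) _; rewrite compA; apply: wr_path.
Qed.

Lemma lifting_exists (E B X : K) (p : arr E B) (a : arr X B) : is_left_adjoint p ->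
  exists (r : arr X E) (eps : hom X B 1), lifting p a r [:: eps].
Proof.
move=> /left_adjointP[r [eps L]].
have := lifting_whisker a L; rewrite id0l => La; have [pe _ _] := La.
have [c [_ _ Hc]] := path_edge_ex (@hom_qcat K X B) pe.
by exists (comp r a), c; apply: lifting_hoeq La Hc.
Qed.

Section ConeAdjoint.
Variables (I : Type) (E B : K) (Ei Bi : I -> K) (p : arr E B)
  (pi : forall i, arr (Ei i) (Bi i)) (k : forall i, arr E (Ei i))
  (l : forall i, arr B (Bi i)).
Hypothesis sq : forall i, comp (pi i) (k i) = comp (l i) p.
Hypotheses (kC : conservative_cone k) (lC : conservative_cone l).
Variables (r : arr B E) (eps : hom B B 1) (eta : hom E E 1)
    (ri : forall i, arr B (Ei i)) (epsi : forall i, hom B (Bi i) 1)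
    (etai : forall i, hom E (Ei i) 1).
Hypotheses (Er : forall i, comp (k i) r = ri i) (Ee : forall i, postc (l i) eps = epsi i)
  (En : forall i, postc (k i) eta = etai i)
  (Li : forall i, lifting (pi i) (l i) (ri i) [:: epsi i])
  (Hn : forall i, [/\ src (etai i) = k i, tgt (etai i) = comp (ri i) p &
    hoeq (comp (pi i) (k i)) (comp (l i) p)
      (whiskerl (pi i) [:: etai i] ++ whiskerr [:: epsi i] p) [::]]).

(** The endpoints are premises for the sake of powers, whose legs at vertices need not be jointly
    monic; [cone_adjoint] derives them when the legs are. *)
Lemma cone_adjoint_ends :
  src eps = comp p r -> tgt eps = id0 B -> src eta = id0 E -> tgt eta = comp r p ->
  lifting p (id0 B) r [:: eps] /\
  forall i, lifting (pi i) (l i) (comp (k i) r) (whiskerl (l i) [:: eps]).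
Proof.
move=> e1 e2 e3 e4.
have Li' i : lifting (pi i) (l i) (comp (k i) r) (whiskerl (l i) [:: eps]).
  by rewrite Er /= Ee; apply: Li.
split=> //; apply: (cone_lifting (eta := [:: eta]) sq kC lC _ Li') => //.
move=> i; have [_ _ H] := Hn i; rewrite sq in H.
by rewrite wl_cat -wr_wl wlA -sq -wlA /= En Ee sq; apply: H.
Qed.

Lemma cone_adjoint : jointly_monic k -> jointly_monic l ->
  lifting p (id0 B) r [:: eps] /\
  forall i, lifting (pi i) (l i) (comp (k i) r) (whiskerl (l i) [:: eps]).
Proof.
move=> kM lM; apply: cone_adjoint_ends.
- apply: lM => i; rewrite !postc0 -src_postc Ee.
  have [[Es _] _ _] := Li i.
  by rewrite -[src _]/(vertex _ _) Es -Er compA sq -compA.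
- apply: lM => i; rewrite !postc0 -tgt_postc Ee id0r.
  by have [[_ Et] _ _] := Li i.
- apply: kM => i; rewrite !postc0 -src_postc En id0r.
  by have [] := Hn i.
- apply: kM => i; rewrite !postc0 -tgt_postc En compA Er.
  by have [] := Hn i.
Qed.

End ConeAdjoint.

End Steps.

(** * Limits and gap maps *)

Section Generic.
Variable C : sCat.

Lemma is_iso_id (A : C) : is_iso (id0 A).
Proof. by exists (id0 A); rewrite id0l. Qed.

Lemma pullback_arr (A B D : C) (f : arr A B) (g : arr D B) (Q : C)
    (q1 : arr Q A) (q2 : arr Q D) (X : C) (s : arr X A) (t : arr X D) :
  is_pullback f g q1 q2 -> comp f s = comp g t ->
  exists u, comp q1 u = s /\ comp q2 u = t.
Proof.
move=> [_ H] E; have [|u [[E1 E2] _]] := H X 0 s t; first by rewrite !postc0.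
by exists u; rewrite -!postc0.
Qed.

Lemma pullback_eq (A B D : C) (f : arr A B) (g : arr D B) (Q : C)
    (q1 : arr Q A) (q2 : arr Q D) (X : C) n (s t : hom X Q n) :
  is_pullback f g q1 q2 -> postc q1 s = postc q1 t -> postc q2 s = postc q2 t ->
  s = t.
Proof.
move=> [sq H] E1 E2.
have [|w [_ U]] := H X n (postc q1 s) (postc q2 s); first by rewrite !postcA sq.
by rewrite -(U s) // -(U t).
Qed.

Lemma pullback_arr_eq (A B D : C) (f : arr A B) (g : arr D B) (Q : C)
    (q1 : arr Q A) (q2 : arr Q D) (X : C) (s t : arr X Q) :
  is_pullback f g q1 q2 -> comp q1 s = comp q1 t -> comp q2 s = comp q2 t ->
  s = t.
Proof. by move=> H E1 E2; apply: (pullback_eq H); rewrite !postc0. Qed.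

Lemma is_pullbackI (A B D : C) (f : arr A B) (g : arr D B) (Q : C)
    (q1 : arr Q A) (q2 : arr Q D) :
  comp f q1 = comp g q2 ->
  (forall (X : C) n (s : hom X A n) (t : hom X D n), postc f s = postc g t ->
     exists u : hom X Q n, postc q1 u = s /\ postc q2 u = t) ->
  (forall (X : C) n (s t : hom X Q n),
     postc q1 s = postc q1 t -> postc q2 s = postc q2 t -> s = t) ->
  is_pullback f g q1 q2.
Proof.
move=> sq ex un; split=> // X n s t E; have [u [E1 E2]] := ex X n s t E.
exists u; split=> // u' [E1' E2']; apply: un; congruence.
Qed.

(** The closure axioms quantify over arbitrary limit cones, whereas limits will be built in one
    particular way. Uniqueness up to isomorphism and transport along isomorphisms bridge the two. *)
Lemma iso_terminal (T T' : C) : is_terminal T -> is_terminal T' ->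
  exists i : arr T' T, is_iso i.
Proof.
move=> H H'; have [i [_ _]] := H T' 0; have [j [_ _]] := H' T 0.
have U (S : C) (f g : arr S S) : is_terminal S -> f = g.
  by move=> hS; have [h [_ Uh]] := hS S 0; rewrite -(Uh f) // -(Uh g).
by exists i, j; split; apply: U.
Qed.

Lemma iso_product (I : smallType) (A : I -> C) (P P' : C)
  (pr : forall i, arr P (A i)) (pr' : forall i, arr P' (A i)) :
  is_product pr -> is_product pr' ->
  exists i : arr P' P, is_iso i /\ forall j, comp (pr j) i = pr' j.
Proof.
move=> H H'; have [i [Hi _]] := H P' 0 pr'; have [i' [Hi' _]] := H' P 0 pr.
exists i; split; last by move=> j; rewrite -postc0.
exists i'; split.
  have [w [_ U]] := H' P' 0 pr'; rewrite -(U (id0 P')); last by move=> j; rewrite postc0 id0r.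
  by rewrite -(U (comp i' i)) // => j; rewrite postc0 compA -[comp (pr' j) i']postc0 Hi' -postc0.
have [w [_ U]] := H P 0 pr; rewrite -(U (id0 P)); last by move=> j; rewrite postc0 id0r.
by rewrite -(U (comp i i')) // => j; rewrite postc0 compA -[comp (pr j) i]postc0 Hi -postc0.
Qed.

Lemma product_iso (I : smallType) (A : I -> C) (P P' : C)
  (pr : forall i, arr P (A i)) (pr' : forall i, arr P' (A i)) (i : arr P' P) :
  is_product pr -> is_iso i -> (forall j, comp (pr j) i = pr' j) -> is_product pr'.
Proof.
move=> H [i' [E1 E2]] E X n s; have [t [Ht U]] := H X n s.
exists (postc i' t); split=> [j|t' Ht'].
  by rewrite postcA -E -compA E2 id0r.
rewrite (U (postc i t')); first by rewrite postcA E1 postc1.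
by move=> j; rewrite postcA E.
Qed.

Lemma iso_pullback (A B D : C) (f : arr A B) (g : arr D B) (Q Q' : C)
  (q1 : arr Q A) (q2 : arr Q D) (q1' : arr Q' A) (q2' : arr Q' D) :
  is_pullback f g q1 q2 -> is_pullback f g q1' q2' ->
  exists i : arr Q' Q, [/\ is_iso i, comp q1 i = q1' & comp q2 i = q2'].
Proof.
move=> H H'; have [i [E1 E2]] := pullback_arr H (proj1 H').
have [j [F1 F2]] := pullback_arr H' (proj1 H).
exists i; split=> //; exists j; split.
  by apply: (pullback_arr_eq H'); rewrite compA ?F1 ?F2 ?E1 ?E2 id0r.
by apply: (pullback_arr_eq H); rewrite compA ?E1 ?E2 ?F1 ?F2 id0r.
Qed.

Lemma pullback_iso (A B D : C) (f : arr A B) (g : arr D B) (Q Q' : C)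
  (q1 : arr Q A) (q2 : arr Q D) (q1' : arr Q' A) (q2' : arr Q' D) (i : arr Q' Q) :
  is_pullback f g q1 q2 -> is_iso i -> comp q1 i = q1' -> comp q2 i = q2' ->
  is_pullback f g q1' q2'.
Proof.
move=> H [j [F1 F2]] E1 E2; apply: is_pullbackI.
- by rewrite -E1 -E2 !compA (proj1 H).
- move=> X n s t E; have [u [[U1 U2] _]] := proj2 H X n s t E.
  exists (postc j u); rewrite -E1 -E2 !postcA.
  by rewrite -[comp (comp q1 i) j]compA -[comp (comp q2 i) j]compA F2 !id0r.
- move=> X n s t; rewrite -E1 -E2 -!postcA => E3 E4.
  have := pullback_eq H E3 E4 => /(congr1 (postc j)).
  by rewrite !postcA F1 !postc1.
Qed.

Lemma iso_chain (A : nat -> C) (p : forall k, arr (A k.+1) (A k)) (L L' : C)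
  (l : forall k, arr L (A k)) (l' : forall k, arr L' (A k)) :
  is_chain_limit p l -> is_chain_limit p l' ->
  exists i : arr L' L, is_iso i /\ forall k, comp (l k) i = l' k.
Proof.
move=> [sq H] [sq' H'].
have ex (M : C) (m : forall k, arr M (A k)) (N : C) (n : forall k, arr N (A k)) :
    is_chain_limit p m -> is_chain_limit p n -> exists i : arr N M, forall k, comp (m k) i = n k.
  move=> [_ Hm] [sqn _]; have [|i [Hi _]] := Hm N 0 n; first by move=> k; rewrite postc0.
  by exists i => k; rewrite -postc0.
have un (M : C) (m : forall k, arr M (A k)) (N : C) (f g : arr N M) :
    is_chain_limit p m -> (forall k, comp (m k) f = comp (m k) g) -> f = g.
  move=> [sm Hm] E; have [|i [_ U]] := Hm N 0 (fun k => comp (m k) f).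
    by move=> k; rewrite postc0 compA sm.
  have Uf : i = f by apply: U => k; rewrite postc0.
  have <- // : i = g by apply: U => k; rewrite postc0 E.
have [i Hi] := ex _ _ _ _ (conj sq H) (conj sq' H').
have [j Hj] := ex _ _ _ _ (conj sq' H') (conj sq H).
exists i; split=> //; exists j; split.
  by apply: (un _ _ _ _ _ (conj sq' H')) => k; rewrite compA Hj Hi id0r.
by apply: (un _ _ _ _ _ (conj sq H)) => k; rewrite compA Hi Hj id0r.
Qed.

Section Power.
Variables (X : sSet) (B P : C) (u : smap X (hom P B)).
Hypothesis uP : is_power u.

Lemma act0 (Y : sSet) m (a : mono m 0) (y : Y 0) : act a y = deg m y.
Proof. by rewrite /deg; congr act; apply: mono_eq => i; rewrite !ord1. Qed.

Lemma power_arr_eq (A : C) (f g : arr A P) :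
  (forall m (x : X m), prec (u m x) f = prec (u m x) g) -> f = g.
Proof. by move=> E; apply: (is_power_eq uP) => m x a; rewrite !act0; apply: E. Qed.

Lemma power_arr (A : C) (v : smap X (hom A B)) :
  exists f : arr A P, forall m (x : X m), prec (u m x) f = v m x.
Proof.
have [t [Ht _]] := uP (@SMap (sprod X (Delta 0)) (hom A B)
  (fun m xa => v m xa.1) (fun m n a xa => smap_nat v a xa.1)).
exists t => m x; have /= -> := Ht m x (mono_cst m ord0 : Delta 0 m).
by rewrite act0.
Qed.

End Power.

Lemma iso_power (X : sSet) (B P P' : C) (u : smap X (hom P B)) (u' : smap X (hom P' B)) :
  is_power u -> is_power u' ->
  exists i : arr P' P, is_iso i /\ forall m (x : X m), prec (u m x) i = u' m x.
Proof.
move=> H H'; have [i Hi] := power_arr H u'; have [j Hj] := power_arr H' u.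
exists i; split=> //; exists j; split.
  by apply: (power_arr_eq H') => m x; rewrite -precA Hj Hi prec1.
by apply: (power_arr_eq H) => m x; rewrite -precA Hi Hj prec1.
Qed.

Lemma power_iso (X : sSet) (B P P' : C) (u : smap X (hom P B)) (u' : smap X (hom P' B))
  (i : arr P' P) :
  is_power u -> is_iso i -> (forall m (x : X m), prec (u m x) i = u' m x) -> is_power u'.
Proof.
move=> H [j [E1 E2]] E A n h; have [t [Ht U]] := H A n h.
exists (postc j t); split=> [m x a|t' Ht'].
  rewrite Ht -E /prec /postc comp_act deg_act compA -[comp (comp (u m x) _) _]compA.
  by rewrite -deg_comp E2 compf1.
rewrite (U (postc i t')); first by rewrite postcA E1 postc1.
move=> m x a; rewrite Ht' -E /prec /postc comp_act deg_act compA.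
by [].
Qed.

(** A simplex of a power is a simplicial map from [X] times [Delta n] to a hom, so compatible pairs
    of simplices can be paired pointwise in [Q]. *)
Lemma power_pullback (X : sSet) (A B D Q : C) (f : arr A B) (g : arr D B)
    (q1 : arr Q A) (q2 : arr Q D) (AX BX DX QX : C)
    (uA : smap X (hom AX A)) (uB : smap X (hom BX B)) (uD : smap X (hom DX D))
    (uQ : smap X (hom QX Q)) (fX : arr AX BX) (gX : arr DX BX) (q1X : arr QX AX)
    (q2X : arr QX DX) :
  is_power uA -> is_power uB -> is_power uD -> is_power uQ ->
  (forall m (x : X m), prec (uB m x) fX = postc f (uA m x)) ->
  (forall m (x : X m), prec (uB m x) gX = postc g (uD m x)) ->
  (forall m (x : X m), prec (uA m x) q1X = postc q1 (uQ m x)) ->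
  (forall m (x : X m), prec (uD m x) q2X = postc q2 (uQ m x)) ->
  is_pullback f g q1 q2 -> is_pullback fX gX q1X q2X.
Proof.
move=> pA pB pD pQ Ef Eg E1 E2 H; have [sq U] := H.
have nat (Z : C) n (V V' W W' : C) (v : arr V W) (uV : smap X (hom V' V)) (uW : smap X (hom W' W))
    (vX : arr V' W') (s : hom Z V' n) :
    (forall m (x : X m), prec (uW m x) vX = postc v (uV m x)) ->
    forall m (x : X m) (a : mono m n), comp (uW m x) (act a (postc vX s)) = postc v
      (comp (uV m x) (act a s)).
  move=> Ev m x a; rewrite -postc_act /postc compA -[comp (uW m x) _]/(prec (uW m x) vX) Ev.
  by rewrite /postc compA.
apply: is_pullbackI.
- apply: (power_arr_eq pB) => m x; rewrite -!precA Ef Eg !prec_postc E1 E2.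
  by rewrite !postcA sq.
- move=> Z n s t E.
  have key m (xa : sprod X (Delta n) m) : exists! w : hom Z Q m,
      postc q1 w = comp (uA m xa.1) (act (xa.2 : mono m n) s) /\
      postc q2 w = comp (uD m xa.1) (act (xa.2 : mono m n) t).
    by apply: U; rewrite -(nat _ _ _ _ _ _ f uA uB fX s Ef) -(nat _ _ _ _ _ _ g uD uB gX t Eg) E.
  pose h m xa := sval (cid (key m xa)).
  have h1 m xa : postc q1 (h m xa) = comp (uA m xa.1) (act (xa.2 : mono m n) s).
    by rewrite /h; case: cid => w [[]].
  have h2 m xa : postc q2 (h m xa) = comp (uD m xa.1) (act (xa.2 : mono m n) t).
    by rewrite /h; case: cid => w [[]].
  have hN m l (b : mono m l) (xa : sprod X (Delta n) l) : h m (act b xa) = act b (h l xa).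
    apply: (pullback_eq H); rewrite postc_act ?h1 ?h2 ?comp_act ?smap_nat ?act_comp //.
  have [w [Hw _]] := pQ Z n (@SMap (sprod X (Delta n)) (hom Z Q) h hN).
  exists w; split.
    apply: (is_power_eq pA) => m x a; rewrite (nat _ _ _ _ _ _ q1 uQ uA) // -Hw /= h1 //.
  apply: (is_power_eq pD) => m x a; rewrite (nat _ _ _ _ _ _ q2 uQ uD) // -Hw /= h2 //.
- move=> Z n s t E3 E4; apply: (is_power_eq pQ) => m x a; apply: (pullback_eq H).
    by rewrite -!(nat _ _ _ _ _ _ q1 uQ uA q1X) // E3.
  by rewrite -!(nat _ _ _ _ _ _ q2 uQ uD q2X) // E4.
Qed.

End Generic.

Section Gap.
Variable K : cosmos.
Let C := cosmosP K.

(** The last clause of [Kisof_isofibration], isolated because it is the one whose closure properties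
    need an argument. *)
Definition gap_isofibration (E1 B1 E2 B2 : K) (p1 : arr E1 B1) (p2 : arr E2 B2)
    (e : arr E1 E2) (b : arr B1 B2) : Prop :=
  forall (Q : K) (q1 : arr Q E2) (q2 : arr Q B1) (k : arr E1 Q),
    is_pullback p2 b q1 q2 -> comp q1 k = e -> comp q2 k = p1 -> isofibration k.

Lemma postcE (X A B D D' : K) (f : arr A B) (g : arr B D) (h : arr A D') (k : arr D' D)
  n (s : hom X A n) :
  comp g f = comp k h -> postc g (postc f s) = postc k (postc h s).
Proof. by move=> E; rewrite !postcA E. Qed.

Lemma gap_exists (E1 B1 E2 B2 : K) (p1 : arr E1 B1) (p2 : arr E2 B2)
    (e : arr E1 E2) (b : arr B1 B2) :
  comp p2 e = comp b p1 -> isofibration p2 -> gap_isofibration p1 p2 e b ->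
  exists (Q : K) (q1 : arr Q E2) (q2 : arr Q B1) (k : arr E1 Q),
    [/\ is_pullback p2 b q1 q2, comp q1 k = e, comp q2 k = p1 & isofibration k].
Proof.
move=> sq F G; have [Q [q1 [q2 H]]] := cosmos_pullback C b F.
have [k [E1' E2']] := pullback_arr H sq.
by exists Q, q1, q2, k; split=> //; apply: G H _ _.
Qed.

(** [p1] is its gap map followed by a pullback of [p2]. This is how the projection of a pullback or
    chain limit is seen to be an isofibration. *)
Lemma isofibration_of_gap (E1 B1 E2 B2 : K) (p1 : arr E1 B1) (p2 : arr E2 B2)
    (e : arr E1 E2) (b : arr B1 B2) :
  comp p2 e = comp b p1 -> isofibration p2 -> gap_isofibration p1 p2 e b ->
  isofibration p1.
Proof.
move=> sq F G; have [Q [q1 [q2 [k [H _ <- kF]]]]] := gap_exists sq F G.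
exact: (isof_comp C (isof_pullback C F H) kF).
Qed.

(** The gap map of the leg into [pD] is a pullback, along [m], of the gap map of the square from
    [pA] to [pB]. *)
Lemma gap_pullback (EA BA EB BB ED BD EQ BQ : K)
    (pA : arr EA BA) (pB : arr EB BB) (pD : arr ED BD) (p : arr EQ BQ)
    (ef : arr EA EB) (bf : arr BA BB) (eg : arr ED EB) (bg : arr BD BB)
    (kA : arr EQ EA) (kD : arr EQ ED) (lA : arr BQ BA) (lD : arr BQ BD) :
  comp pB ef = comp bf pA -> comp pB eg = comp bg pD ->
  comp pA kA = comp lA p -> comp pD kD = comp lD p ->
  isofibration pB -> gap_isofibration pA pB ef bf ->
  is_pullback ef eg kA kD -> is_pullback bf bg lA lD ->
  gap_isofibration p pD kD lD.
Proof.
move=> sf sg sA sD pBF G HE HB W w1 w2 k HW Ek1 Ek2.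
have [Q [g1 [g2 [h [HQ Eh1 Eh2 hF]]]]] := gap_exists sf pBF G.
have [m [m1 m2]] : exists m, comp g1 m = comp eg w1 /\ comp g2 m = comp lA w2.
  apply: (pullback_arr HQ).
  by rewrite compA sg -compA (proj1 HW) !compA (proj1 HB).
apply: (isof_pullback C hF (g := m) (q1 := kA)); apply: is_pullbackI.
- apply: (pullback_arr_eq HQ); rewrite !compA ?Eh1 ?Eh2 ?m1 ?m2.
    by rewrite -compA Ek1 (proj1 HE).
  by rewrite -compA Ek2 sA.
- move=> X n s t E.
  have E1 : postc ef s = postc eg (postc w1 t) by rewrite -Eh1 -postcA E !postcA m1.
  have [u [[U1 U2] _]] := proj2 HE X n s (postc w1 t) E1.
  exists u; split=> //; apply: (pullback_eq HW); rewrite postcA ?Ek1 ?Ek2 //.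
  apply: (pullback_eq HB); rewrite !postcA.
    by rewrite -sA -m2 -!postcA U1 -E postcA Eh2.
  by rewrite -sD -(proj1 HW) -!postcA U2.
- move=> X n s t E1 E2; apply: (pullback_eq HE) => //.
  by rewrite -Ek1 -!postcA E2.
Qed.

(** The gap map of the composite is that of the first square followed by a pullback [n] of that of
    the second. *)
Lemma gap_comp (EA BA EB BB ED BD : K)
    (pA : arr EA BA) (pB : arr EB BB) (pD : arr ED BD)
    (ef : arr EA EB) (bf : arr BA BB) (eg : arr EB ED) (bg : arr BB BD) :
  comp pB ef = comp bf pA -> comp pD eg = comp bg pB ->
  isofibration pB -> isofibration pD ->
  gap_isofibration pA pB ef bf -> gap_isofibration pB pD eg bg ->
  gap_isofibration pA pD (comp eg ef) (comp bg bf).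
Proof.
move=> sf sg pBF pDF Gf Gg W w1 w2 c HW Ec1 Ec2.
have [Q1 [g1 [g2 [kg [H1 Eg1 Eg2 kgF]]]]] := gap_exists sg pDF Gg.
have [Q2 [h1 [h2 [kf [H2 Ef1 Ef2 kfF]]]]] := gap_exists sf pBF Gf.
have [m [m1 m2]] : exists m, comp g1 m = w1 /\ comp g2 m = comp bf w2.
  by apply: (pullback_arr H1); rewrite (proj1 HW) compA.
have [n [n1 n2]] : exists n, comp w1 n = comp eg h1 /\ comp w2 n = h2.
  by apply: (pullback_arr HW); rewrite compA sg -compA (proj1 H2) compA.
have nF : isofibration n.
  apply: (isof_pullback C kgF (g := m) (q1 := h1)); apply: is_pullbackI.
  - apply: (pullback_arr_eq H1); rewrite !compA ?Eg1 ?Eg2 ?m1 ?m2 ?n1 //.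
    by rewrite (proj1 H2) -compA n2.
  - move=> X l s t E.
    have E1 : postc pB s = postc bf (postc w2 t) by rewrite -Eg2 -postcA E !postcA m2.
    have [u [[U1 U2] _]] := proj2 H2 X l s (postc w2 t) E1.
    exists u; split=> //; apply: (pullback_eq HW); rewrite postcA ?n1 ?n2 //.
    by rewrite -postcA U1 -Eg1 -postcA E postcA m1.
  - move=> X l s t E1 E2; apply: (pullback_eq H2) => //.
    by rewrite -n2 -!postcA E2.
have -> : c = comp n kf.
  apply: (pullback_arr_eq HW); rewrite compA ?n1 ?n2 ?Ec1 ?Ec2 //.
  by rewrite -compA Ef1.
exact: (isof_comp C nF kfF).
Qed.


Lemma gap_iso (E1 B1 E2 B2 : K) (p1 : arr E1 B1) (p2 : arr E2 B2)
    (e : arr E1 E2) (b : arr B1 B2) :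
  comp p2 e = comp b p1 -> is_iso e -> is_iso b -> gap_isofibration p1 p2 e b.
Proof.
move=> sq [e' [e1 e2]] [b' [b1 b2]] Q q1 q2 k H Ek1 Ek2.
apply: (isof_iso C); exists (comp e' q1); split; first by rewrite -compA Ek1.
apply: (pullback_arr_eq H); rewrite id0r compA.
  by rewrite Ek1 compA e2 id0l.
rewrite Ek2 compA; have -> : comp p1 e' = comp b' p2.
  by rewrite -[LHS]id0l -b1 -compA [comp b (comp p1 _)]compA -sq -compA e2 id0r.
by rewrite -compA (proj1 H) compA b1 id0l.
Qed.

Lemma gap_terminal (E B T : K) (p : arr E B) (e : arr E T) (b : arr B T) :
  is_terminal T -> isofibration p -> gap_isofibration p (id0 T) e b.
Proof.
move=> HT pF Q q1 q2 k H Ek1 Ek2.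
have un (X : K) (f g : arr X T) : f = g.
  by have [h [_ U]] := HT X 0; rewrite -(U f) // -(U g).
have [j [j1 j2]] : exists j, comp q1 j = b /\ comp q2 j = id0 B.
  by apply: (pullback_arr H); apply: un.
have -> : k = comp j p.
  by apply: (pullback_arr_eq H); [apply: un | rewrite compA j2 id0l].
apply: (isof_comp C) pF; apply: (isof_iso C); exists q2; split=> //.
by apply: (pullback_arr_eq H); [apply: un | rewrite compA j2 id0l id0r].
Qed.

(** [W] is the product of the pullbacks of the factors, so the gap map is the product of the gap
    maps. *)
Lemma gap_product (I : smallType) (EA BA EB BB : I -> K) (EP BP EQ BQ : K)
    (pA : forall i, arr (EA i) (BA i)) (pB : forall i, arr (EB i) (BB i))
    (ef : forall i, arr (EA i) (EB i)) (bf : forall i, arr (BA i) (BB i))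
    (pP : arr EP BP) (pQ : arr EQ BQ) (ek : arr EP EQ) (bk : arr BP BQ)
    (kP : forall i, arr EP (EA i)) (lP : forall i, arr BP (BA i))
    (kQ : forall i, arr EQ (EB i)) (lQ : forall i, arr BQ (BB i)) :
  (forall i, comp (pB i) (ef i) = comp (bf i) (pA i)) ->
  (forall i, comp (pA i) (kP i) = comp (lP i) pP) ->
  (forall i, comp (pB i) (kQ i) = comp (lQ i) pQ) ->
  (forall i, comp (kQ i) ek = comp (ef i) (kP i)) ->
  (forall i, comp (lQ i) bk = comp (bf i) (lP i)) ->
  (forall i, isofibration (pB i)) ->
  (forall i, gap_isofibration (pA i) (pB i) (ef i) (bf i)) ->
  is_product kP -> is_product lP -> is_product kQ -> is_product lQ ->
  gap_isofibration pP pQ ek bk.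
Proof.
move=> sf sP sQ se sb pBF G HkP HlP HkQ HlQ W w1 w2 c HW Ec1 Ec2.
have Gex i : exists T : {Q : K & ((arr Q (EB i) * arr Q (BA i)) * arr (EA i) Q)%type},
    [/\ is_pullback (pB i) (bf i) (projT2 T).1.1 (projT2 T).1.2,
      comp (projT2 T).1.1 (projT2 T).2 = ef i,
      comp (projT2 T).1.2 (projT2 T).2 = pA i & isofibration (projT2 T).2].
  have [Q [q1 [q2 [k H]]]] := gap_exists (sf i) (pBF i) (G i).
  by exists (existT _ Q ((q1, q2), k)).
pose T i := sval (cid (Gex i)); have TP i := svalP (cid (Gex i)).
pose g1 i := (projT2 (T i)).1.1; pose g2 i := (projT2 (T i)).1.2.
pose h i := (projT2 (T i)).2.
have HG i : is_pullback (pB i) (bf i) (g1 i) (g2 i) by case: (TP i).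
have Eh1 i : comp (g1 i) (h i) = ef i by case: (TP i).
have Eh2 i : comp (g2 i) (h i) = pA i by case: (TP i).
have hF i : isofibration (h i) by case: (TP i).
have mex i : exists m : arr W (projT1 (T i)), comp (g1 i) m = comp (kQ i) w1 /\
    comp (g2 i) m = comp (lP i) w2.
  apply: (pullback_arr (HG i)).
  by rewrite compA sQ -compA (proj1 HW) !compA sb.
pose m i := sval (cid (mex i)); have mP i := svalP (cid (mex i)).
have m1 i : comp (g1 i) (m i) = comp (kQ i) w1 by case: (mP i).
have m2 i : comp (g2 i) (m i) = comp (lP i) w2 by case: (mP i).
apply: (isof_product C (f := h) (pr := kP) (qr := m)) => //.
  move=> X n s.
  have [t [Ht _]] := HkQ X n (fun i => postc (g1 i) (s i)).
  have [v [Hv _]] := HlP X n (fun i => postc (g2 i) (s i)).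
  have Etv : postc pQ t = postc bk v.
    apply: (product_monic HlQ) => i; rewrite (postcE _ (esym (sQ i))) Ht.
    rewrite (postcE _ (sb i)) Hv !postcA (proj1 (HG i)) //.
  have [u [[U1 U2] _]] := proj2 HW X n t v Etv.
  exists u; split=> [i|u' Hu'].
    by apply: (pullback_eq (HG i)); rewrite postcA ?m1 ?m2 -postcA ?U1 ?U2.
  apply: (pullback_eq HW).
    by apply: (product_monic HkQ) => i; rewrite U1 Ht -Hu' !postcA m1.
  by apply: (product_monic HlP) => i; rewrite U2 Hv -Hu' !postcA m2.
move=> i; apply: (pullback_arr_eq (HG i)); rewrite compA ?m1 ?m2 -compA ?Ec1 ?Ec2 compA.
  by rewrite Eh1 se.
by rewrite Eh2 sP.
Qed.

(** [EL] is also the limit of the pullbacks [W k] of [p k] along [lL k], with the gap maps [c k] as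
    legs, and the transition maps [m k] of this chain are pullbacks of the gap maps of the given
    squares. *)
Lemma gap_chain (E B : nat -> K) (EL BL : K) (p : forall k, arr (E k) (B k))
    (e : forall k, arr (E k.+1) (E k)) (b : forall k, arr (B k.+1) (B k))
    (pL : arr EL BL) (kL : forall k, arr EL (E k)) (lL : forall k, arr BL (B k)) :
  (forall k, comp (p k) (e k) = comp (b k) (p k.+1)) ->
  (forall k, comp (p k) (kL k) = comp (lL k) pL) ->
  (forall k, isofibration (p k)) ->
  (forall k, gap_isofibration (p k.+1) (p k) (e k) (b k)) ->
  is_chain_limit e kL -> is_chain_limit b lL ->
  forall k, gap_isofibration pL (p k) (kL k) (lL k).
Proof.
move=> se sL pF G HE HB k0 W0 w10 w20 c0 HW0 Ec10 Ec20.
have Wex k : exists T : {Q : K & (arr Q (E k) * arr Q BL)%type},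
    is_pullback (p k) (lL k) (projT2 T).1 (projT2 T).2.
  have [Q [q1 [q2 H]]] := cosmos_pullback C (lL k) (pF k).
  by exists (existT _ Q (q1, q2)).
pose T k := sval (cid (Wex k)); have HW k := svalP (cid (Wex k)).
pose W k := projT1 (T k); pose w1 k : arr (W k) (E k) := (projT2 (T k)).1.
pose w2 k : arr (W k) BL := (projT2 (T k)).2.
have {}HW k : is_pullback (p k) (lL k) (w1 k) (w2 k) := HW k.
have cex k : exists c : arr EL (W k), comp (w1 k) c = kL k /\ comp (w2 k) c = pL.
  by apply: (pullback_arr (HW k)); apply: sL.
pose c k := sval (cid (cex k)); have cP k := svalP (cid (cex k)).
have c1 k : comp (w1 k) (c k) = kL k by case: (cP k).
have c2 k : comp (w2 k) (c k) = pL by case: (cP k).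
have mex k : exists m : arr (W k.+1) (W k), comp (w1 k) m = comp (e k) (w1 k.+1) /\
    comp (w2 k) m = w2 k.+1.
  apply: (pullback_arr (HW k)); rewrite compA se -compA (proj1 (HW k.+1)) compA.
  by rewrite (proj1 HB).
pose m k := sval (cid (mex k)); have mP k := svalP (cid (mex k)).
have m1 k : comp (w1 k) (m k) = comp (e k) (w1 k.+1) by case: (mP k).
have m2 k : comp (w2 k) (m k) = w2 k.+1 by case: (mP k).
have mF k : isofibration (m k).
  have [Q [g1 [g2 [h [HQ Eh1 Eh2 hF]]]]] := gap_exists (se k) (pF k) (G k).
  have [n [n1 n2]] : exists n, comp g1 n = w1 k /\ comp g2 n = comp (lL k.+1) (w2 k).
    by apply: (pullback_arr HQ); rewrite (proj1 (HW k)) compA (proj1 HB).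
  apply: (isof_pullback C hF (g := n) (q1 := w1 k.+1)); apply: is_pullbackI.
  - apply: (pullback_arr_eq HQ); rewrite !compA ?Eh1 ?Eh2 ?n1 ?n2 ?m1 //.
    by rewrite -compA m2 (proj1 (HW k.+1)).
  - move=> X l s t Est.
    have E1 : postc (p k.+1) s = postc (lL k.+1) (postc (w2 k) t).
      by rewrite -Eh2 -postcA Est !postcA n2.
    have [u [[U1 U2] _]] := proj2 (HW k.+1) X l s (postc (w2 k) t) E1.
    exists u; split=> //; apply: (pullback_eq (HW k)); rewrite postcA ?m1 ?m2 //.
    by rewrite -postcA U1 -Eh1 -postcA Est postcA n1.
  - move=> X l s t E1 E2; apply: (pullback_eq (HW k.+1)) => //.
    by rewrite -m2 -!postcA E2.
have HN : is_chain_limit m c.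
  split=> [k|X n s Hs].
    apply: (pullback_arr_eq (HW k)); rewrite compA ?m1 ?m2 ?c1 ?c2 //.
    by rewrite -compA c1 (proj1 HE).
  have [|t [Ht _]] := proj2 HE X n (fun k => postc (w1 k) (s k)).
    by move=> k; rewrite -(Hs k) !postcA m1.
  have Hw2 k : postc (w2 k) (s k) = postc (w2 0) (s 0).
    by elim: k => [//|k <-]; rewrite -(Hs k) postcA m2.
  exists t; split=> [k|t' Ht'].
    apply: (pullback_eq (HW k)); rewrite postcA ?c1 ?c2 ?Ht //.
    rewrite Hw2; apply: (chain_monic HB) => j.
    by rewrite (postcE _ (esym (sL j))) Ht -(Hw2 j) !postcA (proj1 (HW j)).
  by apply: (chain_monic HE) => k; rewrite Ht -Ht' postcA c1.
have [i [Hi i1 i2]] := iso_pullback HW0 (HW k0).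
have -> : c0 = comp i (c k0).
  by apply: (pullback_arr_eq HW0); rewrite compA ?i1 ?i2 ?c1 ?c2.
exact: (isof_comp C (isof_iso C Hi) (isof_chain C mF HN k0)).
Qed.

Section Leibniz.
Variables (X Y : sSet) (i : smap X Y).

Lemma power_map (B P A : K) (Z : sSet) (u : smap Z (hom P B)) (Q : K) (v : smap Z (hom
  Q A)) (f : arr A B) :
  is_power u -> exists fZ : arr Q P, forall m (x : Z m), prec (u m x) fZ = postc f (v m x).
Proof.
move=> H; have [g Hg] := power_arr H (@SMap Z (hom Q B) (fun m x => postc f (v m x))
  (fun m n a x => etrans (congr1 (postc f) (smap_nat v a x)) (postc_act f a (v n x)))).
by exists g.
Qed.

Lemma power_reindex (B PX PY : K) (uX : smap X (hom PX B)) (uY : smap Y (hom PY B)) :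
  is_power uX -> exists Bi : arr PY PX, forall m (x : X m), prec (uX m x) Bi = uY m (i m x).
Proof.
move=> H; have [g Hg] := power_arr H (@SMap X (hom PY B) (fun m x => uY m (i m x))
  (fun m n a x => etrans (congr1 (uY m) (smap_nat i a x)) (smap_nat uY a (i n x)))).
by exists g.
Qed.

Variables (EA BA EB BB : K) (pA : arr EA BA) (pB : arr EB BB)
  (ef : arr EA EB) (bf : arr BA BB).
Variables (EAX EAY EBX EBY BAX BAY BBX BBY EQ BQ : K)
  (uEAX : smap X (hom EAX EA)) (uEAY : smap Y (hom EAY EA))
  (uEBX : smap X (hom EBX EB)) (uEBY : smap Y (hom EBY EB))
  (uBAX : smap X (hom BAX BA)) (uBAY : smap Y (hom BAY BA))
  (uBBX : smap X (hom BBX BB)) (uBBY : smap Y (hom BBY BB))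
  (pAX : arr EAX BAX) (pAY : arr EAY BAY) (pBX : arr EBX BBX) (pBY : arr EBY BBY)
  (EAi : arr EAY EAX) (EBi : arr EBY EBX) (BAi : arr BAY BAX) (BBi : arr BBY BBX)
  (efX : arr EAX EBX) (efY : arr EAY EBY) (bfX : arr BAX BBX) (bfY : arr BAY BBY)
  (k1 : arr EQ EAX) (k2 : arr EQ EBY) (l1 : arr BQ BAX) (l2 : arr BQ BBY)
  (pQ : arr EQ BQ) (ek : arr EAY EQ) (bk : arr BAY BQ).
Hypotheses (im : smonic i) (sf : comp pB ef = comp bf pA) (pBF : isofibration pB)
  (G : gap_isofibration pA pB ef bf).
Hypotheses (hEAX : is_power uEAX) (hEAY : is_power uEAY) (hEBX : is_power uEBX)
  (hEBY : is_power uEBY) (hBAX : is_power uBAX) (hBAY : is_power uBAY)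
  (hBBX : is_power uBBX) (hBBY : is_power uBBY).
Hypotheses (eAX : forall n (x : X n), prec (uBAX n x) pAX = postc pA (uEAX n x))
  (eAY : forall n (x : Y n), prec (uBAY n x) pAY = postc pA (uEAY n x))
  (eBY : forall n (x : Y n), prec (uBBY n x) pBY = postc pB (uEBY n x))
  (eEAi : forall n (x : X n), prec (uEAX n x) EAi = uEAY n (i n x))
  (eEBi : forall n (x : X n), prec (uEBX n x) EBi = uEBY n (i n x))
  (eBAi : forall n (x : X n), prec (uBAX n x) BAi = uBAY n (i n x))
  (eefX : forall n (x : X n), prec (uEBX n x) efX = postc ef (uEAX n x))
  (eefY : forall n (x : Y n), prec (uEBY n x) efY = postc ef (uEAY n x))
  (ebfY : forall n (x : Y n), prec (uBBY n x) bfY = postc bf (uBAY n x)).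
Hypotheses (HE : is_pullback efX EBi k1 k2) (HB : is_pullback bfX BBi l1 l2)
  (s1 : comp pAX k1 = comp l1 pQ) (s2 : comp pBY k2 = comp l2 pQ)
  (ek1 : comp k1 ek = EAi) (ek2 : comp k2 ek = efY)
  (bk1 : comp l1 bk = BAi) (bk2 : comp l2 bk = bfY).

(* The gap map of the Leibniz exponential of a square is the Leibniz
   exponential of its gap map. *)
Lemma gap_leibniz : gap_isofibration pAY pQ ek bk.
Proof.
move=> W w1 w2 c HW Ec1 Ec2.
have [Gm [g1 [g2 [h [HG Eh1 Eh2 hF]]]]] := gap_exists sf pBF G.
have [GX [uGX hGX]] := cosmos_power C X Gm.
have [GY [uGY hGY]] := cosmos_power C Y Gm.
have [Gi eGi] := power_reindex uGY hGX.
have [hX ehX] := power_map uEAX h hGX.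
have [hY ehY] := power_map uEAY h hGY.
have [g1X eg1X] := power_map uGX g1 hEBX.
have [g2X eg2X] := power_map uGX g2 hBAX.
have [g1Y eg1Y] := power_map uGY g1 hEBY.
have [g2Y eg2Y] := power_map uGY g2 hBAY.
have [pBX' eBX] := power_map uEBX pB hBBX.
have [bfX' ebfX] := power_map uBAX bf hBBX.
have HGY := power_pullback hEBY hBBY hBAY hGY eBY ebfY eg1Y eg2Y HG.
have HGX := power_pullback hEBX hBBX hBAX hGX eBX ebfX eg1X eg2X HG.
have a1 : comp g1X Gi = comp EBi g1Y.
  apply: (power_arr_eq hEBX) => m x.
  by rewrite -!precA eg1X eEBi prec_postc eGi eg1Y.
have a2 : comp g2X Gi = comp BAi g2Y.
  apply: (power_arr_eq hBAX) => m x.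
  by rewrite -!precA eg2X eBAi prec_postc eGi eg2Y.
have a3 : comp g1X hX = efX.
  apply: (power_arr_eq hEBX) => m x.
  by rewrite -precA eg1X prec_postc ehX postcA Eh1 eefX.
have a4 : comp g2X hX = pAX.
  apply: (power_arr_eq hBAX) => m x.
  by rewrite -precA eg2X prec_postc ehX postcA Eh2 eAX.
have a5 : comp g1Y hY = efY.
  apply: (power_arr_eq hEBY) => m x.
  by rewrite -precA eg1Y prec_postc ehY postcA Eh1 eefY.
have a6 : comp g2Y hY = pAY.
  apply: (power_arr_eq hBAY) => m x.
  by rewrite -precA eg2Y prec_postc ehY postcA Eh2 eAY.
(* With [q2], [W] becomes the pullback of [hX] and [Gi], so that [c] is the Leibniz exponential of
   [h] by [i]. *)
have [q2 [b1 b2]] : exists q2, comp g1Y q2 = comp k2 w1 /\ comp g2Y q2 = w2.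
  apply: (pullback_arr HGY).
  by rewrite compA s2 -compA (proj1 HW) compA bk2.
apply: (isof_leibniz C (f := h) (Ai := EAi) (Bi := Gi) (fX := hX) (fY := hY)
  (q1 := comp k1 w1) (q2 := q2) im hF hEAX hEAY hGX hGY) => //; first apply: is_pullbackI.
- apply: (pullback_arr_eq HGX); rewrite [RHS]compA ?a1 ?a2 [LHS]compA ?a3 ?a4.
    by rewrite compA (proj1 HE) -!compA b1.
  by rewrite compA s1 -compA (proj1 HW) compA bk1 -compA b2.
- move=> Z n s t E.
  have E1 : postc efX s = postc EBi (postc g1Y t).
    by rewrite -a3 -postcA E !postcA a1.
  have [v [[V1 V2] _]] := proj2 HE Z n s (postc g1Y t) E1.
  have E2 : postc pQ v = postc bk (postc g2Y t).
    apply: (pullback_eq HB).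
      by rewrite (postcE _ (esym s1)) V1 -a4 -postcA E !postcA bk1 a2.
    by rewrite (postcE _ (esym s2)) V2 !postcA bk2 (proj1 HGY).
  have [w [[W1 W2] _]] := proj2 HW Z n v (postc g2Y t) E2.
  exists w; split; first by rewrite -postcA W1.
  by apply: (pullback_eq HGY); rewrite postcA ?b1 ?b2 -?postcA ?W1 ?W2.
- move=> Z n s t; rewrite -!postcA => E1 E2; apply: (pullback_eq HW).
    apply: (pullback_eq HE) => //.
    by have := congr1 (postc g1Y) E2; rewrite !postcA b1.
  by have := congr1 (postc g2Y) E2; rewrite !postcA b2.
- by rewrite -compA Ec1 ek1.
- by apply: (pullback_arr_eq HGY); rewrite compA ?b1 ?b2 ?a5 ?a6 -?compA ?Ec1 ?Ec2.
Qed.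

End Leibniz.

Definition empty_sset : sSet.
Proof. by apply: (@SSet (fun _ => void) (fun _ _ _ x => x)). Defined.

(** The power of [f] is its Leibniz exponential by the inclusion of the empty simplicial set, whose
    powers are terminal. *)
Lemma power_isofibration (Y : sSet) (A B AY BY : K) (f : arr A B)
    (uA : smap Y (hom AY A)) (uB : smap Y (hom BY B)) (fY : arr AY BY) :
  isofibration f -> is_power uA -> is_power uB ->
  (forall m (x : Y m), prec (uB m x) fY = postc f (uA m x)) -> isofibration fY.
Proof.
move=> fF hA hB EfY; have [T HT] := cosmos_terminal C.
have un (Z : K) n (s t : hom Z T n) : s = t.
  by have [h [_ U]] := HT Z n; rewrite -(U s) // -(U t).
pose u0 D : smap empty_sset (hom T D) := @SMap empty_sset (hom T D)
  (fun n x => match x with end) (fun m n a x => match x with end).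
have hT D : is_power (u0 D).
  move=> Z n h; have [t [_ _]] := HT Z n; exists t; split; first by move=> m [].
  by move=> t' _; apply: un.
pose i0 : smap empty_sset Y := @SMap empty_sset Y
  (fun n x => match x with end) (fun m n a x => match x with end).
have [tA _] := HT AY 0; have [tB _] := HT BY 0.
apply: (isof_leibniz C (i := i0) (f := f) (uAX := u0 A) (uAY := uA) (uBX := u0 B) (uBY := uB)
  (Ai := tA) (Bi := tB) (fX := id0 T) (fY := fY) (q1 := tB) (q2 := id0 BY)) => //.
- by move=> n [].
- apply: is_pullbackI; first exact: un.
    by move=> Z n s t _; exists t; rewrite postc1; split=> //; apply: un.
  by move=> Z n s t _; rewrite !postc1.
- exact: id0l.
Qed.

Lemma gap_power (X : sSet) (EA BA EB BB : K) (pA : arr EA BA) (pB : arr EB BB)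
    (ef : arr EA EB) (bf : arr BA BB) (EAX EBX BAX BBX : K)
    (uEA : smap X (hom EAX EA)) (uEB : smap X (hom EBX EB))
    (uBA : smap X (hom BAX BA)) (uBB : smap X (hom BBX BB))
    (pAX : arr EAX BAX) (pBX : arr EBX BBX) (efX : arr EAX EBX) (bfX : arr BAX BBX) :
  comp pB ef = comp bf pA -> isofibration pB -> gap_isofibration pA pB ef bf ->
  is_power uEA -> is_power uEB -> is_power uBA -> is_power uBB ->
  (forall n (x : X n), prec (uBA n x) pAX = postc pA (uEA n x)) ->
  (forall n (x : X n), prec (uBB n x) pBX = postc pB (uEB n x)) ->
  (forall n (x : X n), prec (uEB n x) efX = postc ef (uEA n x)) ->
  (forall n (x : X n), prec (uBB n x) bfX = postc bf (uBA n x)) ->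
  gap_isofibration pAX pBX efX bfX.
Proof.
move=> sf pBF G hEA hEB hBA hBB epA epB eef ebf W w1 w2 c HW Ec1 Ec2.
have [Gm [g1 [g2 [h [HG Eh1 Eh2 hF]]]]] := gap_exists sf pBF G.
have [GX [uG hG]] := cosmos_power C X Gm.
have [hX ehX] := power_map uEA h hG.
have [g1X eg1X] := power_map uG g1 hEB.
have [g2X eg2X] := power_map uG g2 hBA.
have HGX := power_pullback hEB hBB hBA hG epB ebf eg1X eg2X HG.
have [i [Hi i1 i2]] := iso_pullback HW HGX.
have -> : c = comp i hX.
  apply: (pullback_arr_eq HW); rewrite compA ?i1 ?i2 ?Ec1 ?Ec2.
    apply: (power_arr_eq hEB) => m x.
    by rewrite -precA eg1X prec_postc ehX postcA Eh1 eef.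
  apply: (power_arr_eq hBA) => m x.
  by rewrite -precA eg2X prec_postc ehX postcA Eh2 epA.
exact: (isof_comp C (isof_iso C Hi) (power_isofibration hF hEA hG ehX)).
Qed.

End Gap.

(** * The cosmos of left adjoints *)

Lemma vertex0 (X : sSet) (i : 'I_1) (x : X 0) : vertex i x = x.
Proof. by rewrite -{1}(deg0 x) vertex_deg. Qed.

Section La.
Variable K : cosmos.
Let C := cosmosP K.

Definition LE (P : La K) : K := total (la_isof P).
Definition LB (P : La K) : K := base (la_isof P).
Definition lp (P : La K) : arr (LE P) (LB P) := proj (la_isof P).

Lemma lpF (P : La K) : isofibration (lp P).
Proof. exact: projP. Qed.

Lemma lpL (P : La K) : is_left_adjoint (lp P).
Proof. exact: la_adjoint. Qed.

Definition tp (P Q : La K) n (f : hom P Q n) : hom (LE P) (LE Q) n := (sval (sval f)).1.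
Definition bt (P Q : La K) n (f : hom P Q n) : hom (LB P) (LB Q) n := (sval (sval f)).2.

Lemma la_eq (P Q : La K) n (f g : hom P Q n) : tp f = tp g -> bt f = bt g -> f = g.
Proof.
move=> E1 E2; apply: sig_ext; apply: sig_ext; move: E1 E2; rewrite /tp /bt.
by case: (sval (sval f)) => a b; case: (sval (sval g)) => c d /= -> ->.
Qed.

Lemma la_square (P Q : La K) n (f : hom P Q n) :
  postc (lp Q) (tp f) = prec (bt f) (lp P).
Proof. exact: (svalP (sval f)). Qed.

Lemma la_square0 (P Q : La K) (f : arr P Q) :
  comp (lp Q) (tp f) = comp (bt f) (lp P).
Proof. by have := la_square f; rewrite postc0 prec0. Qed.

Definition la_mor (P Q : La K) (e : arr (LE P) (LE Q)) (b : arr (LB P) (LB Q)) : Prop :=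
  left_adjoint_morphism (lp P) (lp Q) e b.

Lemma la_vertex (P Q : La K) n (f : hom P Q n) i : la_mor (vertex i (tp f)) (vertex i (bt f)).
Proof. exact: (svalP f i). Qed.

Lemma la_arr (P Q : La K) (f : arr P Q) : la_mor (tp f) (bt f).
Proof. by have := la_vertex f ord0; rewrite !vertex0. Qed.

Lemma la_simplex (P Q : La K) n (s : hom (LE P) (LE Q) n) (t : hom (LB P) (LB Q) n) :
  postc (lp Q) s = prec t (lp P) ->
  (forall i, la_mor (vertex i s) (vertex i t)) ->
  exists f : hom P Q n, tp f = s /\ bt f = t.
Proof.
move=> sq H.
pose f0 : Kisof_hom (la_isof P) (la_isof Q) n := exist _ (s, t) sq.
have H0 : spanned (@la_morphism K P Q) f0 by move=> i; apply: H.
by exists (exist _ f0 H0 : hom P Q n).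
Qed.

Lemma la_arrow (P Q : La K) (s : arr (LE P) (LE Q)) (t : arr (LB P) (LB Q)) :
  comp (lp Q) s = comp t (lp P) -> la_mor s t ->
  exists f : arr P Q, tp f = s /\ bt f = t.
Proof.
move=> sq H; apply: la_simplex; first by rewrite postc0 prec0.
by move=> i; rewrite !vertex0.
Qed.

Lemma tp_act (P Q : La K) m n (a : mono m n) (f : hom P Q n) : tp (act a f) = act a (tp f).
Proof. by []. Qed.
Lemma bt_act (P Q : La K) m n (a : mono m n) (f : hom P Q n) : bt (act a f) = act a (bt f).
Proof. by []. Qed.
Lemma tp_comp (P Q R : La K) n (g : hom Q R n) (f : hom P Q n) : tp (comp g f) = comp (tp g) (tp f).
Proof. by []. Qed.
Lemma bt_comp (P Q R : La K) n (g : hom Q R n) (f : hom P Q n) : bt (comp g f) = comp (bt g) (bt f).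
Proof. by []. Qed.
Lemma tp_postc (P Q R : La K) n (g : arr Q R) (f : hom P Q n) : tp (postc g f) = postc
  (tp g) (tp f).
Proof. by []. Qed.
Lemma bt_postc (P Q R : La K) n (g : arr Q R) (f : hom P Q n) : bt (postc g f) = postc
  (bt g) (bt f).
Proof. by []. Qed.
Lemma tp_prec (P Q R : La K) n (g : hom Q R n) (f : arr P Q) : tp (prec g f) = prec (tp g) (tp f).
Proof. by []. Qed.
Lemma bt_prec (P Q R : La K) n (g : hom Q R n) (f : arr P Q) : bt (prec g f) = prec (bt g) (bt f).
Proof. by []. Qed.

Lemma la_iso (P Q : La K) (f : arr P Q) : is_iso f -> is_iso (tp f) /\ is_iso (bt f).
Proof.
move=> [g [E1 E2]]; split; [exists (tp g) | exists (bt g)]; rewrite -?tp_comp -?bt_comp;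
  by rewrite E1 E2.
Qed.

Definition la_object (E B : K) (p : arr E B) (F : isofibration p) (L : is_left_adjoint p) : La K :=
  @LaObj K (@IsofObj K E B p F) L.

(** Being in [La] is a condition on vertices, so this is what a cone must satisfy beyond the two
    pointwise universal properties. *)
Definition la_reflects (I : Type) (P : La K) (A : I -> La K)
    (e : forall i, arr (LE P) (LE (A i))) (b : forall i, arr (LB P) (LB (A i))) : Prop :=
  forall (X : La K) (s : arr (LE X) (LE P)) (t : arr (LB X) (LB P)),
    comp (lp P) s = comp t (lp X) ->
    (forall i, la_mor (Q := A i) (comp (e i) s) (comp (b i) t)) -> la_mor s t.

Lemma la_reflects_simplex (I : Type) (P : La K) (A : I -> La K) e b :
  @la_reflects I P A e b ->
  forall (X : La K) n (s : hom (LE X) (LE P) n) (t : hom (LB X) (LB P) n),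
  postc (lp P) s = prec t (lp X) ->
  (forall i j, la_mor (Q := A i) (comp (e i) (vertex j s)) (comp (b i) (vertex j t))) ->
  exists f : hom X P n, tp f = s /\ bt f = t.
Proof.
move=> H X n s t sq M; apply: la_simplex => // j; apply: H; last by move=> i; apply: M.
by rewrite -postc0 -prec0 /vertex postc_act prec_act sq.
Qed.

Lemma la_cone_object (I : Type) (A : I -> La K) (E B : K) (p : arr E B)
    (k : forall i, arr E (LE (A i))) (l : forall i, arr B (LB (A i))) r eps :
  isofibration p -> (forall i, comp (lp (A i)) (k i) = comp (l i) p) ->
  conservative_cone k ->
  lifting p (id0 B) r eps ->
  (forall i, lifting (lp (A i)) (l i) (comp (k i) r) (whiskerl (l i) eps)) ->
  exists (F : isofibration p) (L : is_left_adjoint p),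
    let P := la_object F L in
    la_reflects (P := P) k l /\
    forall i, exists f : arr P (A i), tp f = k i /\ bt f = l i.
Proof.
move=> F sq kC L Li; have la : is_left_adjoint p by apply/left_adjointP; exists r, eps.
exists F, la => /=; split.
  move=> X s t sq' M; apply: (cone_morphism sq kC Li sq' (lpL X) _ L) => // i; exact: lpL.
move=> i; apply: (@la_arrow (la_object F la) (A i) (k i) (l i) (sq i)).
by have := cone_projection sq Li (i := i) (lpL (A i)) L; apply.
Qed.

Lemma vertex_postc (X A B : K) (g : arr A B) n (s : hom X A n) j :
  comp g (vertex j s) = vertex j (postc g s).
Proof. by rewrite -postc0 /vertex postc_act. Qed.

Lemma la_is_product (I : smallType) (A : I -> La K) (P : La K) (pj : forall i, arr P (A i)) :
  is_product (fun i => tp (pj i)) -> is_product (fun i => bt (pj i)) ->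
  la_reflects (fun i => tp (pj i)) (fun i => bt (pj i)) -> is_product pj.
Proof.
move=> HE HB R X n s.
have [t [Ht Ut]] := HE _ n (fun i => tp (s i)); have [u [Hu Uu]] := HB _ n (fun i => bt (s i)).
have sq : postc (lp P) t = prec u (lp X).
  apply: (product_monic HB) => i.
  by rewrite (postcE _ (esym (la_square0 (pj i)))) Ht la_square -prec_postc Hu.
have [|f [F1 F2]] := la_reflects_simplex R sq.
  by move=> i j; rewrite !vertex_postc Ht Hu; apply: la_vertex.
exists f; split=> [i|g Hg]; apply: la_eq; rewrite ?tp_postc ?bt_postc ?F1 ?F2 //.
  by apply: Ut => i; rewrite -tp_postc Hg.
by apply: Uu => i; rewrite -bt_postc Hg.
Qed.

Lemma la_product_ex (I : smallType) (A : I -> La K) :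
  exists (P : La K) (pj : forall i, arr P (A i)),
    [/\ is_product (fun i => tp (pj i)), is_product (fun i => bt (pj i)) &
      la_reflects (fun i => tp (pj i)) (fun i => bt (pj i))].
Proof.
have [E [k Hk]] := cosmos_product C (fun i => LE (A i)).
have [B [l Hl]] := cosmos_product C (fun i => LB (A i)).
have [p [Hp _]] := Hl E 0 (fun i => comp (lp (A i)) (k i)).
have sq i : comp (lp (A i)) (k i) = comp (l i) p by rewrite -Hp postc0.
have pF : isofibration p.
  by apply: (isof_product C Hk Hl (f := fun i => lp (A i))) => i; [rewrite sq | apply: lpF].
(* The factors impose no compatibility, so liftings and units are chosen independently. *)
have exR i : exists re : arr B (LE (A i)) * hom B (LB (A i)) 1,
    lifting (lp (A i)) (l i) re.1 [:: re.2].
  have [r [e H]] := lifting_exists (l i) (lpL (A i)); by exists (r, e).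
pose re i := sval (cid (exR i)); have reP i := svalP (cid (exR i)).
have exN i := cid (unit_exists (q := p) (reP i) (sq i)).
have [r [Hr _]] := Hk B 0 (fun i => (re i).1).
have [eps [He _]] := Hl B 1 (fun i => (re i).2).
have [eta [Hn _]] := Hk E 1 (fun i => sval (exN i)).
have [L Li] := @cone_adjoint K I E B _ _ p (fun i => lp (A i)) k l sq
  (product_conservative Hk) (product_conservative Hl) r eps eta _ _ _
  (fun i => etrans (esym (postc0 _ _)) (Hr i)) He Hn reP (fun i => svalP (exN i))
  (product_monic Hk) (product_monic Hl).
have [F [LA [R ex]]] := la_cone_object pF sq (product_conservative Hk) L Li.
pose pj i := sval (cid (ex i)); have pjP i := svalP (cid (ex i)).
have E1 : (fun i => tp (pj i)) = k by apply: functional_extensionality_dep => i; case: (pjP i).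
have E2 : (fun i => bt (pj i)) = l by apply: functional_extensionality_dep => i; case: (pjP i).
by exists (la_object F LA), pj; rewrite E1 E2.
Qed.

Lemma la_product_pointwise (I : smallType) (A : I -> La K) (P : La K) (pj : forall i, arr P (A i)) :
  is_product pj -> is_product (fun i => tp (pj i)) /\ is_product (fun i => bt (pj i)).
Proof.
move=> H; have [P' [pj' [HE HB R]]] := la_product_ex A.
have [i [Hi Ei]] := iso_product (la_is_product HE HB R) H.
have [it ib] := la_iso Hi.
split; [apply: (product_iso HE it) | apply: (product_iso HB ib)] => j;
  by rewrite -?tp_comp -?bt_comp Ei.
Qed.

(* The terminal object of K, seen as an empty product. *)
Lemma la_terminal_ex : exists (T : K) (F : isofibration (id0 T)) (L : is_left_adjoint (id0 T)),
  is_terminal T /\ is_terminal (la_object F L).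
Proof.
have [T HT] := cosmos_terminal C.
pose A (i : void) : La K := match i with end.
pose k i : arr T (LE (A i)) := match i with end.
pose l i : arr T (LB (A i)) := match i with end.
have un (X : K) n (s t : hom X T n) : s = t.
  by have [h [_ U]] := HT X n; rewrite -(U s) // -(U t).
have Hk : is_product k.
  by move=> X n s; have [t _] := HT X n; exists t; split=> [[]|t' _].
have Hl : is_product l.
  by move=> X n s; have [t _] := HT X n; exists t; split=> [[]|t' _].
have F : isofibration (id0 T) by apply: (isof_iso C); apply: is_iso_id.
have sq i : comp (lp (A i)) (k i) = comp (l i) (id0 T) by case: i.
have [L _] := @cone_adjoint K void T T (fun i => LE (A i)) (fun i => LB (A i)) (id0 T)
  (fun i => lp (A i)) k l sq
  (product_conservative Hk) (product_conservative Hl) (id0 T) (deg 1 (id0 T)) (deg 1 (id0 T))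
  (fun i => match i with end) (fun i => match i with end) (fun i => match i with end)
  (fun i => match i with end) (fun i => match i with end) (fun i => match i with end)
  (fun i => match i with end) (fun i => match i with end)
  (product_monic Hk) (product_monic Hl).
have [F' [LA [R _]]] := la_cone_object F sq (product_conservative Hk) L (fun i : void
  => match i with end).
exists T, F', LA; split=> // X n.
have [t _] := HT (LE X) n; have [u _] := HT (LB X) n.
have [||f _] := la_reflects_simplex R (X := X) (s := t) (t := u); first exact: un.
  by case.
by exists f; split=> // g _; apply: la_eq; apply: un.
Qed.

Lemma la_is_pullback (A B D Q : La K) (f : arr A B) (g : arr D B) (q1 : arr Q A) (q2 : arr Q D) :
  is_pullback (tp f) (tp g) (tp q1) (tp q2) -> is_pullback (bt f) (bt g) (bt q1) (bt q2) ->
  (forall (X : La K) (s : arr (LE X) (LE Q)) (t : arr (LB X) (LB Q)),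
    comp (lp Q) s = comp t (lp X) ->
    la_mor (Q := A) (comp (tp q1) s) (comp (bt q1) t) ->
    la_mor (Q := D) (comp (tp q2) s) (comp (bt q2) t) -> la_mor s t) ->
  is_pullback f g q1 q2.
Proof.
move=> HE HB R; apply: is_pullbackI.
- by apply: la_eq; [apply: (proj1 HE) | apply: (proj1 HB)].
- move=> X n s t E.
  have [u [[U1 U2] _]] := proj2 HE _ n (tp s) (tp t) (congr1 (@tp _ _ _) E).
  have [v [[V1 V2] _]] := proj2 HB _ n (bt s) (bt t) (congr1 (@bt _ _ _) E).
  have sq : postc (lp Q) u = prec v (lp X).
    apply: (pullback_eq HB).
      by rewrite (postcE _ (esym (la_square0 q1))) U1 la_square -prec_postc V1.
    by rewrite (postcE _ (esym (la_square0 q2))) U2 la_square -prec_postc V2.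
  have [|h [H1 H2]] := la_simplex sq.
    move=> j; apply: R.
    + by rewrite -postc0 -prec0 /vertex postc_act prec_act sq.
    + by rewrite !vertex_postc U1 V1; apply: la_vertex.
    + by rewrite !vertex_postc U2 V2; apply: la_vertex.
  by exists h; split; apply: la_eq; rewrite ?tp_postc ?bt_postc ?H1 ?H2.
- move=> X n s t E1 E2; apply: la_eq.
    by apply: (pullback_eq HE); rewrite -!tp_postc ?E1 ?E2.
  by apply: (pullback_eq HB); rewrite -!bt_postc ?E1 ?E2.
Qed.

Definition la_isof (P Q : La K) (f : arr P Q) : Prop :=
  [/\ isofibration (tp f), isofibration (bt f) &
    gap_isofibration (lp P) (lp Q) (tp f) (bt f)].


(** Lifting and unit are chosen over [D], pushed along [g] to [B], and lifted along the isofibration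
    [f] by [lifting_step] and [unit_step]. *)
Lemma la_pullback_ex (A B D : La K) (f : arr A B) (g : arr D B) : la_isof f ->
  exists (Q : La K) (q1 : arr Q A) (q2 : arr Q D),
    [/\ is_pullback f g q1 q2, is_pullback (tp f) (tp g) (tp q1) (tp q2),
      is_pullback (bt f) (bt g) (bt q1) (bt q2) & la_isof q2].
Proof.
case=> fE fB fG.
have [E [kA [kD HE]]] := cosmos_pullback C (tp g) fE.
have [B' [lA [lD HB]]] := cosmos_pullback C (bt g) fB.
have sf := la_square0 f; have sg := la_square0 g.
have [p [pA pD]] : exists p, comp lA p = comp (lp A) kA /\ comp lD p = comp (lp D) kD.
  by apply: (pullback_arr HB); rewrite compA -sf -compA (proj1 HE) !compA sg.
have G : gap_isofibration p (lp D) kD lD.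
  exact: (gap_pullback sf sg (esym pA) (esym pD) (lpF B) fG HE HB).
have pF : isofibration p by apply: (isofibration_of_gap (esym pD) (lpF D) G).
have [rD [eD LD]] := lifting_exists lD (lpL D).
have LB0 := left_adjoint_morphism_lifting sg (lpL D) (lpL B) (la_arr g) LD.
rewrite -(proj1 HB) in LB0.
have [rA [eA [LA ErA EeA]]] := lifting_step sf fE fB (lpL A) (lpL B) (la_arr f) LB0.
have [r [Er1 Er2]] := pullback_arr HE ErA.
have [eps [[Ee1 Ee2] _]] := proj2 HB _ 1 eA eD EeA.
have [nD [snD tnD HnD]] := unit_exists LD (esym pD).
have HnB := unit_push sg HnD.
have [nA [snA tnA HnA EnA]] : exists eta : hom E (LE A) 1, [/\ src eta = kA, tgt eta = comp rA p,
    hoeq (comp (lp A) kA) (comp lA p) (whiskerl (lp A) [:: eta] ++ whiskerr [:: eA] p) [::] &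
    postc (tp f) eta = postc (tp g) nD].
  apply: (unit_step sf fE (lpL A) (lpL B) (la_arr f) LA (esym pA)).
  - by rewrite src_postc snD (proj1 HE).
  - by rewrite tgt_postc tnD !compA ErA.
  - by rewrite (proj1 HE) (proj1 HB) /= EeA.
have [eta [[En1 En2] _]] := proj2 HE _ 1 nA nD EnA.
pose Ab (b : bool) : La K := if b then A else D.
pose kb (b : bool) : arr E (LE (Ab b)) := if b return arr E (LE (Ab b)) then kA else kD.
pose lb (b : bool) : arr B' (LB (Ab b)) := if b return arr B' (LB (Ab b)) then lA else lD.
have kC : conservative_cone kb.
  move=> X x y s ps H; apply: (pullback_conservative fE HE) ps _.
  by case; [apply: (H true) | apply: (H false)].
have lC : conservative_cone lb.
  move=> X x y s ps H; apply: (pullback_conservative fB HB) ps _.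
  by case; [apply: (H true) | apply: (H false)].
have kM : jointly_monic kb.
  by move=> X n s t H; apply: (pullback_eq HE); [apply: (H true) | apply: (H false)].
have lM : jointly_monic lb.
  by move=> X n s t H; apply: (pullback_eq HB); [apply: (H true) | apply: (H false)].
have sq b : comp (lp (Ab b)) (kb b) = comp (lb b) p by case: b.
have [|||||L Li] := @cone_adjoint K bool E B' _ _ p (fun b => lp (Ab b)) kb lb sq kC lC r eps eta
  (fun b => if b return arr B' (LE (Ab b)) then rA else rD)
  (fun b => if b return hom B' (LB (Ab b)) 1 then eA else eD)
  (fun b => if b return hom E (LE (Ab b)) 1 then nA else nD) _ _ _ _ _ kM lM.
- by case.
- by case.
- by case.
- by case.
- by case.
have [F [La_ [R ex]]] := la_cone_object pF sq kC L Li.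
have [q1 [q11 q12]] := ex true; have [q2 [q21 q22]] := ex false.
exists (la_object F La_), q1, q2.
have HE' : is_pullback (tp f) (tp g) (tp q1) (tp q2) by rewrite q11 q21.
have HB' : is_pullback (bt f) (bt g) (bt q1) (bt q2) by rewrite q12 q22.
split=> //.
  apply: la_is_pullback => // X s t sqst M1 M2; apply: R => // -[].
    by rewrite /= in q11 q12; rewrite q11 q12 in M1.
  by rewrite /= in q21 q22; rewrite q21 q22 in M2.
split; rewrite ?q21 ?q22 //.
- exact: (isof_pullback C fE HE).
- exact: (isof_pullback C fB HB).
Qed.

Lemma la_pullback_pointwise (A B D Q : La K) (f : arr A B) (g : arr D B)
    (q1 : arr Q A) (q2 : arr Q D) : la_isof f -> is_pullback f g q1 q2 ->
  is_pullback (tp f) (tp g) (tp q1) (tp q2) /\ is_pullback (bt f) (bt g) (bt q1) (bt q2).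
Proof.
move=> fF H; have [Q' [q1' [q2' [H' HE HB _]]]] := la_pullback_ex g fF.
have [i [Hi E1 E2]] := iso_pullback H' H; have [it ib] := la_iso Hi.
split; [apply: (pullback_iso HE it) | apply: (pullback_iso HB ib)];
  by rewrite -?tp_comp -?bt_comp ?E1 ?E2.
Qed.

Lemma la_chain_ex (A : nat -> La K) (p : forall k, arr (A k.+1) (A k)) :
  (forall k, la_isof (p k)) ->
  exists (P : La K) (pj : forall k, arr P (A k)),
    is_chain_limit p pj /\ forall k, la_isof (pj k).
Proof.
move=> pF.
have eF k : isofibration (tp (p k)) by case: (pF k).
have bF k : isofibration (bt (p k)) by case: (pF k).
have G k : gap_isofibration (lp (A k.+1)) (lp (A k)) (tp (p k)) (bt (p k)) by case: (pF k).
have sp k := la_square0 (p k).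
have [E [k HE]] := cosmos_chain C eF; have [B [l HB]] := cosmos_chain C bF.
have [q [Hq _]] : exists! q : arr E B, forall j, postc (l j) q = comp (lp (A j)) (k j).
  apply: (proj2 HB) => j; rewrite postc0 compA -sp -compA; congr comp.
  exact: (proj1 HE).
have sq j : comp (lp (A j)) (k j) = comp (l j) q by rewrite -Hq postc0.
have GL := gap_chain sp sq (fun j => lpF (A j)) G HE HB.
have qF : isofibration q := isofibration_of_gap (sq 0) (lpF (A 0)) (GL 0).
(* Liftings are chosen up the tower, each strictly over the previous one; the units follow in the
   same way once the liftings are fixed. *)
have [||re Hre] := @tower_choice (fun j => (arr B (LE (A j)) * hom B (LB (A j)) 1)%type : Type)
  (fun j re => lifting (lp (A j)) (l j) re.1 [:: re.2])
  (fun j re re' => comp (tp (p j)) re'.1 = re.1 /\ postc (bt (p j)) re'.2 = re.2).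
- by have [r [e H]] := lifting_exists (l 0) (lpL (A 0)); exists (r, e).
- move=> j [r e] /= L; have L' := L; rewrite -(proj1 HB j) in L'.
  have [r' [e' [H1 H2 H3]]] :=
    lifting_step (sp j) (eF j) (bF j) (lpL (A j.+1)) (lpL (A j)) (la_arr (p j)) L'.
  by exists (r', e').
have [||n Hn] := @tower_choice (fun j => hom E (LE (A j)) 1 : Type)
  (fun j n => [/\ src n = k j, tgt n = comp (re j).1 q &
    hoeq (comp (lp (A j)) (k j)) (comp (l j) q)
      (whiskerl (lp (A j)) [:: n] ++ whiskerr [:: (re j).2] q) [::]])
  (fun j n n' => postc (tp (p j)) n' = n).
- exact: (unit_exists (proj1 (Hre 0)) (sq 0)).
- move=> j nj [Es Et HN]; have [Lj [E1 E2]] := Hre j; have [LS _] := Hre j.+1.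
  have [|||n' [Es' Et' HN' EN']] := unit_step (sp j) (eF j) (lpL (A j.+1)) (lpL (A j))
      (la_arr (p j)) (etaB := nj) LS (sq j.+1).
  + by rewrite Es (proj1 HE).
  + by rewrite Et !compA E1.
  + by rewrite (proj1 HE) (proj1 HB) /= E2.
  by exists n'.
have [|r [Hr _]] := proj2 HE B 0 (fun j => (re j).1).
  by move=> j; rewrite postc0; case: (Hre j) => _ [].
have [|eps [He _]] := proj2 HB B 1 (fun j => (re j).2).
  by move=> j; case: (Hre j) => _ [].
have [|eta [Hn' _]] := proj2 HE E 1 n; first by move=> j; case: (Hn j).
have kC := chain_conservative eF HE; have lC := chain_conservative bF HB.
have [L Li] := @cone_adjoint K nat E B _ _ q (fun j => lp (A j)) k l sq kC lC r eps eta _ _ _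
  (fun j => etrans (esym (postc0 _ _)) (Hr j)) He Hn' (fun j => proj1 (Hre j))
  (fun j => proj1 (Hn j)) (chain_monic HE) (chain_monic HB).
have [F [LA [R ex]]] := la_cone_object qF sq kC L Li.
pose pj j := sval (cid (ex j)); have pjP j := svalP (cid (ex j)).
have E1 j : tp (pj j) = k j by case: (pjP j).
have E2 j : bt (pj j) = l j by case: (pjP j).
exists (la_object F LA), pj; split; last first.
  move=> j; split; rewrite ?E1 ?E2.
  - exact: (isof_chain C eF HE).
  - exact: (isof_chain C bF HB).
  - exact: GL.
split=> [j|X m s Hs].
  by apply: la_eq; rewrite ?tp_comp ?bt_comp ?E1 ?E2 ?(proj1 HE) ?(proj1 HB).
have [|t [Ht Ut]] := proj2 HE _ m (fun j => tp (s j)); first by move=> j; rewrite -tp_postc Hs.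
have [|u [Hu Uu]] := proj2 HB _ m (fun j => bt (s j)); first by move=> j; rewrite -bt_postc Hs.
have sqt : postc q t = prec u (lp X).
  apply: (chain_monic HB) => j.
  by rewrite (postcE _ (esym (sq j))) Ht la_square -prec_postc Hu.
have [|f [F1 F2]] := la_reflects_simplex R (X := X) (s := t) (t := u) sqt.
  by move=> j i; rewrite !vertex_postc Ht Hu; apply: la_vertex.
exists f; split=> [j|g Hg]; apply: la_eq; rewrite ?tp_postc ?bt_postc ?F1 ?F2 ?E1 ?E2 //.
  by apply: Ut => j; have := congr1 (@tp _ _ _) (Hg j); rewrite tp_postc E1.
by apply: Uu => j; have := congr1 (@bt _ _ _) (Hg j); rewrite bt_postc E2.
Qed.

Definition tp_map (P Q : La K) : smap (hom P Q) (hom (LE P) (LE Q)) :=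
  @SMap (hom P Q) (hom (LE P) (LE Q)) (fun n f => tp f) (fun _ _ _ _ => erefl).
Definition bt_map (P Q : La K) : smap (hom P Q) (hom (LB P) (LB Q)) :=
  @SMap (hom P Q) (hom (LB P) (LB Q)) (fun n f => bt f) (fun _ _ _ _ => erefl).

Definition smap_comp (X Y Z : sSet) (g : smap Y Z) (f : smap X Y) : smap X Z.
Proof.
by apply: (@SMap X Z (fun n x => g n (f n x))) => m n a x; rewrite !smap_nat.
Defined.

Lemma power_whisker (X : sSet) (A B PA PB : K) (uA : smap X (hom PA A)) (uB : smap X (hom PB B))
    n (t : hom A B n) : is_power uB ->
  exists s : hom PA PB n, forall m (x : X m) (a : mono m n),
    comp (uB m x) (act a s) = comp (act a t) (uA m x).
Proof.
move=> HB.
have hN m l (b : mono m l) (xa : sprod X (Delta n) l) :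
    comp (act ((act b xa).2 : mono m n) t) (uA m (act b xa).1) =
    act b (comp (act (xa.2 : mono l n) t) (uA l xa.1)).
  by rewrite comp_act smap_nat act_comp.
have [s [Hs _]] := HB PA n (@SMap (sprod X (Delta n)) (hom PA B)
  (fun m xa => comp (act (xa.2 : mono m n) t) (uA m xa.1)) hN).
by exists s => m x a; rewrite -(Hs m x a).
Qed.

Lemma la_power_ex (X : sSet) (A : La K) :
  exists (P : La K) (u : smap X (hom P A)),
    [/\ is_power u, is_power (smap_comp (tp_map P A) u) &
      is_power (smap_comp (bt_map P A) u)].
Proof.
have [E [uE HE]] := cosmos_power C X (LE A); have [B [uB HB]] := cosmos_power C X (LB A).
have [p Hp] := power_map uE (lp A) HB.
have pF : isofibration p := power_isofibration (lpF A) HE HB Hp.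
pose k (x : X 0) : arr E (LE A) := uE 0 x.
pose l (x : X 0) : arr B (LB A) := uB 0 x.
have sq x : comp (lp A) (k x) = comp (l x) p by rewrite -postc0 -Hp prec0.
have kC : conservative_cone k by apply: power_conservative HE.
have lC : conservative_cone l by apply: power_conservative HB.
have /left_adjointP[r0 [e0s L0]] := lpL A.
have [pe0 _ _] := L0; have [e0 [e0s1 e0t He0]] := path_edge_ex (@hom_qcat K _ _) pe0.
have {}L0 := lifting_hoeq L0 He0.
have [n0 [n0s n0t Hn0]] : exists eta : hom (LE A) (LE A) 1, [/\ src eta = id0 (LE A),
    tgt eta = comp r0 (lp A) &
    hoeq (lp A) (lp A) (whiskerl (lp A) [:: eta] ++ whiskerr [:: e0] (lp A)) [::]].
  have [|eta []] := unit_exists (q := lp A) (k := id0 (LE A)) L0; first by rewrite id0l id0r.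
  by rewrite id0l id0r => H1 H2 H3; exists eta.
(* The adjunction is powered as a whole: [r], [eps] and [eta] are the [X]-powers of [r0], [e0] and
   [n0]. *)
have [r Hr] := power_whisker uB r0 HE.
have [eps He] := power_whisker uB e0 HB.
have [eta Hn] := power_whisker uE n0 HE.
have Hr' m (x : X m) : prec (uE m x) r = postc r0 (uB m x).
  by have := Hr m x (mono_cst m ord0); rewrite !act0.
have v1 (Y : sSet) (y : Y 1) i m : act (mono_cst m i : mono m 1) y = deg m (vertex i y).
  exact: act_cst.
(* The legs at vertices need not determine the endpoints, so these are computed on all simplices of
   [X]. *)
have eps_end i (w : arr B B) (w0 : arr (LB A) (LB A)) : vertex i e0 = w0 ->
    (forall m (x : X m), prec (uB m x) w = comp (deg m w0) (uB m x)) -> vertex i eps = w.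
  move=> Ew Hw; apply: (power_arr_eq HB) => m x.
  by have := He m x (mono_cst m i); rewrite !v1 Ew -Hw.
have eta_end i (w : arr E E) (w0 : arr (LE A) (LE A)) : vertex i n0 = w0 ->
    (forall m (x : X m), prec (uE m x) w = comp (deg m w0) (uE m x)) -> vertex i eta = w.
  move=> Ew Hw; apply: (power_arr_eq HE) => m x.
  by have := Hn m x (mono_cst m i); rewrite !v1 Ew -Hw.
have [|||||||||L Li] := @cone_adjoint_ends K (X 0) E B (fun _ => LE A) (fun _ =>
  LB A) p (fun _ => lp A) k l
  sq kC lC r eps eta (fun x => comp r0 (l x)) (fun x => prec e0 (l x)) (fun x => prec n0 (k x)).
- by move=> x; rewrite -prec0 Hr' postc0.
- move=> x; have := He 1 (deg 1 x) (mono_id 1); rewrite !act_id /postc /prec deg_map; exact.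
- move=> x; have := Hn 1 (deg 1 x) (mono_id 1); rewrite !act_id /postc /prec deg_map; exact.
- by move=> x; have := lifting_whisker (l x) L0; rewrite id0l.
- move=> x; split.
  + by rewrite src_prec n0s id0l.
  + by rewrite tgt_prec n0t -!compA sq.
  + have := wr_hoeq (k x) Hn0; rewrite wr_cat wr_wl wrA sq -wrA; exact.
- apply: eps_end e0s1 _ => m x; rewrite -precA Hp prec_postc Hr' postcA.
  by rewrite /postc.
- apply: eps_end e0t _ => m x; by rewrite prec1 comp1f.
- apply: eta_end n0s _ => m x; by rewrite prec1 comp1f.
- apply: eta_end n0t _ => m x; rewrite -precA Hr' prec_postc Hp postcA.
  by rewrite /postc.
have [F [LA [R ex]]] := la_cone_object pF sq kC L Li.
set P := la_object F LA in R ex.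
(* The vertices of this simplex are legs of the cone, hence morphisms of left adjoints; fullness
   asks for nothing more. *)
have exU m (x : X m) : exists f : hom P A m, tp f = uE m x /\ bt f = uB m x.
  apply: la_simplex; first by rewrite -Hp.
  move=> j; have [f [F1 F2]] := ex (vertex j x).
  have := la_arr f; rewrite F1 F2 /k /l /vertex !smap_nat; exact.
pose u0 m x := sval (cid (exU m x)); have uP m x := svalP (cid (exU m x)).
have u1 m x : tp (u0 m x) = uE m x by case: (uP m x).
have u2 m x : bt (u0 m x) = uB m x by case: (uP m x).
have uN m n (a : mono m n) x : u0 m (act a x) = act a (u0 n x).
  by apply: la_eq; rewrite ?tp_act ?bt_act ?u1 ?u2 smap_nat.
pose u := @SMap X (hom P A) u0 uN.
have EE : smap_comp (tp_map P A) u = uE by apply: smap_eq => n x; apply: u1.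
have EB : smap_comp (bt_map P A) u = uB by apply: smap_eq => n x; apply: u2.
exists P, u; rewrite EE EB; split=> // Z n h.
have [t [Ht Ut]] := HE (LE Z) n (smap_comp (tp_map Z A) h).
have [v [Hv Uv]] := HB (LB Z) n (smap_comp (bt_map Z A) h).
have sqt : postc p t = prec v (lp Z).
  apply: (is_power_eq HB) => m x a.
  rewrite -postc_act -prec_act /postc /prec !compA -[comp (uB m x) (deg m p)]/(prec _ p) Hp.
  rewrite -(Hv m x a) /= /postc -compA -(Ht m x a); exact: la_square.
have [|f [F1 F2]] := la_reflects_simplex R (X := Z) (s := t) (t := v) sqt.
  move=> x j; have := Ht 0 x (mono_cst 0 j); have := Hv 0 x (mono_cst 0 j).
  rewrite /k /l /vertex => <- <-; exact: la_arr.
exists f; split=> [m x a|g Hg].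
  apply: la_eq; rewrite ?tp_comp ?bt_comp ?tp_act ?bt_act ?F1 ?F2 /= ?u1 ?u2.
    exact: (Ht m x a).
  exact: (Hv m x a).
apply: la_eq; rewrite ?F1 ?F2.
  by apply: Ut => m x a; rewrite /= Hg tp_comp u1.
by apply: Uv => m x a; rewrite /= Hg bt_comp u2.
Qed.

Lemma la_power_pointwise (X : sSet) (A P : La K) (u : smap X (hom P A)) : is_power u ->
  is_power (smap_comp (tp_map P A) u) /\ is_power (smap_comp (bt_map P A) u).
Proof.
move=> H; have [P' [u' [H' HE HB]]] := la_power_ex X A.
have [i [Hi Ei]] := iso_power H' H; have [it ib] := la_iso Hi.
split; [apply: (power_iso HE it) | apply: (power_iso HB ib)] => m x /=;
  by rewrite -?tp_prec -?bt_prec Ei.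
Qed.

Lemma la_isof_power (X : sSet) (A B AX BX : La K) (f : arr A B)
    (uA : smap X (hom AX A)) (uB : smap X (hom BX B)) (fX : arr AX BX) :
  la_isof f -> is_power uA -> is_power uB ->
  (forall n (x : X n), prec (uB n x) fX = postc f (uA n x)) -> la_isof fX.
Proof.
case=> fE fB G hA hB H; have [hEA hBA] := la_power_pointwise hA.
have [hEB hBB] := la_power_pointwise hB.
have eE n (x : X n) : prec (smap_comp (tp_map BX B) uB n x) (tp fX) =
    postc (tp f) (smap_comp (tp_map AX A) uA n x) := congr1 (@tp _ _ _) (H n x).
have eB n (x : X n) : prec (smap_comp (bt_map BX B) uB n x) (bt fX) =
    postc (bt f) (smap_comp (bt_map AX A) uA n x) := congr1 (@bt _ _ _) (H n x).
split.
- exact: (power_isofibration fE hEA hEB eE).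
- exact: (power_isofibration fB hBA hBB eB).
- apply: (gap_power (la_square0 f) (lpF B) G hEA hEB hBA hBB) => // n x;
    by rewrite /= la_square.
Qed.

Lemma la_leibniz (X Y : sSet) (i : smap X Y) (A B : La K) (f : arr A B)
    (AX AY BX BY : La K)
    (uAX : smap X (hom AX A)) (uAY : smap Y (hom AY A))
    (uBX : smap X (hom BX B)) (uBY : smap Y (hom BY B))
    (Ai : arr AY AX) (Bi : arr BY BX) (fX : arr AX BX) (fY : arr AY BY)
    (Q : La K) (q1 : arr Q AX) (q2 : arr Q BY) (k : arr AY Q) :
  smonic i -> la_isof f ->
  is_power uAX -> is_power uAY -> is_power uBX -> is_power uBY ->
  (forall n (x : X n), prec (uAX n x) Ai = uAY n (i n x)) ->
  (forall n (x : X n), prec (uBX n x) Bi = uBY n (i n x)) ->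
  (forall n (x : X n), prec (uBX n x) fX = postc f (uAX n x)) ->
  (forall n (y : Y n), prec (uBY n y) fY = postc f (uAY n y)) ->
  is_pullback fX Bi q1 q2 ->
  comp q1 k = Ai -> comp q2 k = fY -> la_isof k.
Proof.
move=> im fF hAX hAY hBX hBY eAi eBi efX efY HQ ek1 ek2.
have [HQE HQB] := la_pullback_pointwise (la_isof_power fF hAX hBX efX) HQ.
have [fE fB G] := fF.
have [tAX bAX] := la_power_pointwise hAX; have [tAY bAY] := la_power_pointwise hAY.
have [tBX bBX] := la_power_pointwise hBX; have [tBY bBY] := la_power_pointwise hBY.
have T (P R : La K) n (s t : hom P R n) : s = t -> tp s = tp t by move=> ->.
have S (P R : La K) n (s t : hom P R n) : s = t -> bt s = bt t by move=> ->.
split.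
- exact: (isof_leibniz C im fE tAX tAY tBX tBY
    (fun n x => T _ _ _ _ _ (eAi n x))
    (fun n x => T _ _ _ _ _ (eBi n x))
    (fun n x => T _ _ _ _ _ (efX n x))
    (fun n x => T _ _ _ _ _ (efY n x))
    HQE (T _ _ _ _ _ ek1) (T _ _ _ _ _ ek2)).
- exact: (isof_leibniz C im fB bAX bAY bBX bBY
    (fun n x => S _ _ _ _ _ (eAi n x))
    (fun n x => S _ _ _ _ _ (eBi n x))
    (fun n x => S _ _ _ _ _ (efX n x))
    (fun n x => S _ _ _ _ _ (efY n x))
    HQB (S _ _ _ _ _ ek1) (S _ _ _ _ _ ek2)).
- exact: (gap_leibniz im (la_square0 f) (lpF B) G tAX tAY tBX tBY bAX bAY bBX bBY
    (fun n x => esym (la_square (uAX n x))) (fun n x => esym (la_square (uAY n x)))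
    (fun n x => esym (la_square (uBY n x)))
    (fun n x => T _ _ _ _ _ (eAi n x)) (fun n x => T _ _ _ _ _ (eBi n x))
    (fun n x => S _ _ _ _ _ (eAi n x))
    (fun n x => T _ _ _ _ _ (efX n x)) (fun n x => T _ _ _ _ _ (efY n x))
    (fun n x => S _ _ _ _ _ (efY n x))
    HQE HQB (la_square0 q1) (la_square0 q2)
    (T _ _ _ _ _ ek1) (T _ _ _ _ _ ek2) (S _ _ _ _ _ ek1) (S _ _ _ _ _ ek2)).
Qed.

(** The base is lifted first. The total part is then lifted along the gap map [h], over the pair
    formed by the given map and the lifted base, which keeps the square strict. That the vertices of
    the lift are morphisms of left adjoints is left to the last premise. *)
Lemma la_lift (U V : sSet) (i : smap U V) (A B X : La K) (f : arr A B) :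
  la_isof f ->
  (forall (Z A' B' : K) (g : arr A' B'), isofibration g -> has_lift i (hom_post Z g)) ->
  (forall (wt : smap V (hom (LE X) (LE A))) (wb : smap V (hom (LB X) (LB A))),
     (forall n v, postc (lp A) (wt n v) = prec (wb n v) (lp X)) ->
     (forall u, la_mor (wt 0 (i 0 u)) (wb 0 (i 0 u))) ->
     forall v, la_mor (wt 0 v) (wb 0 v)) ->
  has_lift i (hom_post X f).
Proof.
move=> [fE fB G] HL HV u v Huv.
have [|wb [wb1 wb2]] := HL _ _ _ _ fB (smap_comp (bt_map X A) u) (smap_comp (bt_map X B) v).
  by move=> n a; apply: (congr1 (@bt _ _ _) (Huv n a)).
have [Gm [g1 [g2 [h [HG Eh1 Eh2 hF]]]]] := gap_exists (la_square0 f) (lpF B) G.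
have zex n (b : V n) : exists z : hom (LE X) Gm n,
    postc g1 z = tp (v n b) /\ postc g2 z = prec (wb n b) (lp X).
  have [|z [Hz _]] := proj2 HG _ n (tp (v n b)) (prec (wb n b) (lp X)); last by exists z.
  by rewrite la_square -prec_postc; have /= -> := wb2 n b.
pose z n b := sval (cid (zex n b)).
have z1 n b : postc g1 (z n b) = tp (v n b) by rewrite /z; case: cid => ? [].
have z2 n b : postc g2 (z n b) = prec (wb n b) (lp X) by rewrite /z; case: cid => ? [].
have zN m n (a : mono m n) b : z m (act a b) = act a (z n b).
  apply: (pullback_eq HG); rewrite postc_act ?z1 ?z2 smap_nat //.
  by rewrite prec_act.
have [|wt [wt1 wt2]] := HL (LE X) _ _ _ hF (smap_comp (tp_map X A) u)
    (@SMap V (hom (LE X) Gm) z zN).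
  move=> n a /=; apply: (pullback_eq HG); rewrite postcA ?Eh1 ?Eh2 ?z1 ?z2.
    exact: (congr1 (@tp _ _ _) (Huv n a)).
  by rewrite la_square; have /= <- := wb1 n a.
have sq n b : postc (lp A) (wt n b) = prec (wb n b) (lp X).
  by rewrite -Eh2 -postcA; have /= -> := wt2 n b.
have M := HV wt wb sq _.
have {}M : forall b, la_mor (wt 0 b) (wb 0 b).
  apply: M => a; have /= -> := wt1 0 a; have /= -> := wb1 0 a; exact: la_arr.
have wex n b : exists w : hom X A n, tp w = wt n b /\ bt w = wb n b.
  by apply: la_simplex => // j; rewrite /vertex -!smap_nat; apply: M.
pose w n b := sval (cid (wex n b)).
have w1 n b : tp (w n b) = wt n b by rewrite /w; case: cid => ? [].
have w2 n b : bt (w n b) = wb n b by rewrite /w; case: cid => ? [].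
have wN m n (a : mono m n) b : w m (act a b) = act a (w n b).
  by apply: la_eq; rewrite ?tp_act ?bt_act ?w1 ?w2 smap_nat.
exists (@SMap V (hom X A) w wN); split=> [n a|n b] /=; apply: la_eq.
- by rewrite w1; apply: wt1.
- by rewrite w2; apply: wb1.
- by rewrite tp_postc w1 -Eh1 -postcA; have /= -> := wt2 n b.
- by rewrite bt_postc w2; apply: wb2.
Qed.

Definition flip : smap Iso Iso :=
  @SMap Iso Iso (fun _ s i => ~~ s i) (fun _ _ _ _ => erefl).

Lemma la_isof_hom (A B X : La K) (f : arr A B) : la_isof f ->
  qcat_isofibration (hom_post X f).
Proof.
move=> fF; split=> [n k kn|b]; apply: la_lift => //.
- by move=> Z A' B' g gF; have [H _] := isof_hom C gF Z; apply: H.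
- move=> wt wb sq H v.
  have Hv : in_horn k v.
    (* An inner horn has [n >= 2], so one of 0, 1, 2 differs from both [k] and the vertex [v]; hence
       every vertex already lies in the horn. *)
    have [j [jk jv]] : exists j : 'I_n.+1, j <> k /\ j <> (v : mono 0 n) ord0.
      have lt c : c <= 2 -> c < n.+1 by have := ltn_ord k; case/andP: kn; lia.
      pose o c (h : c <= 2) : 'I_n.+1 := Ordinal (lt c h).
      have h0 : 0 <= 2 by []. have h1 : 1 <= 2 by []. have h2 : 2 <= 2 by [].
      case: (pselect (o 0 h0 <> k /\ o 0 h0 <> (v : mono 0 n) ord0)) => H0;
        first by exists (o 0 h0).
      case: (pselect (o 1 h1 <> k /\ o 1 h1 <> (v : mono 0 n) ord0)) => H1;
        first by exists (o 1 h1).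
      exists (o 2 h2); split=> [E|E].
        apply: H0; split; first by move/(congr1 val); rewrite -E.
        move=> E0; apply: H1; split; first by move/(congr1 val); rewrite -E.
        by rewrite -E0 => /(congr1 val).
      have K0 : o 0 h0 = k.
        by apply: contrapT => h; apply: H0; split=> //; rewrite -E => /(congr1 val).
      by apply: H1; split; [rewrite -K0 => /(congr1 val) | rewrite -E => /(congr1 val)].
    by exists j; split=> // i; rewrite ord1 => E; apply: jv; rewrite E.
  exact: (H (exist _ v Hv)).
- by move=> Z A' B' g gF; have [_ H] := isof_hom C gF Z; apply: H.
- move=> wt wb sq H v.
  have H0 := H (mono_id 0 : Delta 0 0); set v0 : Iso 0 := iso_point b 0 _ in H0.
  case: (eqVneq (v ord0) b) => vb.
    by have -> : v = v0 by apply/funext => j; rewrite ord1 vb.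
  (* [iso_edge] runs from [false] to [true]; it is reversed when [b] is true, so that [e] always
     starts at the given point. Flipping twice is the identity. *)
  pose fl : smap Iso Iso := if b then flip else smap_comp flip flip.
  pose e := fl 1 iso_edge.
  have Es : src e = v0.
    by apply/funext => j; rewrite /src /vertex /e /fl /v0; case: (b).
  have Et : tgt e = v.
    apply/funext => j; rewrite ord1; move: vb; rewrite /tgt /vertex /e /fl.
    by case: (b); case: (v ord0).
  have inv_e (Z : sSet) (w : smap Iso Z) : ho_invertible (w 0 v0) (w 0 v) [:: w 1 e].
    have := iso_edge_invertible (smap_comp w fl).
    by rewrite -[smap_comp w fl 1 iso_edge]/(w 1 e) src_map tgt_map Es Et.
  have it := inv_e _ wt; have ib := inv_e _ wb.
  have sq0 u : comp (lp A) (wt 0 u) = comp (wb 0 u) (lp X) by have := sq 0 u; rewrite postc0 prec0.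
  have E : whiskerl (lp A) [:: wt 1 e] = whiskerr [:: wb 1 e] (lp X) by rewrite /= sq.
  (* The other vertex is linked to the given one by the invertible edge [e], so repleteness
     applies. *)
  have HL := left_adjoint_morphism_iso (sq0 v0) (sq0 v) (lpL X) (lpL A) H0 it ib E.
  have /left_adjointP[r1 [eps1 L1]] := lpL X.
  exact: (lifting_left_adjoint_morphism (sq0 v) (lpL A) L1 (HL _ _ L1)).
Qed.

Lemma la_isof_iso (P Q : La K) (f : arr P Q) : is_iso f -> la_isof f.
Proof.
move=> /la_iso[it ib]; split; [exact: (isof_iso C)|exact: (isof_iso C)|].
exact: gap_iso (la_square0 f) it ib.
Qed.

Lemma la_isof_comp (P Q R : La K) (g : arr Q R) (f : arr P Q) :
  la_isof g -> la_isof f -> la_isof (comp g f).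
Proof.
move=> [g1 g2 g3] [f1 f2 f3]; split.
- exact: (isof_comp C g1 f1).
- exact: (isof_comp C g2 f2).
- exact: (gap_comp (la_square0 f) (la_square0 g) (lpF Q) (lpF R) f3 g3).
Qed.

(** Up to isomorphism the terminal object is the identity of a terminal object of [K], and gap maps
    into that identity are the projections up to isomorphism. *)
Lemma la_isof_terminal (A T : La K) (f : arr A T) : is_terminal T -> la_isof f.
Proof.
move=> HT; have [T0 [F [L [H0 H1]]]] := la_terminal_ex.
have [i Hi] := iso_terminal HT H1.
have [h [_ U]] := HT A 0; have [g _] := H1 A 0.
have -> : f = comp i g by rewrite -(U f) // -(U (comp i g)).
apply: la_isof_comp; first exact: la_isof_iso.
split; [exact: (isof_terminal C) | exact: (isof_terminal C) |].
exact: (gap_terminal H0 (lpF A)).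
Qed.

(** Horn filling is the lifting property of the isofibration from [B] to the terminal object, whose
    homs have one simplex in each dimension. *)
Lemma la_qcat (A B : La K) : quasi_category (hom A B).
Proof.
move=> n k kn u; have [T0 [F [L [_ HT]]]] := la_terminal_ex.
have [g _] := HT B 0.
have un m (s t : hom A (la_object F L) m) : s = t.
  by have [h [_ U]] := HT A m; rewrite -(U s) // -(U t).
have [H _] := la_isof_hom A (la_isof_terminal g HT).
have [t _] := HT A n.
have [|w [w1 _]] := H n k kn u (simplex_map t); first by move=> m a; apply: un.
by exists w => m a; apply: w1.
Qed.

Lemma la_isof_product (I : smallType) (A B : I -> La K) (f : forall i, arr (A i) (B i)) (P Q : La K)
    (pj : forall i, arr P (A i)) (qj : forall i, arr Q (B i)) (k : arr P Q) :
  is_product pj -> is_product qj ->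
  (forall i, comp (qj i) k = comp (f i) (pj i)) ->
  (forall i, la_isof (f i)) -> la_isof k.
Proof.
move=> HP HQ E F; have [tP bP] := la_product_pointwise HP; have [tQ bQ] := la_product_pointwise HQ.
have Et i : comp (tp (qj i)) (tp k) = comp (tp (f i)) (tp (pj i)) by rewrite -!tp_comp E.
have Eb i : comp (bt (qj i)) (bt k) = comp (bt (f i)) (bt (pj i)) by rewrite -!bt_comp E.
split.
- by apply: (isof_product C tP tQ Et) => i; case: (F i).
- by apply: (isof_product C bP bQ Eb) => i; case: (F i).
- apply: (gap_product (fun i => la_square0 (f i)) (fun i => la_square0 (pj i))
    (fun i => la_square0 (qj i)) Et Eb (fun i => lpF (B i)) _ tP bP tQ bQ) => i.
  by case: (F i).
Qed.

End La.

Theorem proposition4p3p17 (K : cosmos) : is_cosmos (@La_isofibration K).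
Proof.
have C := cosmosP K; split.
- exact: la_qcat.
- by have [T0 [F [L [_ HT]]]] := la_terminal_ex K; exists (la_object F L).
- move=> I A; have [P [pj [HE HB R]]] := la_product_ex A.
  by exists P, pj; apply: la_is_product.
- move=> A B D f g F; have [Q [q1 [q2 [H _ _ _]]]] := la_pullback_ex g F.
  by exists Q, q1, q2.
- move=> A p F; have [P [pj [H _]]] := la_chain_ex F; by exists P, pj.
- move=> X B; have [P [u [H _ _]]] := la_power_ex X B; by exists P, u.
- exact: la_isof_iso.
- exact: la_isof_terminal.
- exact: la_isof_comp.
- exact: la_isof_product.
(* The constructed cone has isofibrations as legs, and the given one differs from it by an
   isomorphism. *)
- move=> A B D f g Q q1 q2 F H; have [Q' [q1' [q2' [H' _ _ F']]]] := la_pullback_ex g F.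
  have [i [Hi _ <-]] := iso_pullback H' H.
  by apply: la_isof_comp F' _; apply: la_isof_iso.
- move=> A p L l F H k; have [P [pj [H' F']]] := la_chain_ex F.
  have [i [Hi <-]] := iso_chain H' H.
  by apply: la_isof_comp (F' k) _; apply: la_isof_iso.
- exact: la_leibniz.
- by move=> A B f F X; apply: la_isof_hom.
Qed.
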